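(* Let $G$ be a finite abelian group. The assignment $\mathsf{Stab}(\hat\Delta^{\mathcal W}_G):\mathbf{k}\mapsto\mathsf{Stab}(\hat\Delta^{\mathcal W}_G)(\mathbf{k})$ (from commutative $\mathbb{Q}$-algebras to groups) is an affine $\mathbb{Q}$-group scheme, and $\mathbf{Lie}(\mathsf{Stab}(\hat\Delta^{\mathcal W}_G))=\mathfrak{stab}(\hat\Delta^{\mathcal W}_G)$.
   Context: An affine $\mathbb{Q}$-group scheme is a functor $\mathsf{G}$ from commutative $\mathbb{Q}$-algebras to groups representable by a Hopf $\mathbb{Q}$-algebra; its Lie algebra is $\mathbf{Lie}(\mathsf{G})=\ker(\mathsf{G}(\mathbb{Q}[\epsilon]/(\epsilon^2))\to\mathsf{G}(\mathbb{Q}))$. Let $X=\{x_0\}\sqcup\{x_g\mid g\in G\}$ ($G$ written multiplicatively). For a commutative $\mathbb{Q}$-algebra $\mathbf{k}$, $\mathbf{k}\langle\langle X\rangle\rangle$ is the algebra of noncommutative formal power series in $X$ (complete graded, letters of degree 1); $(v|w)$ is the coefficient of the word $w$ in $v$. $\hat\Delta$ is the continuous algebra morphism $\mathbf{k}\langle\langle X\rangle\rangle\to\mathbf{k}\langle\langle X\rangle\rangle^{\hat\otimes 2}$ with $x_g\mapsto x_g\otimes1+1\otimes x_g$ for $g\in G\sqcup\{0\}$, and $\mathcal{G}(\mathbf{k}\langle\langle X\rangle\rangle)=\{\Psi\in\mathbf{k}\langle\langle X\rangle\rangle^\times\mid\hat\Delta(\Psi)=\Psi\otimes\Psi\}$.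 For $g\in G$, $t_g$ is the continuous algebra automorphism $x_0\mapsto x_0$, $x_h\mapsto x_{gh}$. $\mathrm{aut}_\Psi$ is the continuous algebra automorphism $x_0\mapsto x_0$, $x_g\mapsto t_g(\Psi^{-1})x_gt_g(\Psi)$; the group law is $\Psi\circledast\Phi:=\Psi\,\mathrm{aut}_\Psi(\Phi)$. $\Gamma_\Psi(x):=\exp\big(\sum_{n\ge2}\frac{(-1)^{n-1}}{n}(\Psi|x_0^{n-1}x_1)x^n\big)$, $x_1$ being $x_g$ with $g=1$. $\ell_a$ is left multiplication by $a$, $\mathrm{Ad}_u(a)=uau^{-1}$, $\mathrm{ad}_u(a)=ua-au$. $\hat{\mathcal V}_G=\hat{\mathcal V}_G^{\mathbf{k}}$ is the complete graded topological $\mathbf{k}$-algebra generated by $\{e_0,e_1\}\sqcup G$ ($e_0,e_1$ of degree 1, elements of $G$ of degree 0) with relations: the product of $g,h\in G$ is $gh$; $1=1_G$; $ge_0=e_0g$. $\hat{\mathcal W}_G:=\mathbf{k}\oplus\hat{\mathcal V}_Ge_1$ (a subalgebra); a superscript $\mathbb{Q}$ denotes the case $\mathbf{k}=\mathbb{Q}$. The crossed product $\mathbf{k}\langle\langle X\rangle\rangle\rtimes G$ is $\mathbf{k}\langle\langle X\rangle\rangle\otimes\mathbf{k}G$ with product $(a\otimes g)\ast(b\otimes h)=a\,t_g(b)\otimes gh$; $\beta:\mathbf{k}\langle\langle X\rangle\rangle\rtimes G\to\hat{\mathcal V}_G$ is the algebra isomorphism with $x_0\otimes1\mapsto e_0$,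 $x_g\otimes1\mapsto-ge_1g^{-1}$, $1\otimes g\mapsto g$. $\hat{\mathcal W}_G$ is topologically freely generated by $z_{n,g}:=-e_0^{n-1}ge_1$ ($(n,g)\in\mathbb{N}^*\times G$); $\hat\Delta^{\mathcal W}_G:\hat{\mathcal W}_G\to\hat{\mathcal W}_G^{\hat\otimes2}$ is the topological algebra morphism with $z_{n,g}\mapsto z_{n,g}\otimes1+1\otimes z_{n,g}+\sum_{k=1}^{n-1}\sum_{h\in G}z_{k,h}\otimes z_{n-k,gh^{-1}}$. Group: $\mathrm{aut}^{\mathcal V,(0)}_\Psi$ is the topological algebra automorphism of $\hat{\mathcal V}_G$ with $e_0\mapsto e_0$, $e_1\mapsto\beta(\Psi^{-1}\otimes1)e_1\beta(\Psi\otimes1)$, $g\mapsto g$; $\mathrm{aut}^{\mathcal V,(1)}_\Psi:=\mathrm{Ad}_{\beta(\Psi\otimes1)}\circ\mathrm{aut}^{\mathcal V,(0)}_\Psi$; ${}^\Gamma\mathrm{aut}^{\mathcal W,(1)}_\Psi$ is the restriction to $\hat{\mathcal W}_G$ of $\mathrm{Ad}_{\Gamma_\Psi^{-1}(-e_1)}\circ\mathrm{aut}^{\mathcal V,(1)}_\Psi$ (which preserves $\hat{\mathcal W}_G$). $\mathsf{Stab}(\hat\Delta^{\mathcal W}_G)(\mathbf{k})$ is the subgroup of $(\mathcal{G}(\mathbf{k}\langle\langle X\rangle\rangle),\circledast)$ of all $\Psi$ with $({}^\Gamma\mathrm{aut}^{\mathcal W,(1)}_\Psi)^{\otimes2}\circ\hat\Delta^{\mathcal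 W}_G=\hat\Delta^{\mathcal W}_G\circ{}^\Gamma\mathrm{aut}^{\mathcal W,(1)}_\Psi$. Lie algebra: $\widehat{\mathfrak{Lib}}(X)$ is the free complete graded $\mathbb{Q}$-Lie algebra on $X$, identified with $\{\psi\in\mathbb{Q}\langle\langle X\rangle\rangle\mid\hat\Delta(\psi)=\psi\otimes1+1\otimes\psi\}$. For $\psi\in\widehat{\mathfrak{Lib}}(X)$, $d_\psi$ is the continuous derivation of $\mathbb{Q}\langle\langle X\rangle\rangle$ with $x_0\mapsto0$, $x_g\mapsto[x_g,t_g(\psi)]$; $s_\psi:=\ell_\psi+d_\psi$; $\langle\psi_1,\psi_2\rangle:=s_{\psi_1}(\psi_2)-s_{\psi_2}(\psi_1)$ is a Lie bracket, and $\mathbf{Lie}(\mathbf{k}\mapsto(\mathcal{G}(\mathbf{k}\langle\langle X\rangle\rangle),\circledast))=(\widehat{\mathfrak{Lib}}(X),\langle\cdot,\cdot\rangle)$ via $1+\epsilon\psi\leftrightarrow\psi$; Lie algebras of subgroup schemes are viewed as Lie subalgebras of it. $\gamma_\psi(x):=\sum_{n\ge1}\frac{(-1)^{n+1}}{n}(\psi|x_0^{n-1}x_1)x^n$. $\mathrm{der}^{\mathcal V,(0)}_\psi$ is the continuous derivation of $\hat{\mathcal V}_G^{\mathbb{Q}}$ with $e_0\mapsto0$, $e_1\mapsto[e_1,\beta(\psi\otimes1)]$, $g\mapsto0$; $\mathrm{der}^{\mathcal V,(1)}_\psi:=\mathrm{ad}_{\beta(\psi\otimes1)}+\mathrm{der}^{\mathcal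 V,(0)}_\psi$; ${}^\gamma\mathrm{der}^{\mathcal W,(1)}_\psi$ is the restriction to $\hat{\mathcal W}_G^{\mathbb{Q}}$ of $\mathrm{ad}_{-\gamma_\psi(-e_1)}+\mathrm{der}^{\mathcal V,(1)}_\psi$ (which preserves $\hat{\mathcal W}^{\mathbb{Q}}_G$). $\mathfrak{stab}(\hat\Delta^{\mathcal W}_G)$ is the Lie subalgebra of all $\psi\in\widehat{\mathfrak{Lib}}(X)$ with $({}^\gamma\mathrm{der}^{\mathcal W,(1)}_\psi\otimes\mathrm{id}+\mathrm{id}\otimes{}^\gamma\mathrm{der}^{\mathcal W,(1)}_\psi)\circ\hat\Delta^{\mathcal W}_G=\hat\Delta^{\mathcal W}_G\circ{}^\gamma\mathrm{der}^{\mathcal W,(1)}_\psi$. *)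

(* Defs.v *)
From HB Require Import structures.
From mathcomp Require Import all_boot all_order all_algebra all_fingroup.
From mathcomp Require Import boolp classical_sets zify.

Set Implicit Arguments.
Unset Strict Implicit.
Unset Printing Implicit Defensive.

Import GRing.Theory.
Local Open Scope classical_set_scope.
Local Open Scope ring_scope.

(* A commutative Q-algebra, as a commutative ring under Q; the library's
   [comAlgType rat] would exclude the zero algebra. *)
Record qalg := QAlg {
  qalg_ring :> comPzRingType;
  qalg_in : {rmorphism rat -> qalg_ring}
}.

Definition qscale (k : qalg) (c : rat) (x : k) : k := qalg_in k c * x.

Record qalg_hom (k k' : qalg) := QAlgHom {
  qalg_hom_fun :> {rmorphism k -> k'};
  qalg_homE : forall c : rat, qalg_hom_fun (qalg_in k c) = qalg_in k' c
}.

Definition qalg_of (A : comAlgType rat) : qalg := QAlg (GRing.in_alg A).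

(* A formal sum \sum_i a_i (x) b_i in A (x) A is given by the sequence of the
   pairs (a_i, b_i); two such sequences define the same tensor iff every
   bilinear map takes the same value on both. *)
Definition tensor_eq (A : lmodType rat) (s t : seq (A * A)) : Prop :=
  forall (V : lmodType rat) (b : A -> A -> V),
    (forall x, linear (b x)) -> (forall y, linear (b^~ y)) ->
  \sum_(p <- s) b p.1 p.2 = \sum_(p <- t) b p.1 p.2.

Definition tensor3_eq (A : lmodType rat) (s t : seq (A * A * A)) : Prop :=
  forall (V : lmodType rat) (b : A -> A -> A -> V),
    (forall x y, linear (b x y)) -> (forall x z, linear (b x ^~ z)) ->
    (forall y z, linear (fun x => b x y z)) ->
  \sum_(p <- s) b p.1.1 p.1.2 p.2 = \sum_(p <- t) b p.1.1 p.1.2 p.2.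

Record hopf_structure (A : comAlgType rat) := HopfStructure {
  comul : A -> seq (A * A);
  counit : {lrmorphism A -> rat^o};
  antipode : {linear A -> A};
  comul_linear : forall (c : rat) x y, tensor_eq (comul (c *: x + y))
    ([seq (c *: p.1, p.2) | p <- comul x] ++ comul y);
  comul1 : tensor_eq (comul 1) [:: (1, 1)];
  comulM : forall x y, tensor_eq (comul (x * y))
    [seq (p.1 * q.1, p.2 * q.2) | p <- comul x, q <- comul y];
  comulA : forall x, tensor3_eq
    [seq (q.1, q.2, p.2) | p <- comul x, q <- comul p.1]
    [seq (p.1, q.1, q.2) | p <- comul x, q <- comul p.2];
  counitl : forall x, \sum_(p <- comul x) (counit p.1 : rat) *: p.2 = x;
  counitr : forall x, \sum_(p <- comul x) (counit p.2 : rat) *: p.1 = x;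
  antipodel : forall x,
    \sum_(p <- comul x) antipode p.1 * p.2 = (counit x : rat) *: 1;
  antipoder : forall x,
    \sum_(p <- comul x) p.1 * antipode p.2 = (counit x : rat) *: 1
}.

Definition is_group_on (T : Type) (S : set T) (mul : T -> T -> T) (e : T) :
    Prop :=
  [/\ S e,
      forall x y, S x -> S y -> S (mul x y),
      forall x y z, S x -> S y -> S z -> mul x (mul y z) = mul (mul x y) z,
      forall x, S x -> mul e x = x /\ mul x e = x
    & forall x, S x -> exists y, [/\ S y, mul x y = e & mul y x = e]].

Section GroupSchemes.

(* The group of k-points is the subset [F k] of [U k] with the law [mul k]. *)
Variable U : qalg -> Type.
Variable Umap : forall k k' : qalg, qalg_hom k k' -> U k -> U k'.
Variable F : forall k : qalg, set (U k).
Variable mul : forall k : qalg, U k -> U k -> U k.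
Variable one : forall k : qalg, U k.

Definition is_group_functor : Prop :=
  [/\ forall k, is_group_on (@F k) (@mul k) (one k),
      forall k k' (f : qalg_hom k k') x, F x -> F (Umap f x),
      forall k k' (f : qalg_hom k k') x y, F x -> F y ->
        Umap f (mul x y) = mul (Umap f x) (Umap f y),
      forall k (f : qalg_hom k k) x, f =1 id -> F x -> Umap f x = x
    & forall k1 k2 k3 (f : qalg_hom k1 k2) (g : qalg_hom k2 k3)
             (h : qalg_hom k1 k3) x,
        h =1 g \o f -> F x -> Umap h x = Umap g (Umap f x)].

(* [phi] is a natural isomorphism of groups Hom(A, k) -> F k, the product of
   f and g in Hom(A, k) being the convolution x |-> \sum f(x_(1)) g(x_(2)). *)
Definition represented_by (A : comAlgType rat) (H : hopf_structure A) :
    Prop :=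
  exists phi : forall k : qalg, qalg_hom (qalg_of A) k -> U k,
  [/\ forall k (f : qalg_hom (qalg_of A) k), F (phi k f),
      forall k (f g : qalg_hom (qalg_of A) k), phi k f = phi k g -> f =1 g,
      forall k (x : U k), F x -> exists f, phi k f = x,
      forall k k' (u : qalg_hom k k') (f : qalg_hom (qalg_of A) k)
             (g : qalg_hom (qalg_of A) k'),
        g =1 u \o f -> phi k' g = Umap u (phi k f)
    & forall k (f g h : qalg_hom (qalg_of A) k),
        (forall x, h x = \sum_(p <- comul H x) f p.1 * g p.2) ->
        phi k h = mul (phi k f) (phi k g)].

Definition affine_group_scheme : Prop :=
  is_group_functor /\
  exists (A : comAlgType rat) (H : hopf_structure A), represented_by H.

End GroupSchemes.

HB.mixin Record Monoid_isGraded M of Monoid M := {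
  gdeg : M -> nat;
  gpiece : nat -> seq M;
  gdegM : forall x y : M, gdeg (x * y)%g = (gdeg x + gdeg y)%N;
  gpiece_uniq : forall d, uniq (gpiece d);
  mem_gpiece : forall d x, (x \in gpiece d) = (gdeg x == d)
}.

#[short(type="gradedMonoidType")]
HB.structure Definition GradedMonoid := {M of Monoid M & Monoid_isGraded M}.

Section GradedMonoidTheory.
Variable M : gradedMonoidType.

Definition gelems (d : nat) : seq M :=
  flatten [seq gpiece i | i <- iota 0 d.+1].

Lemma mem_gelems d (x : M) : (x \in gelems d) = (gdeg x <= d)%N.
Proof.
apply/flatten_mapP/idP => [[i]|le_d]; first by rewrite mem_iota mem_gpiece
  => /andP[_ lt_id] /eqP->.
by exists (gdeg x); rewrite ?mem_iota ?mem_gpiece.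
Qed.

Lemma gelems_uniq d : uniq (gelems d).
Proof.
rewrite /gelems; elim: {d}d.+1 0%N => //= n IHn m.
rewrite cat_uniq gpiece_uniq IHn andbT /=; apply/hasPn => x.
move=> /flatten_mapP[i]; rewrite mem_iota !mem_gpiece => /andP[lt_mi _] /eqP->.
by rewrite gtn_eqF.
Qed.

Definition gfactors (m : M) : seq (M * M) :=
  [seq p <- [seq (x, y) | x <- gelems (gdeg m), y <- gelems (gdeg m)]
     | (p.1 * p.2)%g == m].

Lemma mem_gfactors (m : M) p : (p \in gfactors m) = ((p.1 * p.2)%g == m).
Proof.
rewrite mem_filter andb_idr // => /eqP <-; apply/allpairsP.
by exists p; rewrite !mem_gelems gdegM leq_addr leq_addl; case: p.
Qed.

Lemma gfactors_uniq (m : M) : uniq (gfactors m).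
Proof.
by apply: filter_uniq; apply: allpairs_uniq;
  rewrite ?gelems_uniq // => -[x y] [].
Qed.

End GradedMonoidTheory.

(* The formal series \sum_m a_m m over M with coefficients in k, i.e. the
   completion of the monoid algebra k[M] for the degree of M. *)
Record series (M : gradedMonoidType) (k : Type) := Series {
  coef :> M -> k
}.

Lemma seriesP (M : gradedMonoidType) (k : Type) (a b : series M k) :
  a = b <-> a =1 b.
Proof. by split=> [-> //|]; case: a b => [a] [b] /= /funext->. Qed.

HB.instance Definition _ M k := gen_eqMixin (series M k).
HB.instance Definition _ M k := gen_choiceMixin (series M k).

Section SeriesRing.
Variables (M : gradedMonoidType) (k : comPzRingType).
Implicit Types a b c : series M k.

Definition sadd a b : series M k := Series (fun m => a m + b m).
Definition szero : series M k := Series (fun=> 0).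
Definition sopp a : series M k := Series (fun m => - a m).
Definition sscale (x : k) a : series M k := Series (fun m => x * a m).
Definition mono (m : M) : series M k := Series (fun n => (n == m)%:R).
Definition smul a b : series M k :=
  Series (fun m => \sum_(p <- gfactors m) a p.1 * b p.2).

Fact saddA : associative sadd.
Proof. by move=> a b c; apply/seriesP => m /=; rewrite addrA. Qed.
Fact saddC : commutative sadd.
Proof. by move=> a b; apply/seriesP => m /=; rewrite addrC. Qed.
Fact sadd0 : left_id szero sadd.
Proof. by move=> a; apply/seriesP => m /=; rewrite add0r. Qed.
Fact saddN : left_inverse szero sopp sadd.
Proof. by move=> a; apply/seriesP => m /=; rewrite addNr. Qed.

HB.instance Definition _ :=
  GRing.isZmodule.Build (series M k) saddA saddC sadd0 saddN.

Fact sscaleA x y a : sscale x (sscale y a) = sscale (x * y) a.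
Proof. by apply/seriesP => m /=; rewrite mulrA. Qed.
Fact sscale1 : left_id 1 sscale.
Proof. by move=> a; apply/seriesP => m /=; rewrite mul1r. Qed.
Fact sscaleDr : right_distributive sscale +%R.
Proof. by move=> x a b; apply/seriesP => m /=; rewrite mulrDr. Qed.
Fact sscaleDl a : {morph sscale^~ a : x y / x + y}.
Proof. by move=> x y; apply/seriesP => m /=; rewrite mulrDl. Qed.

HB.instance Definition _ := GRing.Zmodule_isLmodule.Build k (series M k)
  sscaleA sscale1 sscaleDr sscaleDl.

Fact smulA : associative smul.
Proof.
move=> a b c; apply/seriesP => m /=.
under eq_bigr do rewrite big_distrr /=.
under [RHS]eq_bigr do rewrite big_distrl /=.
pose G (t : M * M * M) := a t.1.1 * b t.1.2 * c t.2.
transitivity (\sum_(t <- [seq (p.1, q.1, q.2) | p <- gfactors m,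
                                                q <- gfactors p.2]) G t).
  rewrite big_allpairs_dep /=; apply: eq_bigr => p _.
  by apply: eq_bigr => q _; rewrite /G /= mulrA.
transitivity (\sum_(t <- [seq (q.1, q.2, p.2) | p <- gfactors m,
                                                q <- gfactors p.1]) G t);
  last by rewrite big_allpairs_dep.
apply/perm_big/uniq_perm; rewrite ?allpairs_uniq_dep ?gfactors_uniq //.
- by move=> p _; rewrite gfactors_uniq.
- move=> _ _ /allpairsPdep[p [q [Hp Hq ->]]]
    /allpairsPdep[p' [q' [Hp' Hq' ->]]].
  case: p q p' q' Hp Hq Hp' Hq' => [p1 p2] [q1 q2] [p1' p2'] [q1' q2'] /=.
  by rewrite !mem_gfactors /= => _ /eqP<- _ /eqP<- [-> -> ->].
- by move=> p _; rewrite gfactors_uniq.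
- move=> _ _ /allpairsPdep[p [q [Hp Hq ->]]]
    /allpairsPdep[p' [q' [Hp' Hq' ->]]].
  case: p q p' q' Hp Hq Hp' Hq' => [p1 p2] [q1 q2] [p1' p2'] [q1' q2'] /=.
  by rewrite !mem_gfactors /= => _ /eqP<- _ /eqP<- [-> -> ->].
case=> [[x y] z]; apply/allpairsPdep/allpairsPdep => -[p [q []]];
  rewrite !mem_gfactors => /eqP Hp /eqP Hq [-> -> ->].
- exists ((p.1 * q.1)%g, q.2), (p.1, q.1); rewrite !mem_gfactors /=.
  by rewrite -mulgA Hq Hp !eqxx.
- exists (q.1, (q.2 * p.2)%g), (q.2, p.2); rewrite !mem_gfactors /=.
  by rewrite mulgA Hq Hp !eqxx.
Qed.

Fact smul1l : left_id (mono 1%g) smul.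
Proof.
move=> a; apply/seriesP => m /=.
have m_in : (1%g, m) \in gfactors m by rewrite mem_gfactors /= mul1g.
rewrite (bigD1_seq _ m_in) ?gfactors_uniq //= eqxx mul1r big_seq_cond big1.
  by rewrite addr0.
case=> x y /=; rewrite mem_gfactors /= => /andP[/eqP<- ne].
by case: (eqVneq x 1%g) ne => [->|_ _]; rewrite ?mul0r // mul1g eqxx.
Qed.

Fact smul1r : right_id (mono 1%g) smul.
Proof.
move=> a; apply/seriesP => m /=.
have m_in : (m, 1%g) \in gfactors m by rewrite mem_gfactors /= mulg1.
rewrite (bigD1_seq _ m_in) ?gfactors_uniq //= eqxx mulr1 big_seq_cond big1.
  by rewrite addr0.
case=> x y /=; rewrite mem_gfactors /= => /andP[/eqP<- ne].
by case: (eqVneq y 1%g) ne => [->|_ _]; rewrite ?mulr0 // mulg1 eqxx.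
Qed.

Fact smulDl : left_distributive smul sadd.
Proof.
move=> a b c; apply/seriesP => m /=; rewrite -big_split /=.
by apply: eq_bigr => p _; rewrite mulrDl.
Qed.

Fact smulDr : right_distributive smul sadd.
Proof.
move=> a b c; apply/seriesP => m /=; rewrite -big_split /=.
by apply: eq_bigr => p _; rewrite mulrDr.
Qed.

HB.instance Definition _ := GRing.Zmodule_isPzRing.Build (series M k)
  smulA smul1l smul1r smulDl smulDr.

Definition sinvertible a : Prop := exists b, a * b = 1 /\ b * a = 1.

(* The two-sided inverse, when there is one. *)
Definition sinv a : series M k := xget 0 [set b | a * b = 1 /\ b * a = 1].

Definition sAd u a : series M k := u * a * sinv u.
Definition sad u a : series M k := u * a - a * u.

End SeriesRing.

Arguments mono {M k} m.

Section Maps.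
Variables (M N : gradedMonoidType) (k : comPzRingType).

(* The continuous linear map with m |-> tau m; meaningful when every tau m is
   a series of terms of degree at least [gdeg m]. *)
Definition cont_ext (tau : M -> series N k) (a : series M k) : series N k :=
  Series (fun n => \sum_(m <- gelems M (gdeg n)) a m * tau m n).

Definition smap (k' : Type) (f : k -> k') (a : series M k) : series M k' :=
  Series (fun m => f (a m)).

End Maps.

Section MapsTheory.
Variables (M N : gradedMonoidType) (k : comPzRingType).
Variable tau : M -> series N k.
Hypothesis tau_deg : forall m n, (gdeg n < gdeg m)%N -> tau m n = 0.
Implicit Types a b : series M k.

Lemma cont_ext_mono m : cont_ext tau (mono m) = tau m.
Proof.
apply/seriesP => n /=; have [le_mn|lt_nm] := leqP (gdeg m) (gdeg n).
  rewrite (bigD1_seq m) ?mem_gelems ?gelems_uniq //= eqxx mul1r big1 ?addr0 //.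
  by move=> m' /negPf->; rewrite mul0r.
rewrite tau_deg // big_seq big1 // => m'; rewrite mem_gelems => le_m'n.
by case: eqP le_m'n => [->|_ _]; rewrite ?mul0r // leqNgt lt_nm.
Qed.

Lemma cont_extE a n d : (gdeg n <= d)%N ->
  cont_ext tau a n = \sum_(m <- gelems M d) a m * tau m n.
Proof.
move=> le_nd /=; rewrite [RHS](bigID (fun m => gdeg m <= gdeg n)%N) /=.
rewrite [X in _ + X]big1 ?addr0 => [|m]; last first.
  by rewrite -ltnNge => lt_nm; rewrite tau_deg ?mulr0.
rewrite -[RHS]big_filter; apply/perm_big/uniq_perm;
  rewrite ?filter_uniq ?gelems_uniq // => m.
by rewrite mem_filter !mem_gelems andb_idr // => /leq_trans->.
Qed.

Lemma cont_extM a b :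
    (forall m n, a m != 0 -> b n != 0 -> tau (m * n)%g = tau m * tau n) ->
  cont_ext tau (a * b) = cont_ext tau a * cont_ext tau b.
Proof.
move=> tauM; apply/seriesP => n.
pose E := [seq (x, y) | x <- gelems M (gdeg n), y <- gelems M (gdeg n)].
pose G (p : M * M) := a p.1 * b p.2 * tau (p.1 * p.2)%g n.
transitivity (\sum_(p <- E) G p); last first.
  transitivity (\sum_(q <- gfactors n) \sum_(p <- E)
      (a p.1 * tau p.1 q.1) * (b p.2 * tau p.2 q.2)); last first.
    rewrite -[RHS]/(\sum_(q <- gfactors n)
                      cont_ext tau a q.1 * cont_ext tau b q.2).
    apply: eq_big_seq => q; rewrite mem_gfactors => /eqP nE.
    rewrite !(@cont_extE _ _ (gdeg n)) -?nE ?gdegM ?leq_addl ?leq_addr //.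
    rewrite -!gdegM nE big_allpairs_dep /= big_distrl /=.
    by apply: eq_bigr => x _; rewrite big_distrr.
  rewrite exchange_big /=; apply: eq_bigr => -[x y] _; rewrite /G /=.
  have [->|a0] := eqVneq (a x) 0.
    by rewrite !mul0r big1 // => q _; rewrite !mul0r.
  have [->|b0] := eqVneq (b y) 0.
    by rewrite mulr0 mul0r big1 // => q _; rewrite mul0r mulr0.
  rewrite tauM // /= big_distrr /=; apply: eq_bigr => q _.
  by rewrite mulrACA.
rewrite /=; under eq_bigr do rewrite big_distrl /=.
transitivity (\sum_(p <- [seq p <- E | (gdeg (p.1 * p.2)%g <= gdeg n)%N]) G p).
  transitivity (\sum_(t <- [seq (m, p) | m <- gelems M (gdeg n),
                               p <- gfactors m]) G t.2).
    rewrite big_allpairs_dep /=; apply: eq_bigr => m _.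
    by apply: eq_big_seq => p; rewrite mem_gfactors /G => /eqP->.
  rewrite -(big_map snd xpredT G); apply/perm_big/uniq_perm.
  - rewrite map_inj_in_uniq.
      apply: allpairs_uniq_dep; rewrite ?gelems_uniq //.
        by move=> m _; rewrite gfactors_uniq.
      by move=> [m p] [m' p'] _ _ [-> ->].
    move=> _ _ /allpairsPdep[m [p [_ Hp ->]]] /allpairsPdep[m' [p' [_ Hp' ->]]].
    by move: Hp Hp'; rewrite !mem_gfactors /= => /eqP<- /eqP<- ->.
  - by rewrite filter_uniq // allpairs_uniq ?gelems_uniq // => -[x y] [].
  move=> p; rewrite mem_filter; apply/mapP/andP => [[_ /allpairsPdep
      [m [q [Hm Hq ->]]] ->]|[Hp Ep]].
    move: Hm Hq; rewrite mem_gelems mem_gfactors /= => Hm /eqP Hq.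
    rewrite Hq; split=> //; apply/allpairsP; exists q.
    move: Hm; rewrite -Hq gdegM => Hm; rewrite !mem_gelems.
    rewrite (leq_trans (leq_addr _ _) Hm) (leq_trans (leq_addl _ _) Hm).
    by case: (q).
  exists ((p.1 * p.2)%g, p) => //; apply/allpairsPdep.
  by exists (p.1 * p.2)%g, p; rewrite mem_gelems Hp mem_gfactors eqxx.
rewrite big_filter big_mkcond /=; apply: eq_bigr => p _.
by case: leqP => // lt; rewrite /G tau_deg // mulr0.
Qed.

End MapsTheory.

Section Order.
Variables (k : comPzRingType).

(* all the terms of a have degree at least d *)
Definition has_order (M : gradedMonoidType) (d : nat) (a : series M k) : Prop :=
  forall m, (gdeg m < d)%N -> a m = 0.

Lemma gdeg1 (M : gradedMonoidType) : gdeg (1%g : M) = 0%N.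
Proof.
by apply/eqP; rewrite -(eqn_add2l (gdeg (1%g : M))) -gdegM mulg1 addn0.
Qed.

Lemma monoM (M : gradedMonoidType) (m n : M) :
  mono m * mono n = mono (m * n)%g :> series M k.
Proof.
apply/seriesP => x; rewrite /GRing.mul /=.
have [->|ne] := eqVneq x (m * n)%g.
  rewrite (bigD1_seq (m, n)) ?gfactors_uniq ?mem_gfactors //= !eqxx mulr1.
  rewrite big1 ?addr0 // => -[y z]; rewrite xpair_eqE /=.
  by case: eqP => _ /=; rewrite ?mul0r // mul1r => /negPf->.
rewrite big_seq big1 // => -[y z]; rewrite mem_gfactors /= => /eqP xE.
case: eqVneq => [yE|]; rewrite ?mul0r // mul1r.
by case: eqVneq => // zE; case/eqP: ne; rewrite -xE yE zE.
Qed.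

Lemma has_orderM (M : gradedMonoidType) d e (a b : series M k) :
  has_order d a -> has_order e b -> has_order (d + e) (a * b).
Proof.
move=> oa ob m lt_m; rewrite /GRing.mul /= big_seq big1 // => p.
rewrite mem_gfactors => /eqP mE; move: lt_m; rewrite -mE gdegM.
have [lt1|le1] := ltnP (gdeg p.1) d; first by rewrite oa ?mul0r.
have [lt2|le2] := ltnP (gdeg p.2) e; first by rewrite ob ?mulr0.
by rewrite ltnNge leq_add.
Qed.

Lemma has_order0 (M : gradedMonoidType) (a : series M k) : has_order 0 a.
Proof. by []. Qed.

Lemma has_orderD (M : gradedMonoidType) d (a b : series M k) :
  has_order d a -> has_order d b -> has_order d (a + b).
Proof. by move=> oa ob m lt; rewrite /GRing.add /= oa ?ob ?addr0. Qed.

Lemma has_orderN (M : gradedMonoidType) d (a : series M k) :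
  has_order d a -> has_order d (- a).
Proof. by move=> oa m lt; rewrite /GRing.opp /= oa ?oppr0. Qed.

Lemma has_order_mono (M : gradedMonoidType) (m : M) :
  has_order (gdeg m) (mono m : series M k).
Proof. by move=> n; rewrite /=; case: eqP => [->|//]; rewrite ltnn. Qed.

Lemma has_order_prod (M : gradedMonoidType) I (r : seq I) (d : I -> nat)
    (a : I -> series M k) :
  (forall i, has_order (d i) (a i)) ->
  has_order (\sum_(i <- r) d i) (\prod_(i <- r) a i).
Proof.
move=> oa; elim: r => [|i r IH]; first by rewrite big_nil.
by rewrite !big_cons; apply: has_orderM.
Qed.

End Order.

Definition word (X : finType) := seq X.

Section Words.
Variable X : finType.

HB.instance Definition _ := Choice.copy (word X) (seq X).
HB.instance Definition _ :=
  isMonoid.Build (word X) (@catA X) (@cat0s X) (@cats0 X).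

Definition wpiece (d : nat) : seq (word X) :=
  [seq (val t : word X) | t : d.-tuple X].

Fact wpiece_uniq d : uniq (wpiece d).
Proof. by rewrite map_inj_uniq ?enum_uniq //; apply: val_inj. Qed.

Fact mem_wpiece d (u : word X) : (u \in wpiece d) = (size u == d).
Proof.
apply/mapP/idP => [[t _ ->]|Hu]; first by rewrite size_tuple.
by exists (Tuple Hu); rewrite ?mem_enum.
Qed.

HB.instance Definition _ := Monoid_isGraded.Build (word X)
  (@size_cat X) wpiece_uniq mem_wpiece.

Definition letter (x : X) : word X := [:: x].

End Words.

Section WordMaps.
Variables (X : finType) (N : gradedMonoidType) (k : comPzRingType).

(* The continuous algebra morphism k<<X>> -> k[[N]] with x |-> sigma x (a series
   without terms of degree 0). *)
Definition alg_ext (sigma : X -> series N k) :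
    series (word X) k -> series N k :=
  cont_ext (fun u : word X => \prod_(x <- u) sigma x).

(* \sum_i sigma x_1 ... sigma x_(i-1) (delta x_i) sigma x_(i+1) ... sigma x_n *)
Fixpoint word_der (sigma delta : X -> series N k) (u : seq X) : series N k :=
  if u is x :: v then
    delta x * (\prod_(y <- v) sigma y) + sigma x * word_der sigma delta v
  else 0.

End WordMaps.

Section AlgExt.
Variables (X : finType) (N : gradedMonoidType) (k : comPzRingType).
Variable sigma : X -> series N k.
Hypothesis o_sigma : forall x, has_order 1 (sigma x).

Lemma alg_ext_tau (m : word X) : has_order (gdeg m) (\prod_(x <- m) sigma x).
Proof.
by have := has_order_prod (r := m) (d := fun=> 1%N) o_sigma; rewrite sum1_size.
Qed.

Lemma alg_ext_letter x : alg_ext sigma (mono (letter x)) = sigma x.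
Proof.
rewrite /alg_ext cont_ext_mono; last by move=> m n; apply: alg_ext_tau.
by rewrite big_seq1.
Qed.

Lemma alg_ext1 : alg_ext sigma 1 = 1.
Proof.
rewrite /alg_ext cont_ext_mono; last by move=> m n; apply: alg_ext_tau.
by rewrite big_nil.
Qed.

Lemma alg_extM a b : alg_ext sigma (a * b) = alg_ext sigma a * alg_ext sigma b.
Proof.
rewrite /alg_ext cont_extM //; first by move=> m n; apply: alg_ext_tau.
by move=> m n _ _; rewrite big_cat.
Qed.

End AlgExt.

Section Pairs.
Variables M N : gradedMonoidType.

Definition pdeg (p : M * N) : nat := (gdeg p.1 + gdeg p.2)%N.
Definition ppiece (d : nat) : seq (M * N) :=
  [seq p <- [seq (x, y) | x <- gelems M d, y <- gelems N d] | pdeg p == d].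

Fact pdegM (p q : M * N) : pdeg (p * q)%g = (pdeg p + pdeg q)%N.
Proof. by rewrite /pdeg !gdegM addnACA. Qed.

Fact ppiece_uniq d : uniq (ppiece d).
Proof.
by apply: filter_uniq; apply: allpairs_uniq;
  rewrite ?gelems_uniq // => -[x y] [].
Qed.

Fact mem_ppiece d (p : M * N) : (p \in ppiece d) = (pdeg p == d).
Proof.
rewrite mem_filter andb_idr // => /eqP <-; apply/allpairsP.
by exists p; rewrite !mem_gelems leq_addr leq_addl; case: p.
Qed.

HB.instance Definition _ := Monoid_isGraded.Build (M * N)%type
  pdegM ppiece_uniq mem_ppiece.

End Pairs.

(* k[[M]] (x)^ k[[N]] is k[[M * N]]. *)
Definition tens (M N : gradedMonoidType) (k : comPzRingType)
    (a : series M k) (b : series N k) : series (M * N)%type k :=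
  Series (fun p => a p.1 * b p.2).

Lemma has_order_tens (M N : gradedMonoidType) (k : comPzRingType) d e
    (a : series M k) (b : series N k) :
  has_order d a -> has_order e b -> has_order (d + e) (tens a b).
Proof.
move=> oa ob [m n] lt_m /=; move: lt_m; rewrite /gdeg /= /pdeg /=.
have [lt1|le1] := ltnP (gdeg m) d; first by rewrite oa ?mul0r.
have [lt2|le2] := ltnP (gdeg n) e; first by rewrite ob ?mulr0.
by rewrite ltnNge leq_add.
Qed.

(* f (x) g, for continuous linear f and g that do not lower degrees *)
Definition tens_map (M N : gradedMonoidType) (k : comPzRingType)
    (f : series M k -> series M k) (g : series N k -> series N k) :
    series (M * N)%type k -> series (M * N)%type k :=
  cont_ext (fun p : M * N => tens (f (mono p.1)) (g (mono p.2))).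

Notation pseries k := (series (word unit) k).

Definition mkps (k : Type) (c : nat -> k) : pseries k :=
  Series (fun w : word unit => c (size w)).

(* f(v), for v without terms of degree 0 *)
Definition ps_eval (N : gradedMonoidType) (k : comPzRingType)
    (f : pseries k) (v : series N k) : series N k :=
  alg_ext (fun=> v) f.

Definition ps_exp (k : qalg) (f : pseries k) : pseries k :=
  Series (fun w : word unit =>
    \sum_(n < (gdeg w).+1) qscale n`!%:R^-1 ((f ^+ n) w)).

(* [None] is x_0 and [Some g] is x_g. *)
Notation wordX gT := (word (option gT)).

Section NCSeries.
Variables (gT : finGroupType) (k : comPzRingType).
Local Notation kX := (series (wordX gT) k).
Implicit Types Psi Phi : kX.

Definition xvar (x : option gT) : kX := mono (letter x).

Definition coprod : kX -> series (wordX gT * wordX gT)%type k :=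
  alg_ext (fun x => tens (xvar x) 1 + tens 1 (xvar x)).

Definition grouplike : set kX :=
  [set Psi | sinvertible Psi /\ coprod Psi = tens Psi Psi].

Definition primitive : set kX :=
  [set psi | coprod psi = tens psi 1 + tens 1 psi].

Definition tshift (g : gT) : kX -> kX :=
  alg_ext (fun x => xvar (omap (fun h => (g * h)%g) x)).

Definition autX Psi : kX -> kX :=
  alg_ext (fun x => if x is Some g
                    then tshift g (sinv Psi) * xvar x * tshift g Psi
                    else xvar x).

Definition circast Psi Phi : kX := Psi * autX Psi Phi.

(* the coefficient (v | x_0^n x_1) *)
Definition coef_x0x1 (v : kX) (n : nat) : k :=
  v (nseq n None ++ [:: Some 1%g]).

Definition derX (psi : kX) : kX -> kX :=
  cont_ext (fun u : wordX gT => word_der xvar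
    (fun x => if x is Some g then sad (xvar x) (tshift g psi) else 0) u).

Definition s_op (psi a : kX) : kX := psi * a + derX psi a.

Definition lie_bracket (psi1 psi2 : kX) : kX :=
  s_op psi1 psi2 - s_op psi2 psi1.

End NCSeries.

Definition Gam (gT : finGroupType) (k : qalg)
    (Psi : series (wordX gT) k) : pseries k :=
  ps_exp (mkps (fun n => if (2 <= n)%N
    then qscale ((-1) ^+ n.-1 / n%:R) (coef_x0x1 Psi n.-1) else 0)).

Definition gam (gT : finGroupType) (k : qalg)
    (psi : series (wordX gT) k) : pseries k :=
  mkps (fun n => if (1 <= n)%N
    then qscale ((-1) ^+ n.+1 / n%:R) (coef_x0x1 psi n.-1) else 0).

(* All the relations of V_G equate monomials, so V_G is the algebra of the
   monoid generated by e_0, e_1 and G with these relations. Its elements have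
   the unique normal form u g with u a word in e_0 and the h e_1, and g in G:
   the pair (u, g), where [None] stands for e_0 and [Some h] for h e_1 (see
   [vmon_presentation] below). *)
Record vmon (gT : finGroupType) := VMon {
  vword : wordX gT;
  vgrp : gT
}.

Section VMonoid.
Variable gT : finGroupType.
Implicit Types (u v : wordX gT) (m : vmon gT).

Definition vmon_pair m := (vword m, vgrp m).
Definition pair_vmon (p : wordX gT * gT) := VMon p.1 p.2.
Fact vmon_pairK : cancel vmon_pair pair_vmon. Proof. by case. Qed.
HB.instance Definition _ := Choice.copy (vmon gT) (can_type vmon_pairK).

(* g u = (vpush g u) (vcarry g u), as g commutes with e_0 *)
Fixpoint vpush (g : gT) u : wordX gT :=
  match u with
  | [::] => [::]
  | None :: v => None :: vpush g v
  | Some h :: v => Some (g * h)%g :: v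
  end.

Definition vcarry (g : gT) u : gT := if has isSome u then 1%g else g.

Definition vone : vmon gT := VMon [::] 1%g.
Definition vmul m n : vmon gT :=
  VMon (vword m ++ vpush (vgrp m) (vword n))
       (vcarry (vgrp m) (vword n) * vgrp n)%g.

Lemma has_vpush g u : has isSome (vpush g u) = has isSome u.
Proof. by elim: u => [|[h|] u IHu]. Qed.

Lemma size_vpush g u : size (vpush g u) = size u.
Proof. by elim: u => [|[h|] u IHu] //=; rewrite IHu. Qed.

Lemma vpush1 u : vpush 1 u = u.
Proof. by elim: u => [|[h|] u IHu] //=; rewrite ?mul1g ?IHu. Qed.

Lemma vpush_cat g u v : vpush g (u ++ v) = vpush g u ++ vpush (vcarry g u) v.
Proof.
by elim: u => [|[h|] u IHu] //=; rewrite ?vpush1 ?IHu.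
Qed.

Lemma vpushM g h u : vpush (g * h) u = vpush g (vpush h u).
Proof. by elim: u => [|[h'|] u IHu] //=; rewrite ?mulgA ?IHu. Qed.

Fact vmulA : associative vmul.
Proof.
move=> [u f] [v g] [w h]; rewrite /vmul /=; congr VMon.
  rewrite vpush_cat catA; congr (_ ++ _); rewrite -vpushM; congr vpush.
rewrite /vcarry has_cat has_vpush mulgA.
by case: (has _ v); case: (has _ w); rewrite /= ?mul1g ?mulgA.
Qed.

Fact vmul1l : left_id vone vmul.
Proof.
by move=> [u g]; rewrite /vmul /= vpush1 /vcarry if_same mul1g.
Qed.

Fact vmul1r : right_id vone vmul.
Proof. by move=> [u g]; rewrite /vmul /= cats0 /vcarry /= mulg1. Qed.

HB.instance Definition _ := isMonoid.Build (vmon gT) vmulA vmul1l vmul1r.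

Definition vdeg m : nat := size (vword m).
Definition vpiece (d : nat) : seq (vmon gT) :=
  [seq VMon u g | u <- wpiece (option gT) d, g <- enum gT].

Fact vdegM m n : vdeg (m * n)%g = (vdeg m + vdeg n)%N.
Proof. by rewrite /vdeg /= size_cat size_vpush. Qed.

Fact vpiece_uniq d : uniq (vpiece d).
Proof.
apply: allpairs_uniq; rewrite ?wpiece_uniq ?enum_uniq //.
by move=> [u g] [v h] _ _ [-> ->].
Qed.

Fact mem_vpiece d m : (m \in vpiece d) = (vdeg m == d).
Proof.
apply/allpairsP/idP => [[[u g] [/= Hu _ ->]]|Hm].
  by rewrite -mem_wpiece.
by exists (vmon_pair m); rewrite mem_wpiece mem_enum; case: m Hm.
Qed.

HB.instance Definition _ := Monoid_isGraded.Build (vmon gT)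
  vdegM vpiece_uniq mem_vpiece.

Definition ve0 : vmon gT := VMon [:: None] 1%g.
Definition ve1 : vmon gT := VMon [:: Some 1%g] 1%g.
Definition vg (g : gT) : vmon gT := VMon [::] g.

Lemma vmon_relations :
  [/\ forall g h, (vg g * vg h = vg (g * h))%g, vg 1 = 1%g
    & forall g, (vg g * ve0 = ve0 * vg g)%g].
Proof. by split=> [g h||g] //; congr VMon; rewrite /= mul1g ?mulg1. Qed.

Definition vlift (N : monoidType) (E0 E1 : N) (P : gT -> N) m : N :=
  ((\big[*%g/1%g]_(x <- vword m) (if x is Some h then P h * E1 else E0))
   * P (vgrp m))%g.

Lemma vmon_presentation (N : monoidType) (E0 E1 : N) (P : gT -> N) :
    (forall g h, P g * P h = P (g * h))%g -> P 1%g = 1%g ->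
    (forall g, P g * E0 = E0 * P g)%g ->
  [/\ vlift E0 E1 P 1%g = 1%g,
      forall m n, vlift E0 E1 P (m * n)%g
        = (vlift E0 E1 P m * vlift E0 E1 P n)%g,
      [/\ vlift E0 E1 P ve0 = E0, vlift E0 E1 P ve1 = E1
        & forall g, vlift E0 E1 P (vg g) = P g]
    & forall f : vmon gT -> N, f 1%g = 1%g ->
        (forall m n, f (m * n)%g = (f m * f n)%g) ->
        f ve0 = E0 -> f ve1 = E1 -> (forall g, f (vg g) = P g) ->
        f =1 vlift E0 E1 P].
Proof.
move=> PM P1 PE0.
pose L (x : option gT) : N := (if x is Some h then P h * E1 else E0)%g.
pose B (u : seq (option gT)) : N := (\big[*%g/1%g]_(x <- u) L x)%g.
have Bcons x u : B (x :: u) = (L x * B u)%g by rewrite /B big_cons.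
have Bpush g u : (P g * B u = B (vpush g u) * P (vcarry g u))%g.
  elim: u => [|[h|] u IHu]; first by rewrite /B big_nil mul1g mulg1.
    by rewrite /= !Bcons /vcarry /= P1 mulg1 !mulgA PM.
  by rewrite /= !Bcons /= mulgA PE0 -!mulgA IHu.
split.
- by rewrite /vlift /= big_nil mul1g.
- move=> [u g] [v h]; rewrite /vlift /= big_cat /= -!/(L _) -!/(B _).
  by rewrite -!mulgA; congr (_ * _)%g; rewrite -PM !mulgA Bpush.
- by split=> [||g]; rewrite /vlift /= ?big_seq1 ?big_nil ?P1 ?mulg1 ?mul1g.
move=> f f1 fM f0 fe1 fP [u g]; rewrite /vlift /=.
have -> : VMon u g = (VMon u 1 * vg g)%g by congr VMon; rewrite ?cats0 ?mul1g.
rewrite fM fP; congr (_ * _)%g; elim: u => [|x u IHu].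
  by rewrite big_nil -f1.
rewrite big_cons -IHu; case: x => [h|].
  rewrite -fP -fe1 -!fM; congr f; congr VMon; rewrite /= ?mulg1 ?vpush1 //.
  by rewrite /vcarry if_same.
by rewrite -f0 -fM; congr f; congr VMon; rewrite /= ?vpush1 // /vcarry if_same
  mulg1.
Qed.

End VMonoid.

Section VAlgebra.
Variables (gT : finGroupType) (k : comPzRingType).
Local Notation kX := (series (wordX gT) k).
Local Notation V := (series (vmon gT) k).
Local Notation VV := (series (vmon gT * vmon gT)%type k).

Definition e0 : V := mono (ve0 gT).
Definition e1 : V := mono (ve1 gT).
Definition egrp (g : gT) : V := mono (vg g).

(* The generator e_0, resp. h e_1, is sent to E0, resp. h E1. *)
Definition vletter (E0 E1 : V) (x : option gT) : V :=
  if x is Some h then egrp h * E1 else E0.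

(* the continuous algebra morphism with e_0 |-> E0, e_1 |-> E1, g |-> g *)
Definition V_ext (E0 E1 : V) : V -> V :=
  cont_ext (fun m : vmon gT =>
    (\prod_(x <- vword m) vletter E0 E1 x) * egrp (vgrp m)).

(* the continuous derivation with e_0 |-> D0, e_1 |-> D1, g |-> 0 *)
Definition V_der (D0 D1 : V) : V -> V :=
  cont_ext (fun m : vmon gT =>
    word_der (vletter e0 e1) (vletter D0 D1) (vword m) * egrp (vgrp m)).

(* a |-> beta (a (x) 1) *)
Definition beta1 : kX -> V :=
  alg_ext (fun x => if x is Some g then - (egrp g * e1 * egrp g^-1%g) else e0).

Definition W : set V :=
  [set a : V | exists (c : k) (v : V), a = c *: (1 : V) + v * e1].

Definition zgen (n : nat) (g : gT) : V := - (e0 ^+ n.-1 * egrp g * e1).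

Definition Delta_zgen (n : nat) (g : gT) : VV :=
  tens (zgen n g) 1 + tens 1 (zgen n g)
  + \sum_(1 <= i < n) \sum_(h : gT)
      tens (zgen i h) (zgen (n - i) (g * h^-1)%g).

(* The monomials in W are the products e_0^(n_1-1) g_1 e_1 ... e_0^(n_r-1) g_r
   e_1 = (-1)^r z_(n_1,g_1) ... z_(n_r,g_r), i.e. the (u, 1) where u is empty
   or ends with some h e_1. *)
Definition in_Wmon (m : vmon gT) : bool :=
  (vgrp m == 1%g) && isSome (last (Some 1%g) (vword m)).

(* the indices (n_i, g_i); n counts the e_0's already read *)
Fixpoint z_indices (n : nat) (u : seq (option gT)) : seq (nat * gT) :=
  match u with
  | [::] => [::]
  | None :: v => z_indices n.+1 v
  | Some g :: v => (n.+1, g) :: z_indices 0 v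
  end.

Definition DeltaW_mon (m : vmon gT) : VV :=
  if in_Wmon m then \prod_(p <- z_indices 0 (vword m)) (- Delta_zgen p.1 p.2)
  else 0.

(* Only the restriction to W matters: the harmonic coproduct of W, with values
   in the image of W (x)^ W in V (x)^ V (see [DeltaWM] and [DeltaW_zgen]). *)
Definition DeltaW : V -> VV := cont_ext DeltaW_mon.

Definition autV0 (Psi : kX) : V -> V :=
  V_ext e0 (beta1 (sinv Psi) * e1 * beta1 Psi).

Definition autV1 (Psi : kX) (a : V) : V := sAd (beta1 Psi) (autV0 Psi a).

Definition derV0 (psi : kX) : V -> V := V_der 0 (sad e1 (beta1 psi)).

Definition derV1 (psi : kX) (a : V) : V := sad (beta1 psi) a + derV0 psi a.

End VAlgebra.

Section Delta.
Variables (gT : finGroupType) (k : comPzRingType).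
Local Notation V := (series (vmon gT) k).

Lemma zgenE n (g : gT) :
  zgen k n g = - mono (VMon (rcons (nseq n.-1 None) (Some g)) 1%g).
Proof.
rewrite /zgen; congr (- _).
have -> : e0 gT k ^+ n.-1 = mono (VMon (nseq n.-1 None) 1%g).
  elim: n.-1 => // i IH; rewrite exprS IH monoM; congr mono.
  by congr VMon; rewrite /= ?vpush1 // /vcarry if_same mulg1.
rewrite !monoM; congr mono; congr VMon; rewrite /= ?cats0.
  by rewrite /vcarry /= mul1g mulg1 cats1.
by rewrite /vcarry /= mulg1.
Qed.

Lemma o_zgen n (g : gT) : has_order n (zgen k n g).
Proof.
rewrite zgenE; apply: has_orderN => m lt; apply: has_order_mono.
apply: (leq_trans lt); rewrite /gdeg /= /vdeg /= size_rcons size_nseq.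
by rewrite leqSpred.
Qed.

Lemma o_Dzgen n (g : gT) : has_order n (Delta_zgen k n g).
Proof.
apply: has_orderD; first apply: has_orderD.
- rewrite -[X in has_order X]addn0; apply: has_order_tens => //; exact: o_zgen.
- rewrite -[X in has_order X]add0n; apply: has_order_tens => //; exact: o_zgen.
rewrite big_nat; elim/big_rec: _ => // i x /andP[i0 lt_i] ox.
apply: has_orderD => //; elim/big_rec: _ => // h y _ oy.
apply: has_orderD => //.
rewrite -[X in has_order X](subnKC (ltnW lt_i)).
by apply: has_order_tens; apply: o_zgen.
Qed.

Lemma z_indices_size n (u : seq (option gT)) : isSome (last (Some 1%g) u) ->
  (u != [::]) || (n == 0%N) ->
  \sum_(p <- z_indices n u) p.1 = (n + size u)%N.
Proof.
elim: u n => [|[g|] u IH] n /=; first by move=> _ /eqP->; rewrite big_nil.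
  move=> lu _; rewrite big_cons /= IH ?eqxx ?orbT //; first by lia.
  by case: u lu {IH}.
case: u IH => // x u IH lu _; rewrite IH //=; lia.
Qed.

Lemma DeltaW_mon_deg (m : vmon gT) n : (gdeg n < gdeg m)%N -> DeltaW_mon k m n = 0.
Proof.
rewrite /DeltaW_mon; case: ifP => // /andP[_ lu] lt.
have := @has_order_prod k _ _ (z_indices 0 (vword m)) (fun p => p.1)
  (fun p => - Delta_zgen k p.1 p.2).
apply; first by move=> p; apply/has_orderN/o_Dzgen.
by rewrite z_indices_size ?eqxx ?orbT.
Qed.

Lemma z_indices_cat n (u v : seq (option gT)) : isSome (last (Some 1%g) u) ->
  (u != [::]) || (n == 0%N) ->
  z_indices n (u ++ v) = z_indices n u ++ z_indices 0 v.
Proof.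
elim: u n => [|[g|] u IH] n /=; first by move=> _ /eqP->.
  move=> lu _; rewrite IH ?eqxx ?orbT //.
  by case: u lu {IH}.
case: u IH => // x u IH lu _; rewrite IH //=; lia.
Qed.

Lemma DeltaW_monM (m n : vmon gT) : in_Wmon m -> in_Wmon n ->
  DeltaW_mon k (m * n)%g = DeltaW_mon k m * DeltaW_mon k n.
Proof.
case: m n => [u g] [v h]; rewrite /DeltaW_mon => mW nW; rewrite mW nW.
move: mW nW; rewrite /in_Wmon /= => /andP[/eqP-> lu] /andP[/eqP-> lv].
rewrite vpush1 /vcarry if_same mul1g eqxx last_cat /=.
have -> : isSome (last (last (Some 1%g) u) v) by case: v lv.
by rewrite /= z_indices_cat ?eqxx ?orbT // big_cat.
Qed.

Lemma W_mon (a : V) m : W a -> a m != 0 -> in_Wmon m.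
Proof.
case=> c [v ->]; rewrite /GRing.add /= /GRing.scale /=.
have [->|ne] := eqVneq m 1%g; first by rewrite /in_Wmon eqxx.
rewrite mulr0 add0r.
apply: contraR => nW; apply/eqP; rewrite big_seq; apply: big1 => -[p q].
rewrite mem_gfactors /= => /eqP mE.
case: eqP => [qE|]; rewrite ?mulr0 //; case/negP: nW.
by rewrite -mE qE /in_Wmon /= /vcarry /= mulg1 eqxx last_cat.
Qed.

Lemma DeltaWM (a b : V) : W a -> W b -> DeltaW (a * b) = DeltaW a * DeltaW b.
Proof.
move=> Wa Wb; apply: cont_extM; [exact: DeltaW_mon_deg|].
by move=> m n /(W_mon Wa) mW /(W_mon Wb) nW; apply: DeltaW_monM.
Qed.

Lemma DeltaW1 : DeltaW (1 : V) = 1.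
Proof.
rewrite /DeltaW cont_ext_mono; last exact: DeltaW_mon_deg.
by rewrite /DeltaW_mon /in_Wmon /= eqxx big_nil.
Qed.

Lemma DeltaW_zgen n (g : gT) :
  (0 < n)%N -> DeltaW (zgen k n g) = Delta_zgen k n g.
Proof.
move=> n0; rewrite zgenE.
have DN a : DeltaW (- a) = - DeltaW a :> series (vmon gT * vmon gT)%type k.
  apply/seriesP => m; rewrite /DeltaW /GRing.opp /= -sumrN.
  by apply: eq_bigr => p _; rewrite mulNr.
rewrite DN /DeltaW cont_ext_mono; last exact: DeltaW_mon_deg.
rewrite /DeltaW_mon /in_Wmon /= eqxx last_rcons /=.
have -> : z_indices 0 (rcons (nseq n.-1 None) (Some g)) = [:: (n, g)].
  rewrite -[in RHS](prednK n0) -[in RHS](add0n n.-1).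
  elim: n.-1 0%N => [|i IH] j /=; first by rewrite addn0.
  by rewrite IH addSnnS.
by rewrite big_seq1 opprK.
Qed.

End Delta.

Section Stabilizers.
Variables (gT : finGroupType) (k : qalg).
Local Notation kX := (series (wordX gT) k).
Local Notation V := (series (vmon gT) k).

Definition Gam_autW (Psi : kX) (a : V) : V :=
  sAd (ps_eval (sinv (Gam Psi)) (- e1 gT k)) (autV1 Psi a).

Definition Stab : set kX :=
  [set Psi | grouplike Psi /\
    forall a, W a -> tens_map (Gam_autW Psi) (Gam_autW Psi) (DeltaW a)
                     = DeltaW (Gam_autW Psi a)].

Definition gam_derW (psi : kX) (a : V) : V :=
  sad (- ps_eval (gam psi) (- e1 gT k)) a + derV1 psi a.

Definition stab : set kX :=
  [set psi | primitive psi /\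
    forall a, W a -> tens_map (gam_derW psi) id (DeltaW a)
                     + tens_map id (gam_derW psi) (DeltaW a)
                     = DeltaW (gam_derW psi a)].

End Stabilizers.

Definition ratQ : qalg := QAlg (idfun : {rmorphism rat -> rat}).

(* Q[eps]/(eps^2) *)
Definition dualQ : qalg :=
  QAlg (qpolyC ('X^2 : {poly rat}) :
          {rmorphism rat -> {poly %/ ('X^2 : {poly rat})}}).

Definition epsQ : dualQ := 'qX.

(* a + b eps |-> a *)
Definition dual_aug (p : dualQ) : ratQ :=
  (p : {poly %/ ('X^2 : {poly rat})})`_0.

Section LieAlgebras.
Variable gT : finGroupType.
Local Notation QX := (series (wordX gT) ratQ).

Definition one_eps (psi : QX) : series (wordX gT) dualQ :=
  1 + Series (fun w => qscale (psi w) epsQ).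

(* the kernel of F(Q[eps]) -> F(Q) *)
Definition Lie_ker (F : forall k : qalg, set (series (wordX gT) k)) :
    set (series (wordX gT) dualQ) :=
  [set Psi | F dualQ Psi /\ smap dual_aug Psi = 1 :> QX].

Definition lie_subalgebra (L : set QX) : Prop :=
  [/\ L `<=` @primitive gT ratQ, L 0,
      forall (c : rat) x y, L x -> L y -> L (c *: x + y)
    & forall x y, L x -> L y -> L (lie_bracket x y)].

End LieAlgebras.

(* Main.v *)
(* Representability. Take the polynomial expressions in the coordinates of a
   point, and identify two of them when they have the same value at every point
   of Stab over every Q-algebra. The conditions defining Stab are natural
   equations between coordinates, so they hold at the generic point of the
   quotient A because they hold at all points. Hence Hom(A, k) = Stab k, and the
   comultiplication, the counit and the antipode come from Yoneda's lemma.

   Group structure. The coefficients of the words x_0^n x_1 are additive for the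
   law of the group, so Gam is multiplicative and Psi |-> Gam_autW Psi is a
   morphism to the automorphisms of V. Inverses exist since autX Psi is unipotent
   for the degree filtration.

   Lie algebra. Over Q[eps] one has Gam_autW (1 + eps psi) = 1 + eps D, where D
   is gam_derW psi up to a multiple of ad e_1, which is compatible with DeltaW
   because e_1 is primitive. The same expansion turns every identity between the
   automorphisms attached to Psi into one between the derivations attached to
   psi. A derivation of V that kills e_1 and equals ad p on e_0 and G is
   determined by p; comparing the elements p shows that gam_derW maps the bracket
   of Lib(X) to the commutator, as gam vanishes on brackets. *)
Require Import Defs.
From HB Require Import structures.
From mathcomp Require Import all_boot all_order all_algebra all_fingroup.
From mathcomp Require Import generic_quotient boolp classical_sets zify ring.

Set Implicit Arguments.
Unset Strict Implicit.
Unset Printing Implicit Defensive.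

Import GRing.Theory.
Local Open Scope classical_set_scope.
Local Open Scope ring_scope.
Local Open Scope quotient_scope.
Local Obligation Tactic := idtac.

(** * Representability *)

(** No ideal of relations is ever written down. That [Stab] is cut out by equations enters only
    through [Stab_closed]: a series is a point as soon as the morphisms sending it to a point
    separate the scalars. The separating morphisms are then supplied by the construction of the
    quotient, where two expressions differ only if some point tells them apart. The identification
    of expressions quantifies over all Q-algebras. Classical logic makes it a boolean relation, so
    the quotient is again one of the Q-algebras quantified over; this is what allows the generic
    point to be a series over it and [Stab] to be evaluated there. *)

(* Formal sums of elements of a type X, up to equality of the values of a class
   of test maps X -> V; with a product on X and a compatible map rat -> X they
   form a commutative Q-algebra. With the evaluations at points, resp. the
   balanced maps, as test maps, this gives the coordinate ring of a scheme,
   resp. the tensor powers of an algebra. *)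
Record fsum_data := FsumData {
  fs_gen :> choiceType;
  fs_mul : fs_gen -> fs_gen -> fs_gen;
  fs_const : rat -> fs_gen;
  fs_test : forall V : zmodType, (fs_gen -> V) -> Prop;
  fs_testM : forall (V : zmodType) (phi : fs_gen -> V) x,
    fs_test phi -> fs_test (phi \o fs_mul x);
  fs_mulA : forall (V : zmodType) (phi : fs_gen -> V) x y z, fs_test phi ->
    phi (fs_mul x (fs_mul y z)) = phi (fs_mul (fs_mul x y) z);
  fs_mulC : forall (V : zmodType) (phi : fs_gen -> V) x y, fs_test phi ->
    phi (fs_mul x y) = phi (fs_mul y x);
  fs_mul1 : forall (V : zmodType) (phi : fs_gen -> V) x, fs_test phi ->
    phi (fs_mul (fs_const 1) x) = phi x;
  fs_constD : forall (V : zmodType) (phi : fs_gen -> V) c d, fs_test phi ->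
    phi (fs_const (c + d)) = phi (fs_const c) + phi (fs_const d);
  fs_constM : forall (V : zmodType) (phi : fs_gen -> V) c d, fs_test phi ->
    phi (fs_const (c * d)) = phi (fs_mul (fs_const c) (fs_const d))
}.

Section FormalSums.
Variable D : fsum_data.

Definition fs_rel : rel (seq D) := fun s t =>
  `[< forall (V : zmodType) (phi : D -> V), fs_test phi ->
        \sum_(x <- s) phi x = \sum_(x <- t) phi x >].

Fact fs_rel_refl : reflexive fs_rel.
Proof. by move=> s; apply/asboolP. Qed.
Fact fs_rel_sym : symmetric fs_rel.
Proof.
by move=> s t; apply/asboolP/asboolP => st V phi H; rewrite (st _ _ H).
Qed.
Fact fs_rel_trans : transitive fs_rel.
Proof.
move=> t s u /asboolP st /asboolP tu; apply/asboolP => V phi H.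
by rewrite (st _ _ H) (tu _ _ H).
Qed.
Canonical fs_equiv := EquivRel fs_rel fs_rel_refl fs_rel_sym fs_rel_trans.

Definition fsum := {eq_quot fs_equiv}.
HB.instance Definition _ := Choice.on fsum.

Definition fs_class (s : seq D) : fsum := \pi_{eq_quot fs_equiv} s.
Definition fs_repr (a : fsum) : seq D := repr (a : {eq_quot fs_equiv}).

Lemma fs_reprK : cancel fs_repr fs_class.
Proof. by move=> a; apply: reprK. Qed.

Definition fs_eval (V : zmodType) (phi : D -> V) (a : fsum) : V :=
  \sum_(x <- fs_repr a) phi x.

Lemma fs_eval_class (V : zmodType) (phi : D -> V) s : fs_test phi ->
  fs_eval phi (fs_class s) = \sum_(x <- s) phi x.
Proof.
move=> H; have /eqquotP : fs_repr (fs_class s) = s %[mod {eq_quot fs_equiv}].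
  exact: reprK.
by move=> /asboolP/(_ V phi H).
Qed.

Lemma fs_classP s t : fs_class s = fs_class t <->
  forall (V : zmodType) (phi : D -> V), fs_test phi ->
    \sum_(x <- s) phi x = \sum_(x <- t) phi x.
Proof.
by split=> [/eqquotP/asboolP//|H]; apply/eqquotP/asboolP.
Qed.

Lemma fsumP (a b : fsum) : (forall (V : zmodType) (phi : D -> V),
  fs_test phi -> fs_eval phi a = fs_eval phi b) -> a = b.
Proof. by move=> H; rewrite -(fs_reprK a) -(fs_reprK b); apply/fs_classP. Qed.

Definition fs_add a b := fs_class (fs_repr a ++ fs_repr b).
Definition fs_prod a b :=
  fs_class [seq fs_mul x y | x <- fs_repr a, y <- fs_repr b].
Definition fs_in c := fs_class [:: fs_const D c].

Lemma fs_evalD (V : zmodType) (phi : D -> V) a b : fs_test phi ->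
  fs_eval phi (fs_add a b) = fs_eval phi a + fs_eval phi b.
Proof. by move=> H; rewrite fs_eval_class // big_cat. Qed.

(** The representative of [a] stays visible, while [b] enters through an evaluation, which depends
    on its class alone because [fs_testM] keeps [phi \o fs_mul x] among the test maps. With
    commutativity, the product is independent of both representatives. *)
Lemma fs_evalM (V : zmodType) (phi : D -> V) a b : fs_test phi ->
  fs_eval phi (fs_prod a b) =
  \sum_(x <- fs_repr a) fs_eval (phi \o fs_mul x) b.
Proof. by move=> H; rewrite fs_eval_class // big_allpairs_dep. Qed.

Lemma fs_eval_in (V : zmodType) (phi : D -> V) c : fs_test phi ->
  fs_eval phi (fs_in c) = phi (fs_const D c).
Proof. by move=> H; rewrite fs_eval_class // big_seq1. Qed.

Fact fs_prodC : commutative fs_prod.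
Proof.
move=> a b; apply: fsumP => V phi H; rewrite !fs_evalM // exchange_big /=.
by apply: eq_bigr => x _; apply: eq_bigr => y _ /=; rewrite fs_mulC.
Qed.

Fact fs_prodA : associative fs_prod.
Proof.
move=> a b c; apply: fsumP => V phi H.
(* On both sides the inner product has to be the second factor, where the choice of a representative
   does not matter. *)
rewrite (fs_prodC (fs_prod a b)) !fs_evalM //.
transitivity (\sum_(x <- fs_repr a) \sum_(y <- fs_repr b)
   \sum_(z <- fs_repr c) phi (fs_mul z (fs_mul x y))).
  apply: eq_bigr => x _; have Hx := fs_testM x H.
  rewrite fs_evalM //; apply: eq_bigr => y _; apply: eq_bigr => z _ /=.
  by rewrite fs_mulA // fs_mulC.
under eq_bigr do rewrite exchange_big /=.
rewrite exchange_big /=; apply: eq_bigr => z _.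
by rewrite fs_evalM //; apply: fs_testM.
Qed.

Fact fs_prod1 : left_id (fs_in 1) fs_prod.
Proof.
move=> a; apply: fsumP => V phi H; rewrite fs_prodC fs_evalM //.
apply: eq_bigr => x _; rewrite fs_eval_in /=; last exact: fs_testM.
by rewrite fs_mulC // fs_mul1.
Qed.

Fact fs_prodD : left_distributive fs_prod fs_add.
Proof.
move=> a b c; apply: fsumP => V phi H.
rewrite fs_evalD // !(fs_prodC _ c) !fs_evalM // -big_split /=.
by apply: eq_bigr => x _; rewrite fs_evalD //; apply: fs_testM.
Qed.

Fact fs_addA : associative fs_add.
Proof. by move=> a b c; apply: fsumP => V phi H; rewrite !fs_evalD // addrA. Qed.

Fact fs_addC : commutative fs_add.
Proof. by move=> a b; apply: fsumP => V phi H; rewrite !fs_evalD // addrC. Qed.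

Fact fs_add0 : left_id (fs_class [::]) fs_add.
Proof.
move=> a; apply: fsumP => V phi H.
by rewrite !fs_evalD // fs_eval_class // big_nil add0r.
Qed.

Lemma fs_inD c d : fs_in (c + d) = fs_add (fs_in c) (fs_in d).
Proof.
by apply: fsumP => V phi H; rewrite fs_evalD // !fs_eval_in // fs_constD.
Qed.

Lemma fs_in0 : fs_in 0 = fs_class [::].
Proof.
apply: fsumP => V phi H; rewrite fs_eval_in // fs_eval_class // big_nil.
by apply: (addrI (phi (fs_const D 0))); rewrite -fs_constD // !addr0.
Qed.

Lemma fs_inM c d : fs_in (c * d) = fs_prod (fs_in c) (fs_in d).
Proof.
apply: fsumP => V phi H; rewrite fs_eval_in // fs_constM //.
rewrite fs_evalM // fs_mulC //; have Hd := fs_testM (fs_const D d) H.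
have := fs_eval_in c Hd; rewrite /= => <-; apply: eq_bigr => x _.
by rewrite fs_eval_in; [exact: fs_mulC|exact: fs_testM].
Qed.

(** The generators carry no sign; the constant -1 supplies the opposites. *)
Definition fs_opp a := fs_prod (fs_in (-1)) a.

Fact fs_addN : left_inverse (fs_class [::]) fs_opp fs_add.
Proof.
move=> a; rewrite -{2}[a]fs_prod1 -fs_prodD -fs_inD addNr fs_in0 fs_prodC.
apply: fsumP => V phi H; rewrite fs_evalM // big1 => [|x _].
  by rewrite fs_eval_class // big_nil.
by rewrite fs_eval_class ?big_nil //; apply: fs_testM.
Qed.

HB.instance Definition _ :=
  GRing.isZmodule.Build fsum fs_addA fs_addC fs_add0 fs_addN.
HB.instance Definition _ := GRing.Zmodule_isComPzRing.Build fsum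
  fs_prodA fs_prodC fs_prod1 fs_prodD.

Lemma fs_addE a b : fs_add a b = a + b. Proof. by []. Qed.

Fact fs_in_zmod : zmod_morphism fs_in.
Proof.
by move=> c d; rewrite -[c in RHS](subrK d) (fs_inD (c - d) d) fs_addE addrK.
Qed.
Fact fs_in_monoid : monoid_morphism fs_in.
Proof. by split; last exact: fs_inM. Qed.
HB.instance Definition _ := GRing.isZmodMorphism.Build rat fsum fs_in fs_in_zmod.
HB.instance Definition _ :=
  GRing.isMonoidMorphism.Build rat fsum fs_in fs_in_monoid.

Definition fsum_qalg : qalg := QAlg (fs_in : {rmorphism rat -> fsum}).

Lemma fs_classD s t : fs_class (s ++ t) = fs_class s + fs_class t.
Proof.
apply: fsumP => V phi H.
by rewrite fs_evalD // !fs_eval_class // big_cat.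
Qed.

Lemma fs_class_sum (s : seq D) : fs_class s = \sum_(x <- s) fs_class [:: x].
Proof.
elim: s => [|x s IH]; first by rewrite big_nil.
by rewrite big_cons -IH -fs_classD.
Qed.

Lemma fs_class1M x y : fs_class [:: x] * fs_class [:: y] = fs_class [:: fs_mul x y].
Proof.
apply: fsumP => V phi H; rewrite fs_eval_class // big_seq1 fs_evalM //.
under eq_bigr => z _.
  rewrite fs_eval_class ?big_seq1 /=; [rewrite fs_mulC //; over|exact: fs_testM].
have := @fs_eval_class _ (phi \o fs_mul y) [:: x] (fs_testM y H).
by rewrite big_seq1 /= fs_mulC.
Qed.

End FormalSums.

Arguments fs_class {D} s.
Arguments fs_repr {D} a.
Arguments fs_in {D} c.

Section Evaluation.
Variables (D : fsum_data) (k : qalg) (ev : D -> k).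
Hypothesis ev_test : fs_test ev.
Hypothesis evM : forall x y, ev (fs_mul x y) = ev x * ev y.
Hypothesis ev_const : forall c, ev (fs_const D c) = qalg_in k c.

Fact fs_eval_zmod : zmod_morphism (fs_eval ev).
Proof.
move=> a b; apply/(canRL (addrK _)).
by rewrite -fs_evalD // fs_addE subrK.
Qed.
Fact fs_eval_monoid : monoid_morphism (fs_eval ev).
Proof.
split=> [|a b].
  by rewrite -[1]/(fs_in 1) fs_eval_in // ev_const rmorph1.
rewrite -[a * b]/(fs_prod a b) fs_evalM // /fs_eval mulr_suml.
apply: eq_bigr => x _; rewrite mulr_sumr; apply: eq_bigr => y _ /=.
exact: evM.
Qed.
HB.instance Definition _ :=
  GRing.isZmodMorphism.Build (fsum D) k (fs_eval ev) fs_eval_zmod.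
HB.instance Definition _ :=
  GRing.isMonoidMorphism.Build (fsum D) k (fs_eval ev) fs_eval_monoid.

Definition fs_hom : {rmorphism fsum D -> k} := fs_eval ev.
End Evaluation.

Section FormalSumAlgebra.
Variables (D : fsum_data) (nzD : (1 : fsum D) != 0).

(** The proof [nzD] becomes an argument of the type, so that the nonzero-ring structure, which a
    [comAlgType] requires, can be attached to this alias while [fsum D] itself may be the zero
    ring. *)
Definition fsum_alg : Type := let _ := nzD in fsum D.
HB.instance Definition _ := GRing.ComPzRing.on fsum_alg.
HB.instance Definition _ :=
  GRing.PzSemiRing_isNonZero.Build fsum_alg nzD.

Definition fs_scale (c : rat) (a : fsum_alg) : fsum_alg := fs_in c * (a : fsum D).

Fact fs_scaleA c d a : fs_scale c (fs_scale d a) = fs_scale (c * d) a.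
Proof. by rewrite /fs_scale rmorphM mulrA. Qed.
Fact fs_scale1 : left_id 1 fs_scale.
Proof. by move=> a; rewrite /fs_scale rmorph1 mul1r. Qed.
Fact fs_scaleDr : right_distributive fs_scale +%R.
Proof. by move=> c a b; rewrite /fs_scale mulrDr. Qed.
Fact fs_scaleDl a : {morph fs_scale^~ a : c d / c + d}.
Proof. by move=> c d; rewrite /fs_scale rmorphD mulrDl. Qed.
HB.instance Definition _ := GRing.Zmodule_isLmodule.Build rat fsum_alg
  fs_scaleA fs_scale1 fs_scaleDr fs_scaleDl.
Fact fs_scaleAl (c : rat) (a b : fsum_alg) : c *: (a * b) = c *: a * b.
Proof. exact: (mulrA (fs_in c : fsum D)). Qed.
HB.instance Definition _ := GRing.Lmodule_isLalgebra.Build rat fsum_alg fs_scaleAl.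
HB.instance Definition _ := GRing.Lalgebra_isComAlgebra.Build rat fsum_alg.

Lemma fs_in_alg (c : rat) : c%:A = fs_in c :> fsum_alg.
Proof. exact: (mulr1 (fs_in c : fsum D)). Qed.
End FormalSumAlgebra.

Lemma smap_comp (M : gradedMonoidType) (k k' k'' : comPzRingType) (f : k -> k')
  (g : k' -> k'') (x : series M k) : smap g (smap f x) = smap (g \o f) x.
Proof. by []. Qed.

Lemma smap1 (M : gradedMonoidType) (k k' : qalg) (f : qalg_hom k k') :
  smap f 1 = 1 :> series M k'.
Proof. by apply/seriesP => m; rewrite /= rmorph_nat. Qed.

(** * The coordinate ring and its generic point *)

Section CoordinateRing.
Variables (M : gradedMonoidType) (F : forall k : qalg, set (series M k)).

Definition point_eval (k : qalg) (x : series M k) (t : rat * seq M) : k :=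
  qalg_in k t.1 * \prod_(m <- t.2) x m.

(** The additive map after an evaluation separates nothing more, but it closes the test maps under
    translation: multiplication by a value is additive. *)
Definition point_test (V : zmodType) (phi : rat * seq M -> V) : Prop :=
  exists (k : qalg) (x : series M k) (f : {additive k -> V}),
    F x /\ phi = f \o point_eval x.

Definition coord_mul (t u : rat * seq M) : rat * seq M :=
  (t.1 * u.1, t.2 ++ u.2).

Lemma point_evalM (k : qalg) (x : series M k) t u :
  point_eval x (coord_mul t u) = point_eval x t * point_eval x u.
Proof. by rewrite /point_eval /= rmorphM big_cat mulrACA. Qed.

Lemma point_eval_const (k : qalg) (x : series M k) c :
  point_eval x (c, [::]) = qalg_in k c.
Proof. by rewrite /point_eval /= big_nil mulr1. Qed.

Lemma point_eval_test (k : qalg) (x : series M k) : F x ->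
  point_test (point_eval x).
Proof. by exists k, x, (idfun : {additive k -> k}). Qed.

Program Definition coord_data : fsum_data :=
  @FsumData (rat * seq M)%type coord_mul (fun c => (c, [::])) point_test
    _ _ _ _ _ _.
Next Obligation.
move=> V _ t [k [x [f [Fx ->]]]].
exists k, x, (f \o GRing.mull_fun (point_eval x t) idfun : {additive k -> V}); split=> //.
by apply/funext => u /=; rewrite point_evalM.
Qed.
Next Obligation.
by move=> V _ t u v [k [x [f [Fx ->]]]] /=; rewrite !point_evalM mulrA.
Qed.
Next Obligation.
by move=> V _ t u [k [x [f [Fx ->]]]] /=; rewrite !point_evalM mulrC.
Qed.
Next Obligation.
move=> V _ t [k [x [f [Fx ->]]]] /=.
by rewrite point_evalM point_eval_const rmorph1 mul1r.
Qed.
Next Obligation.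
move=> V _ c d [k [x [f [Fx ->]]]] /=.
by rewrite !point_eval_const rmorphD raddfD.
Qed.
Next Obligation.
move=> V _ c d [k [x [f [Fx ->]]]] /=.
by rewrite point_evalM !point_eval_const.
Qed.

Hypothesis F1 : F (1 : series M ratQ).

(** The neutral point over Q separates 1 from 0. *)
Fact coord_ring_nz : (1 : fsum coord_data) != 0.
Proof.
apply/eqP => /(congr1 (@fs_eval coord_data (qalg_ring ratQ) (point_eval 1))).
have t := point_eval_test F1.
have := @fs_eval_class coord_data _ _ [::] t; rewrite big_nil => ->.
by rewrite -(rmorph1 (@fs_in coord_data)) fs_eval_in // point_eval_const.
Qed.

Definition coord_ring : comAlgType rat := fsum_alg coord_ring_nz.

Definition generic_point : series M (qalg_of coord_ring) :=
  Series (fun m => fs_class [:: (1, [:: m]) : coord_data] : coord_ring).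

Lemma point_hom (k : qalg) (x : series M k) : F x ->
  exists f : qalg_hom (qalg_of coord_ring) k,
    smap f generic_point = x
    /\ f =1 (fs_eval (point_eval x : coord_data -> k)).
Proof.
move=> Fx; have t : @fs_test coord_data _ (point_eval x) := point_eval_test Fx.
pose f : {rmorphism qalg_of coord_ring -> k} :=
  fs_hom t (point_evalM x) (point_eval_const x).
have fc c : f (qalg_in (qalg_of coord_ring) c) = qalg_in k c.
  by rewrite /= fs_in_alg fs_eval_in // point_eval_const.
exists (@QAlgHom (qalg_of coord_ring) k f fc); split=> //; apply/seriesP => m /=.
rewrite fs_eval_class // big_seq1 /point_eval /= rmorph1 big_seq1.
exact: mul1r.
Qed.

(** Every class is a sum of constants times products of coordinates of the generic point. *)
Lemma coord_ring_hom_ext (k : qalg) (f g : qalg_hom (qalg_of coord_ring) k) :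
  smap f generic_point = smap g generic_point -> f =1 g.
Proof.
move=> fg a; rewrite -(fs_reprK a) fs_class_sum !rmorph_sum.
apply: eq_bigr => -[c s] _.
suff -> : fs_class [:: (c, s) : coord_data] =
    qalg_in (qalg_of coord_ring) c * \prod_(m <- s) generic_point m.
  rewrite (rmorphM f) (rmorphM g) !(qalg_homE f, qalg_homE g) !rmorph_prod; congr (_ * _).
  apply: eq_bigr => m _; exact: (congr1 (fun x : series M k => x m) fg).
rewrite /= fs_in_alg; elim: s c => [|m s IH] c.
  by rewrite big_nil; symmetry; apply: mulr1.
rewrite big_cons mulrCA -IH; symmetry.
rewrite [LHS]fs_class1M; by congr (fs_class [:: _]); congr (_, _); apply: mul1r.
Qed.

(** Closedness without equations: the morphisms carrying [x] into [F] only have to separate the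
    elements of [k]. A functor cut out by natural equations satisfies this, since each equation
    holds after every such morphism. *)
Hypothesis F_closed : forall (k : qalg) (x : series M k),
  (forall a b : k, (forall (k' : qalg) (f : qalg_hom k k'),
     F (smap f x) -> f a = f b) -> a = b) -> F x.

(* An equation between coordinates holds in the coordinate ring as soon as it
   holds after every evaluation. *)
Lemma generic_pointP : F generic_point.
Proof.
apply: F_closed => a b ab; apply: fsumP => V _ [k [x [f [Fx ->]]]].
have [h [hx hE]] := point_hom Fx.
by rewrite /fs_eval -!raddf_sum -!/(fs_eval _ _) -!hE ab // hx.
Qed.

End CoordinateRing.

(** * Tensor squares and cubes as quotients of formal sums *)

Section TensorPowers.
Variable A : comAlgType rat.

(** The targets are mere abelian groups, so bilinearity over Q is replaced by biadditivity and
    balance. *)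
Definition tensor_test (V : zmodType) (phi : A * A -> V) : Prop :=
  [/\ forall x x' y, phi (x + x', y) = phi (x, y) + phi (x', y),
      forall x y y', phi (x, y + y') = phi (x, y) + phi (x, y')
    & forall c x y, phi (c *: x, y) = phi (x, c *: y)].

Program Definition tensor_data : fsum_data :=
  @FsumData (A * A)%type (fun p q => (p.1 * q.1, p.2 * q.2))
    (fun c => (c%:A, 1)) tensor_test _ _ _ _ _ _.
Next Obligation.
move=> V phi [x y] [DL DR Z]; split=> [u u' v|u v v'|c u v] /=.
- by rewrite mulrDr DL.
- by rewrite mulrDr DR.
by rewrite -!scalerAr Z.
Qed.
Next Obligation. by move=> V phi x y z _; rewrite /= !mulrA. Qed.
Next Obligation. by move=> V phi x y _; rewrite /= (mulrC x.1) (mulrC x.2). Qed.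
Next Obligation. by move=> V phi [x y] _; rewrite /= scale1r !mul1r. Qed.
Next Obligation. by move=> V phi c d [DL _ _]; rewrite scalerDl DL. Qed.
Next Obligation. by move=> V phi c d _; rewrite /= mulr1 mulr_algl scalerA. Qed.

Definition tensor3_test (V : zmodType) (phi : A * A * A -> V) : Prop :=
  [/\ forall x x' y z, phi (x + x', y, z) = phi (x, y, z) + phi (x', y, z),
      forall x y y' z, phi (x, y + y', z) = phi (x, y, z) + phi (x, y', z),
      forall x y z z', phi (x, y, z + z') = phi (x, y, z) + phi (x, y, z'),
      forall c x y z, phi (c *: x, y, z) = phi (x, c *: y, z)
    & forall c x y z, phi (c *: x, y, z) = phi (x, y, c *: z)].

Program Definition tensor3_data : fsum_data :=
  @FsumData (A * A * A)%type
    (fun p q => (p.1.1 * q.1.1, p.1.2 * q.1.2, p.2 * q.2))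
    (fun c => (c%:A, 1, 1)) tensor3_test _ _ _ _ _ _.
Next Obligation.
move=> V phi [[x y] z] [D1 D2 D3 Z2 Z3].
split=> [u u' v w|u v v' w|u v w w'|c u v w|c u v w] /=.
- by rewrite mulrDr D1.
- by rewrite mulrDr D2.
- by rewrite mulrDr D3.
- by rewrite -!scalerAr Z2.
by rewrite -!scalerAr Z3.
Qed.
Next Obligation. by move=> V phi x y z _; rewrite /= !mulrA. Qed.
Next Obligation.
by move=> V phi x y _; rewrite /= (mulrC x.1.1) (mulrC x.1.2) (mulrC x.2).
Qed.
Next Obligation. by move=> V phi [[x y] z] _; rewrite /= scale1r !mul1r. Qed.
Next Obligation. by move=> V phi c d [D1 _ _ _ _]; rewrite scalerDl D1. Qed.
Next Obligation. by move=> V phi c d _; rewrite /= !mulr1 mulr_algl scalerA. Qed.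

Lemma tensor_one : fs_class [:: (1, 1) : tensor_data] = 1.
Proof. by rewrite -(rmorph1 (@fs_in tensor_data)); congr (fs_class [:: _]); rewrite /= scale1r. Qed.

Lemma tensor3_one : fs_class [:: (1, 1, 1) : tensor3_data] = 1.
Proof. by rewrite -(rmorph1 (@fs_in tensor3_data)); congr (fs_class [:: _]); rewrite /= scale1r. Qed.

Lemma tensor_class_eq (s t : seq (A * A)) :
  fs_class (s : seq tensor_data) = fs_class (t : seq tensor_data) ->
  tensor_eq s t.
Proof.
move=> /fs_classP st V b bl br.
have blD x y y' : b x (y + y') = b x y + b x y'.
  by have := bl x 1 y y'; rewrite !scale1r.
have brD y x x' : b (x + x') y = b x y + b x' y.
  by have := br y 1 x x'; rewrite /= !scale1r.
have bl0 x : b x 0 = 0 by apply: (addrI (b x 0)); rewrite -blD !addr0.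
have br0 y : b 0 y = 0 by apply: (addrI (b 0 y)); rewrite -brD !addr0.
apply: (st V (fun p => b p.1 p.2)); split=> [x x' y|x y y'|c x y] /=;
  rewrite ?blD ?brD //.
have := br y c x 0; rewrite /= !addr0 br0 addr0 => ->.
by have := bl x c y 0; rewrite !addr0 bl0 addr0 => ->.
Qed.

Lemma tensor3_class_eq (s t : seq (A * A * A)) :
  fs_class (s : seq tensor3_data) = fs_class (t : seq tensor3_data) ->
  tensor3_eq s t.
Proof.
move=> /fs_classP st V b b3 b2 b1.
have D3 x y z z' : b x y (z + z') = b x y z + b x y z'.
  by have := b3 x y 1 z z'; rewrite !scale1r.
have D2 x y y' z : b x (y + y') z = b x y z + b x y' z.
  by have := b2 x z 1 y y'; rewrite /= !scale1r.
have D1 x x' y z : b (x + x') y z = b x y z + b x' y z.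
  by have := b1 y z 1 x x'; rewrite /= !scale1r.
have z3 x y : b x y 0 = 0 by apply: (addrI (b x y 0)); rewrite -D3 !addr0.
have z2 x z : b x 0 z = 0 by apply: (addrI (b x 0 z)); rewrite -D2 !addr0.
have z1 y z : b 0 y z = 0 by apply: (addrI (b 0 y z)); rewrite -D1 !addr0.
have Z1 c x y z : b (c *: x) y z = c *: b x y z.
  by have := b1 y z c x 0; rewrite /= !addr0 z1 addr0.
apply: (st V (fun p => b p.1.1 p.1.2 p.2)).
split=> [x x' y z|x y y' z|x y z z'|c x y z|c x y z] /=;
  rewrite ?D1 ?D2 ?D3 ?Z1 //.
  by have := b2 x z c y 0; rewrite /= !addr0 z2 addr0 => ->.
by have := b3 x y c z 0; rewrite /= !addr0 z3 addr0 => ->.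
Qed.

Fact tensor_inl_zmod : zmod_morphism (fun a : A => fs_class [:: (a, 1) : tensor_data]).
Proof.
move=> a b; apply/(canRL (addrK _)); rewrite -fs_classD; apply/fs_classP.
by move=> V phi [D _ _]; rewrite !big_cons !big_nil !addr0 -D subrK.
Qed.
Fact tensor_inr_zmod : zmod_morphism (fun a : A => fs_class [:: (1, a) : tensor_data]).
Proof.
move=> a b; apply/(canRL (addrK _)); rewrite -fs_classD; apply/fs_classP.
by move=> V phi [_ D _]; rewrite !big_cons !big_nil !addr0 -D subrK.
Qed.

End TensorPowers.

Lemma qalg_hom_exists (k k' : qalg) (f : k -> k') :
    zmod_morphism f -> monoid_morphism f ->
    (forall c, f (qalg_in k c) = qalg_in k' c) ->
  exists h : qalg_hom k k', h =1 f.
Proof.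
move=> fZ fM fc; pose g : {rmorphism k -> k'} := HB.pack f
  (GRing.isZmodMorphism.Build _ _ f fZ) (GRing.isMonoidMorphism.Build _ _ f fM).
by exists (@QAlgHom _ _ g fc).
Qed.

Lemma qalg_hom_comp (k1 k2 k3 : qalg) (g : qalg_hom k2 k3) (f : qalg_hom k1 k2) :
  exists h : qalg_hom k1 k3, h =1 g \o f.
Proof.
apply: qalg_hom_exists; first by move=> x y /=; rewrite !rmorphB.
  by split=> [|x y] /=; rewrite ?rmorph1 ?rmorphM.
by move=> c; rewrite /= !qalg_homE.
Qed.

Lemma qalg_hom_id (k : qalg) : exists h : qalg_hom k k, h =1 id.
Proof. by apply: qalg_hom_exists. Qed.

Lemma qalg_hom_in (k : qalg) : exists h : qalg_hom ratQ k, h =1 qalg_in k.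
Proof.
apply: qalg_hom_exists => //; first by move=> x y; rewrite rmorphB.
by split=> [|x y]; rewrite ?rmorph1 ?rmorphM.
Qed.

Lemma eq_smap (M : gradedMonoidType) (k k' : comPzRingType) (f g : k -> k') (x : series M k) :
  f =1 g -> smap f x = smap g x.
Proof. by move=> fg; apply/seriesP => m /=. Qed.

(** * The Hopf structure given by Yoneda's lemma *)

Section Yoneda.
Variables (M : gradedMonoidType) (F : forall k : qalg, set (series M k)).
Variable mul : forall k : qalg, series M k -> series M k -> series M k.
Hypothesis group_F :
  is_group_functor (fun k k' (f : qalg_hom k k') => @smap M k k' f) F mul
    (fun k => 1).
Variables (A : comAlgType rat) (xi : series M (qalg_of A)).
Hypothesis F_xi : F xi.
Hypothesis xi_hom : forall (k : qalg) (x : series M k), F x ->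
  exists f : qalg_hom (qalg_of A) k, smap f xi = x.
Hypothesis xi_ext : forall (k : qalg) (f g : qalg_hom (qalg_of A) k),
  smap f xi = smap g xi -> f =1 g.

Let QA := qalg_of A.
Let F_smap (k k' : qalg) (f : qalg_hom k k') (x : series M k) :
  F x -> F (smap f x).
Proof. by case: group_F => _ + _ _ _; apply. Qed.
Let smap_mul (k k' : qalg) (f : qalg_hom k k') (x y : series M k) :
  F x -> F y -> smap f (mul x y) = mul (smap f x) (smap f y).
Proof. by case: group_F => _ _ + _ _; apply. Qed.
Let F_group (k : qalg) : is_group_on (@F k) (@mul k) 1.
Proof. by case: group_F. Qed.

Lemma tensor_inl_hom : exists f : qalg_hom QA (fsum_qalg (tensor_data A)),
  forall a, f a = fs_class [:: (a, 1) : tensor_data A].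
Proof.
apply: qalg_hom_exists; [exact: (@tensor_inl_zmod A)| |].
  split=> [|a b]; first exact: tensor_one.
  by symmetry; rewrite [LHS]fs_class1M /= mulr1.
by [].
Qed.

Lemma tensor_inr_hom : exists f : qalg_hom QA (fsum_qalg (tensor_data A)),
  forall a, f a = fs_class [:: (1, a) : tensor_data A].
Proof.
apply: qalg_hom_exists; [exact: (@tensor_inr_zmod A)| |].
  split=> [|a b]; first exact: tensor_one.
  by symmetry; rewrite [LHS]fs_class1M /= mulr1.
by move=> c; apply/fs_classP => V phi [_ _ Z]; rewrite !big_seq1 Z.
Qed.

(** The three inclusions of [A] in its tensor cube, recorded through the product of their values,
    the form in which coassociativity uses them. *)
Lemma tensor3_homs : exists f g h : qalg_hom QA (fsum_qalg (tensor3_data A)),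
  forall a b c, f a * g b * h c = fs_class [:: (a, b, c) : tensor3_data A].
Proof.
have Z1 : zmod_morphism (fun a : A => fs_class [:: (a, 1, 1) : tensor3_data A]).
  move=> a b; apply/(canRL (addrK _)); rewrite -fs_classD; apply/fs_classP.
  by move=> V phi [D _ _ _ _]; rewrite !big_cons !big_nil !addr0 -D subrK.
have Z2 : zmod_morphism (fun a : A => fs_class [:: (1, a, 1) : tensor3_data A]).
  move=> a b; apply/(canRL (addrK _)); rewrite -fs_classD; apply/fs_classP.
  by move=> V phi [_ D _ _ _]; rewrite !big_cons !big_nil !addr0 -D subrK.
have Z3 : zmod_morphism (fun a : A => fs_class [:: (1, 1, a) : tensor3_data A]).
  move=> a b; apply/(canRL (addrK _)); rewrite -fs_classD; apply/fs_classP.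
  by move=> V phi [_ _ D _ _]; rewrite !big_cons !big_nil !addr0 -D subrK.
have E1 : fs_class [:: (1, 1, 1) : tensor3_data A] = 1 by exact: (tensor3_one A).
have [f fE] : exists f : qalg_hom QA (fsum_qalg (tensor3_data A)),
    forall a, f a = fs_class [:: (a, 1, 1) : tensor3_data A].
  apply: qalg_hom_exists => [||c]; [exact: Z1| |by []].
  split=> [|a b]; first exact: E1.
  by symmetry; rewrite [LHS]fs_class1M /= !mulr1.
have [g gE] : exists g : qalg_hom QA (fsum_qalg (tensor3_data A)),
    forall a, g a = fs_class [:: (1, a, 1) : tensor3_data A].
  apply: qalg_hom_exists; first by [].
    split=> [|a b]; first exact: E1.
    by symmetry; rewrite [LHS]fs_class1M /= !mulr1.
  by move=> c; apply/fs_classP => V phi [_ _ _ Z _]; rewrite !big_seq1 Z.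
have [h hE] : exists h : qalg_hom QA (fsum_qalg (tensor3_data A)),
    forall a, h a = fs_class [:: (1, 1, a) : tensor3_data A].
  apply: qalg_hom_exists; first by [].
    split=> [|a b]; first exact: E1.
    by symmetry; rewrite [LHS]fs_class1M /= !mulr1.
  by move=> c; apply/fs_classP => V phi [_ _ _ _ Z]; rewrite !big_seq1 Z.
exists f, g, h => a b c; rewrite fE gE hE.
by rewrite [X in X * _]fs_class1M [LHS]fs_class1M /= !mulr1 !mul1r.
Qed.

Lemma tensor_hom (k : qalg) (f g : qalg_hom QA k) :
  exists h : qalg_hom (fsum_qalg (tensor_data A)) k,
    forall s, h (fs_class s) = \sum_(p <- s) f p.1 * g p.2.
Proof.
pose ev (p : tensor_data A) : k := f p.1 * g p.2.
have t : fs_test ev.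
  split=> [x x' y|x y y'|c x y]; rewrite /ev /=.
  - by rewrite rmorphD mulrDl.
  - by rewrite rmorphD mulrDr.
  rewrite -(mulr_algl c x) -(mulr_algl c y) !rmorphM mulrCA mulrA.
  by congr (_ * _ * _); rewrite (qalg_homE f) (qalg_homE g).
have evM (x y : tensor_data A) : ev (fs_mul x y) = ev x * ev y.
  by rewrite /ev /= !rmorphM mulrACA.
have ev_c c : ev (fs_const (tensor_data A) c) = qalg_in k c.
  by rewrite /ev /= rmorph1 mulr1 (qalg_homE f).
have hc c : fs_hom t evM ev_c (fs_in c) = qalg_in k c.
  by rewrite /= fs_eval_in // ev_c.
exists (@QAlgHom (fsum_qalg (tensor_data A)) k (fs_hom t evM ev_c) hc) => s.
exact: fs_eval_class.
Qed.

(** [D] classifies the product, over the tensor square, of the two copies of the generic point.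
    Specializing along the morphism induced by [f] and [g] on the square turns this product into
    that of the points of [f] and [g], and [D] into their convolution. *)
Lemma comul_hom : exists D : qalg_hom QA (fsum_qalg (tensor_data A)),
  forall (k : qalg) (f g h : qalg_hom QA k),
    (forall a, h a = \sum_(p <- fs_repr (D a)) f p.1 * g p.2) <->
    smap h xi = mul (smap f xi) (smap g xi).
Proof.
have [i1 i1E] := tensor_inl_hom; have [i2 i2E] := tensor_inr_hom.
have F1 := F_smap i1 F_xi; have F2 := F_smap i2 F_xi.
have [_ FM _ _ _] := F_group (fsum_qalg (tensor_data A)).
have [D DE] := xi_hom (FM _ _ F1 F2); exists D => k f g.
have [fg fgE] := tensor_hom f g; have [h0 h0E] := qalg_hom_comp fg D.
have h0x : smap h0 xi = mul (smap f xi) (smap g xi).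
  have -> : smap h0 xi = smap fg (smap D xi) by rewrite smap_comp; apply: eq_smap.
  rewrite DE smap_mul //; congr mul; rewrite smap_comp; apply: eq_smap => a /=.
    by rewrite i1E fgE big_seq1 /= rmorph1 mulr1.
  by rewrite i2E fgE big_seq1 /= rmorph1 mul1r.
have h0M a : h0 a = \sum_(p <- fs_repr (D a)) f p.1 * g p.2.
  by rewrite h0E /= -fgE fs_reprK.
move=> h; split=> [hE|hx a].
  by rewrite -h0x; apply: eq_smap => a; rewrite hE h0M.
by rewrite -h0M; apply: xi_ext; rewrite h0x.
Qed.

Theorem hopf_represented : exists H : hopf_structure A,
  represented_by (fun k k' (f : qalg_hom k k') => @smap M k k' f) F mul H.
Proof.
have [D DP] := comul_hom.
have D_conv (k : qalg) (f g h : qalg_hom QA k) :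
    smap h xi = mul (smap f xi) (smap g xi) ->
    forall a, h a = \sum_(p <- fs_repr (D a)) f p.1 * g p.2.
  by move/DP.
(* The counit is the morphism of the neutral point over Q; its composite [u] with the structure map
   of [A] is the morphism of the neutral point over [A]. *)
have [F1Q _ _ _ _] := F_group ratQ; have [e eE] := xi_hom F1Q.
have eZ : scalable (e : A -> rat^o).
  by move=> c x; rewrite -mulr_algl rmorphM (qalg_homE e).
pose eps : {lrmorphism A -> rat^o} := HB.pack (e : A -> rat^o)
  (GRing.RMorphism.class (e : {rmorphism A -> rat}))
  (GRing.isScalable.Build rat A rat^o *:%R (e : A -> rat^o) eZ).
have [inA inAE] := qalg_hom_in QA; have [idA idAE] := qalg_hom_id QA.
have [u uE] := qalg_hom_comp inA e.
have ux : smap u xi = 1.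
  rewrite -(smap1 M inA) -eE smap_comp; exact: eq_smap.
have idx : smap idA xi = xi by apply/seriesP => m /=; rewrite idAE.
have [FA1 FAM FAA FAe FAV] := F_group QA.
(* The antipode is the morphism of the inverse [eta] of the generic point. *)
have [_ /(_ _ F_xi) [eta [Feta xeta etax]]] := (FAe _ F_xi, FAV).
have [S SE] := xi_hom Feta.
have SZ : scalable (S : A -> A).
  by move=> c x; rewrite -mulr_algl rmorphM (qalg_homE S) mulr_algl.
pose anti : {linear A -> A} := HB.pack (S : A -> A)
  (GRing.Additive.class (S : {rmorphism A -> A}))
  (GRing.isScalable.Build rat A A *:%R (S : A -> A) SZ).
pose com (a : A) : seq (A * A) := fs_repr (D a).
have comE a : fs_class (com a : seq (tensor_data A)) = D a by apply: fs_reprK.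
have [g1 g2] := FAe _ F_xi.
have H1 c x y : tensor_eq (com (c *: x + y))
    ([seq (c *: p.1, p.2) | p <- com x] ++ com y).
  apply: tensor_class_eq; rewrite fs_classD !comE rmorphD -mulr_algl rmorphM.
  congr (_ + _); rewrite (qalg_homE D c) -comE /= !fs_class_sum big_map mulr_sumr.
  apply: eq_bigr => p _; rewrite [LHS]fs_class1M /= mulr_algl mul1r.
  by case: p.
have H2 : tensor_eq (com 1) [:: (1, 1)].
  by apply: tensor_class_eq; rewrite comE rmorph1 tensor_one.
have H3 x y : tensor_eq (com (x * y))
    [seq (p.1 * q.1, p.2 * q.2) | p <- com x, q <- com y].
  by apply: tensor_class_eq; rewrite comE rmorphM.
have H4 x : tensor3_eq
    [seq (q.1, q.2, p.2) | p <- com x, q <- com p.1]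
    [seq (p.1, q.1, q.2) | p <- com x, q <- com p.2].
  have [i [j [l ijl]]] := tensor3_homs.
  have Fi := F_smap i F_xi; have Fj := F_smap j F_xi; have Fl := F_smap l F_xi.
  have [_ TM TA _ _] := F_group (fsum_qalg (tensor3_data A)).
  have [ij ijE] := xi_hom (TM _ _ Fi Fj); have [jl jlE] := xi_hom (TM _ _ Fj Fl).
  (* Both iterated coproducts compute [m], the morphism of the product of the three copies of the
     generic point; this is where associativity of [mul] enters. *)
  have [m mE] := xi_hom (TM _ _ (TM _ _ Fi Fj) Fl).
  apply: tensor3_class_eq; rewrite !fs_class_sum !big_allpairs_dep /=.
  transitivity (m x).
    rewrite (D_conv _ ij l m) ?mE ?ijE //; apply: eq_bigr => p _.
    rewrite (D_conv _ i j ij) ?ijE // mulr_suml.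
    by apply: eq_bigr => q _; rewrite ijl.
  rewrite (D_conv _ i jl m) ?mE ?jlE ?TA //; apply: eq_bigr => p _.
  rewrite (D_conv _ j l jl) ?jlE // mulr_sumr.
  by apply: eq_bigr => q _; rewrite mulrA ijl.
have inAeps a : u a = (eps a : rat) *: 1 by rewrite uE /= inAE.
have H5 x : \sum_(p <- com x) (eps p.1 : rat) *: p.2 = x.
  rewrite -[RHS](idAE x) (D_conv _ u idA) ?ux ?idx ?g1 //.
  by apply: eq_bigr => p _; rewrite inAeps idAE mulr_algl.
have H6 x : \sum_(p <- com x) (eps p.2 : rat) *: p.1 = x.
  rewrite -[RHS](idAE x) (D_conv _ idA u) ?ux ?idx ?g2 //.
  by apply: eq_bigr => p _; rewrite inAeps idAE mulrC mulr_algl.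
have H7 x : \sum_(p <- com x) anti p.1 * p.2 = (eps x : rat) *: 1.
  rewrite -inAeps (D_conv _ S idA) ?ux ?SE ?idx ?etax //.
  by apply: eq_bigr => p _; rewrite idAE.
have H8 x : \sum_(p <- com x) p.1 * anti p.2 = (eps x : rat) *: 1.
  rewrite -inAeps (D_conv _ idA S) ?ux ?SE ?idx ?xeta //.
  by apply: eq_bigr => p _; rewrite idAE.
exists (HopfStructure H1 H2 H3 H4 H5 H6 H7 H8), (fun k f => smap f xi); split.
- by move=> k f; apply: F_smap.
- by move=> k f g; apply: xi_ext.
- by move=> k x /xi_hom.
- by move=> k k' v f g gE; rewrite smap_comp; apply: eq_smap.
by move=> k f g h hE; apply/DP.
Qed.

End Yoneda.

Theorem affine_of_closed (M : gradedMonoidType)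
    (F : forall k : qalg, set (series M k))
    (mul : forall k : qalg, series M k -> series M k -> series M k) :
    is_group_functor (fun k k' (f : qalg_hom k k') => @smap M k k' f) F mul
      (fun k => 1) ->
    (forall (k : qalg) (x : series M k),
      (forall a b : k, (forall (k' : qalg) (f : qalg_hom k k'),
         F k' (smap f x) -> f a = f b) -> a = b) -> F k x) ->
  affine_group_scheme (fun k k' (f : qalg_hom k k') => @smap M k k' f) F mul
    (fun k => 1).
Proof.
move=> gF clF; split=> //.
have F1 : F ratQ 1 by case: gF => /(_ ratQ) [].
exists (coord_ring F1); apply: (hopf_represented gF (generic_pointP F1 clF)).
  by move=> k x /(point_hom F1) [f [fx _]]; exists f.
exact: coord_ring_hom_ext.
Qed.

(** * Continuous linear maps between algebras of series *)

Section SeriesCoefficients.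
Variables (M : gradedMonoidType) (k : comPzRingType).
Implicit Types (a b : series M k) (m : M).

Lemma scoefD a b m : (a + b) m = a m + b m. Proof. by []. Qed.
Lemma scoefN a m : (- a) m = - a m. Proof. by []. Qed.
Lemma scoefZ (c : k) a m : (c *: a) m = c * a m. Proof. by []. Qed.
Lemma coef_mono n m : (mono n : series M k) m = (m == n)%:R. Proof. by []. Qed.
Lemma scoefM a b m : (a * b) m = \sum_(p <- gfactors m) a p.1 * b p.2.
Proof. by []. Qed.
Lemma mono1 : mono 1%g = 1 :> series M k. Proof. by []. Qed.

Lemma scoef_sum I (r : seq I) (P : pred I) (F : I -> series M k) m :
  (\sum_(i <- r | P i) F i) m = \sum_(i <- r | P i) F i m.
Proof. by elim/big_rec2: _ => // i x y _ <-. Qed.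

Lemma sscalerAl (c : k) a b : (c *: a) * b = c *: (a * b).
Proof.
apply/seriesP => m; rewrite scoefZ !scoefM mulr_sumr.
by apply: eq_bigr => p _; rewrite mulrA.
Qed.

Lemma sscalerAr (c : k) a b : a * (c *: b) = c *: (a * b).
Proof.
apply/seriesP => m; rewrite scoefZ !scoefM mulr_sumr.
by apply: eq_bigr => p _; rewrite scoefZ mulrCA.
Qed.

Lemma has_orderZ d (c : k) a : has_order d a -> has_order d (c *: a).
Proof. by move=> oa m lt; rewrite scoefZ oa ?mulr0. Qed.

Lemma has_order_zero d : has_order d (0 : series M k). Proof. by []. Qed.

Lemma has_order_eq0 a : (forall d, has_order d a) -> a = 0.
Proof. by move=> oa; apply/seriesP => m; apply: (oa (gdeg m).+1). Qed.

End SeriesCoefficients.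

(* Preserving the order makes f continuous: f is determined by its values on the
   monomials. *)
Definition clin (M N : gradedMonoidType) (k : comPzRingType)
    (f : series M k -> series N k) : Prop :=
  linear f /\ forall d a, has_order d a -> has_order d (f a).

Section ContinuousLinear.
Variables (M N L : gradedMonoidType) (k : comPzRingType).
Implicit Types (f g : series M k -> series N k) (a b : series M k).

Section OneMap.
Variable f : series M k -> series N k.
Hypothesis cf : clin f.

Lemma clinD a b : f (a + b) = f a + f b.
Proof. by have := cf.1 1 a b; rewrite !scale1r. Qed.
Lemma clin0 : f 0 = 0.
Proof. by apply: (addrI (f 0)); rewrite -clinD !addr0. Qed.
Lemma clinZ c a : f (c *: a) = c *: f a.
Proof. by have := cf.1 c a 0; rewrite clin0 !addr0. Qed.
Lemma clinN a : f (- a) = - f a.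
Proof. by apply: (addrI (f a)); rewrite -clinD !subrr clin0. Qed.
Lemma clinB a b : f (a - b) = f a - f b.
Proof. by rewrite clinD clinN. Qed.
Lemma clin_sum I (r : seq I) (P : pred I) (F : I -> series M k) :
  f (\sum_(i <- r | P i) F i) = \sum_(i <- r | P i) f (F i).
Proof. exact: (big_morph f clinD clin0). Qed.

Lemma clin_cont_ext a : f a = cont_ext (fun m => f (mono m)) a.
Proof.
apply/seriesP => n /=; set d := gdeg n.
(* The part of [a] in degrees at most that of [n] is a finite sum; the order of the remainder is too
   large for its image to have a term at [n]. *)
pose t := \sum_(m <- gelems M d) a m *: (mono m : series M k).
have o_r : has_order d.+1 (a - t).
  move=> m lt; rewrite scoefD scoefN scoef_sum (bigD1_seq m) /= ?mem_gelems //;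
    last exact: gelems_uniq.
  rewrite eqxx mulr1 big1 ?addr0 ?subrr // => i /negPf ne.
  by rewrite eq_sym ne mulr0.
rewrite -[a in LHS](subrK t) clinD scoefD (cf.2 _ _ o_r) ?add0r //.
by rewrite /t clin_sum scoef_sum; apply: eq_bigr => m _; rewrite clinZ.
Qed.

End OneMap.

Lemma cont_ext_clin (tau : M -> series N k) :
  (forall m n, (gdeg n < gdeg m)%N -> tau m n = 0) -> clin (cont_ext tau).
Proof.
move=> tau_deg; split=> [c a b|d a oa n lt].
  apply/seriesP => n; rewrite scoefD scoefZ /= mulr_sumr -big_split /=.
  by apply: eq_bigr => m _; rewrite mulrDl mulrA.
rewrite /= big1_seq // => m /=; rewrite mem_gelems => le.
by rewrite oa ?mul0r //; apply: leq_ltn_trans lt.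
Qed.

Lemma clin_ext_on (P : pred M) f g : clin f -> clin g ->
    (forall m, P m -> f (mono m) = g (mono m)) ->
  forall a, (forall m, a m != 0 -> P m) -> f a = g a.
Proof.
move=> cf cg fg a aP; rewrite (clin_cont_ext cf) (clin_cont_ext cg).
apply/seriesP => n /=; apply: eq_bigr => m _.
by have [->|/aP/fg->//] := eqVneq (a m) 0; rewrite !mul0r.
Qed.

Lemma clin_ext f g : clin f -> clin g ->
  (forall m, f (mono m) = g (mono m)) -> f =1 g.
Proof. by move=> cf cg fg a; apply: (@clin_ext_on predT). Qed.

Lemma clin_comp (h : series N k -> series L k) f :
  clin h -> clin f -> clin (h \o f).
Proof.
move=> ch cf; split=> [c a b|d a oa] /=; first by rewrite cf.1 ch.1.
by apply: ch.2; apply: cf.2.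
Qed.

Lemma clin_id : clin (id : series M k -> _). Proof. by []. Qed.

Lemma clin_zero : clin (fun _ : series M k => 0 : series N k).
Proof. by split=> // c a b; rewrite scaler0 addr0. Qed.

Lemma clin_add f g : clin f -> clin g -> clin (fun a => f a + g a).
Proof.
move=> cf cg; split=> [c a b|d a oa]; last first.
  by apply: has_orderD; [apply: cf.2|apply: cg.2].
by rewrite cf.1 cg.1 scalerDr addrACA.
Qed.

Lemma clin_opp f : clin f -> clin (fun a => - f a).
Proof.
move=> cf; split=> [c a b|d a oa]; last by apply: has_orderN; apply: cf.2.
by rewrite cf.1 opprD scalerN.
Qed.

Lemma clin_scale (c : k) f : clin f -> clin (fun a => c *: f a).
Proof.
move=> cf; split=> [d a b|d a oa]; last by apply: has_orderZ; apply: cf.2.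
by rewrite cf.1 scalerDr !scalerA mulrC.
Qed.

Lemma clin_sub f g : clin f -> clin g -> clin (fun a => f a - g a).
Proof. by move=> cf cg; apply: clin_add => //; apply: clin_opp. Qed.

Lemma clin_mulr f u : clin f -> clin (fun a => f a * u).
Proof.
move=> cf; split=> [c a b|d a oa]; first by rewrite cf.1 mulrDl sscalerAl.
by rewrite -[d]addn0; apply: has_orderM => //; apply: cf.2.
Qed.

Lemma clin_mull f u : clin f -> clin (fun a => u * f a).
Proof.
move=> cf; split=> [c a b|d a oa]; first by rewrite cf.1 mulrDr sscalerAr.
by rewrite -[d]add0n; apply: has_orderM => //; apply: cf.2.
Qed.

Lemma clin_tensl f (u : series L k) : clin f -> clin (fun a => tens (f a) u).
Proof.
move=> cf; split=> [c a b|d a oa]; last first.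
  by rewrite -[d]addn0; apply: has_order_tens => //; apply: cf.2.
by rewrite cf.1; apply/seriesP => m /=; rewrite mulrDl mulrA.
Qed.

Lemma clin_tensr f (u : series L k) : clin f -> clin (fun a => tens u (f a)).
Proof.
move=> cf; split=> [c a b|d a oa]; last first.
  by rewrite -[d]add0n; apply: has_order_tens => //; apply: cf.2.
rewrite cf.1; apply/seriesP => m /=; rewrite mulrDr.
by rewrite mulrCA.
Qed.

End ContinuousLinear.

Lemma bilin_ext (M M' N : gradedMonoidType) (k : comPzRingType)
    (B C : series M k -> series M' k -> series N k) :
    (forall y, clin (B^~ y)) -> (forall a, clin (B a)) ->
    (forall y, clin (C^~ y)) -> (forall a, clin (C a)) ->
    (forall m n, B (mono m) (mono n) = C (mono m) (mono n)) ->
  forall a y, B a y = C a y.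
Proof.
move=> Bl Br Cl Cr BC a y; apply: (clin_ext (Bl y) (Cl y)) => m /=.
exact: (clin_ext (Br _) (Cr _) (BC m)).
Qed.

Lemma clin_eq (M N : gradedMonoidType) (k : comPzRingType)
  (f g : series M k -> series N k) : f =1 g -> clin f -> clin g.
Proof. by move/funext->. Qed.

Ltac clin_tac := repeat first
  [ eassumption | apply: clin_id | apply: clin_add | apply: clin_opp
  | apply: clin_mulr | apply: clin_mull | apply: clin_tensl
  | apply: clin_tensr ].

Section ContinuousMorphisms.
Variables (M N L : gradedMonoidType) (k : comPzRingType).

Definition chom (f : series M k -> series N k) : Prop :=
  [/\ clin f, f 1 = 1 & {morph f : a b / a * b}].

Lemma chom_clin f : chom f -> clin f. Proof. by case. Qed.

Lemma chomP (f : series M k -> series N k) : clin f -> f 1 = 1 ->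
  (forall m n, f (mono (m * n)%g) = f (mono m) * f (mono n)) -> chom f.
Proof.
move=> cf f1 fM; split=> // a b.
apply: (bilin_ext (B := fun a b => f (a * b)) (C := fun a b => f a * f b))
  => [b'|a'|b'|a'|m n].
- by apply: (clin_comp cf); apply: clin_mulr; apply: clin_id.
- by apply: (clin_comp cf); apply: clin_mull; apply: clin_id.
- exact: clin_mulr.
- exact: clin_mull.
by rewrite monoM fM.
Qed.

End ContinuousMorphisms.

Lemma chom_comp (M N L : gradedMonoidType) (k : comPzRingType)
    (g : series N k -> series L k) (f : series M k -> series N k) :
  chom g -> chom f -> chom (g \o f).
Proof.
case=> cg g1 gM [cf f1 fM]; split=> [||a b] /=; first exact: clin_comp.
  by rewrite f1.
by rewrite fM gM.
Qed.

Lemma word_ind (X : finType) (P : word X -> Prop) : P [::] ->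
  (forall x (u : word X), P u -> P (x :: u)) -> forall u, P u.
Proof. exact: list_ind. Qed.

Section FreeMorphisms.
Variables (X : finType) (N : gradedMonoidType) (k : comPzRingType).
Local Notation kX := (series (word X) k).
Implicit Types f g : kX -> series N k.

Lemma mono_cons x (u : word X) :
  mono (x :: u : word X) = mono (letter x) * mono u :> kX.
Proof. by rewrite monoM. Qed.

Lemma mono_nil : mono ([::] : word X) = 1 :> kX. Proof. by []. Qed.

Lemma alg_ext_chom (sigma : X -> series N k) :
  (forall x, has_order 1 (sigma x)) -> chom (alg_ext sigma).
Proof.
move=> os; split=> [||a b]; last exact: alg_extM.
  by apply: cont_ext_clin => m n; apply: alg_ext_tau.
exact: alg_ext1.
Qed.

Lemma chom_word_ext f g : chom f -> chom g ->
  (forall x, f (mono (letter x)) = g (mono (letter x))) -> f =1 g.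
Proof.
case=> cf f1 fM [cg g1 gM] fg; apply: clin_ext => //.
elim=> [|x u IH]; first by rewrite mono_nil f1 g1.
by rewrite mono_cons fM gM fg IH.
Qed.

Lemma derivation_word_ext (phi psi D E : kX -> series N k) :
  clin D -> clin E ->
  (forall a b, D (a * b) = D a * phi b + psi a * D b) ->
  (forall a b, E (a * b) = E a * phi b + psi a * E b) ->
  phi 1 = 1 -> psi 1 = 1 ->
  (forall x, D (mono (letter x)) = E (mono (letter x))) -> D =1 E.
Proof.
move=> cD cE DM EM p1 q1 DE; apply: clin_ext => //.
have D1 : D 1 = 0.
  by apply: (addrI (D 1)); rewrite addr0 -{3}[1]mulr1 DM p1 q1 mulr1 mul1r.
have E1 : E 1 = 0.
  by apply: (addrI (E 1)); rewrite addr0 -{3}[1]mulr1 EM p1 q1 mulr1 mul1r.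
elim=> [|x u IH]; first by rewrite mono_nil D1 E1.
by rewrite mono_cons DM EM DE IH.
Qed.

(** The empty word is the only word of degree 0, so [a] minus its constant term has order 1, and so
    has its image. *)
Lemma chom_nil f a : chom f -> f a 1%g = a [::].
Proof.
case=> cf f1 _; pose r : kX := a - a [::] *: (1 : kX).
have aE : a = r + a [::] *: (1 : kX) by rewrite subrK.
have r1 : has_order 1 r.
  by case=> [|x u] // _; rewrite scoefD scoefN scoefZ coef_mono eqxx mulr1 subrr.
rewrite {1}aE (clinD cf) (clinZ cf) f1 scoefD scoefZ coef_mono eqxx mulr1.
by rewrite (cf.2 1%N r r1) ?gdeg1 // add0r.
Qed.

End FreeMorphisms.

Section Tensors.
Variables (M N : gradedMonoidType) (k : comPzRingType).
Implicit Types (a : series M k) (b : series N k).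

Lemma tens_mono (m : M) (n : N) :
  tens (mono m) (mono n) = mono (m, n) :> series (M * N)%type k.
Proof. by apply/seriesP => -[x y] /=; rewrite -natrM mulnb xpair_eqE. Qed.

Lemma tens11 : tens 1 1 = 1 :> series (M * N)%type k.
Proof. exact: tens_mono. Qed.

Lemma tensDl a a' b : tens (a + a') b = tens a b + tens a' b.
Proof. by rewrite (clinD (clin_tensl b (@clin_id M k))). Qed.
Lemma tensDr a b b' : tens a (b + b') = tens a b + tens a b'.
Proof. by rewrite (clinD (clin_tensr a (@clin_id N k))). Qed.
Lemma tensBl a a' b : tens (a - a') b = tens a b - tens a' b.
Proof. by rewrite (clinB (clin_tensl b (@clin_id M k))). Qed.
Lemma tensBr a b b' : tens a (b - b') = tens a b - tens a b'.
Proof. by rewrite (clinB (clin_tensr a (@clin_id N k))). Qed.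
Lemma tensNl a b : tens (- a) b = - tens a b.
Proof. by rewrite (clinN (clin_tensl b (@clin_id M k))). Qed.
Lemma tensNr a b : tens a (- b) = - tens a b.
Proof. by rewrite (clinN (clin_tensr a (@clin_id N k))). Qed.
Lemma tens0l b : tens 0 b = 0 :> series (M * N)%type k.
Proof. exact: (clin0 (clin_tensl b (@clin_id M k))). Qed.
Lemma tens0r a : tens a 0 = 0 :> series (M * N)%type k.
Proof. exact: (clin0 (clin_tensr a (@clin_id N k))). Qed.

Lemma tensM a b a' b' : tens a b * tens a' b' = tens (a * a') (b * b').
Proof.
move: a; apply: clin_ext => [||m]; [clin_tac..|].
move: b; apply: clin_ext => [||n]; [clin_tac..|].
move: a'; apply: clin_ext => [||m']; [clin_tac..|].
move: b'; apply: clin_ext => [||n']; [clin_tac..|].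
by rewrite !tens_mono !monoM tens_mono.
Qed.

Variables (f : series M k -> series M k) (g : series N k -> series N k).
Hypotheses (cf : clin f) (cg : clin g).

Lemma tens_map_clin : clin (tens_map f g).
Proof.
apply: cont_ext_clin => p n lt.
apply: (has_order_tens (d := gdeg p.1) (e := gdeg p.2)) => //.
  by apply: cf.2; apply: has_order_mono.
by apply: cg.2; apply: has_order_mono.
Qed.

Lemma tens_map_mono p :
  tens_map f g (mono p) = tens (f (mono p.1)) (g (mono p.2)).
Proof.
rewrite /tens_map cont_ext_mono // => q n lt.
apply: (has_order_tens (d := gdeg q.1) (e := gdeg q.2)) => //.
  by apply: cf.2; apply: has_order_mono.
by apply: cg.2; apply: has_order_mono.
Qed.

Lemma tens_map_tens a b : tens_map f g (tens a b) = tens (f a) (g b).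
Proof.
move: a b; apply: bilin_ext => [b|a|b|a|m n].
- by apply: (clin_comp tens_map_clin); apply: clin_tensl; apply: clin_id.
- by apply: (clin_comp tens_map_clin); apply: clin_tensr; apply: clin_id.
- exact: clin_tensl.
- exact: clin_tensr.
by rewrite tens_mono tens_map_mono.
Qed.

End Tensors.

Section TensorMaps.
Variables (M N : gradedMonoidType) (k : comPzRingType).
Implicit Types (f : series M k -> series M k) (g : series N k -> series N k).

Lemma tens_map_chom f g : chom f -> chom g -> chom (tens_map f g).
Proof.
case=> cf f1 fM [cg g1 gM]; apply: chomP; first exact: tens_map_clin.
  by rewrite -tens11 tens_map_tens // f1 g1.
move=> [m1 n1] [m2 n2]; rewrite !tens_map_mono //= tensM -fM -gM.
by rewrite !monoM.
Qed.

Lemma tens_map_comp f f' g g' : clin f -> clin f' -> clin g -> clin g' ->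
  tens_map (f \o f') (g \o g') =1 tens_map f g \o tens_map f' g'.
Proof.
move=> cf cf' cg cg'; have cff := clin_comp cf cf'; have cgg := clin_comp cg cg'.
apply: clin_ext => [||p]; first exact: tens_map_clin.
  by apply: clin_comp; apply: tens_map_clin.
by rewrite /= !tens_map_mono //= tens_map_tens.
Qed.

Lemma tens_map_id : tens_map id id =1 (@id (series (M * N)%type k)).
Proof.
apply: clin_ext => [||[m n]] //; first exact: tens_map_clin.
by rewrite tens_map_mono //= tens_mono.
Qed.

End TensorMaps.

(** * Extension of scalars for series *)

Section ScalarExtension.
Variables (M : gradedMonoidType) (k k' : comPzRingType) (f : {rmorphism k -> k'}).
Local Notation sf := (smap f : series M k -> series M k').

Fact smap_zmod : zmod_morphism sf.
Proof. by move=> a b; apply/seriesP => m /=; rewrite rmorphB. Qed.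
Fact smap_monoid : monoid_morphism sf.
Proof.
split=> [|a b]; apply/seriesP => m /=; first by rewrite rmorph_nat.
by rewrite rmorph_sum; apply: eq_bigr => p _; rewrite rmorphM.
Qed.
HB.instance Definition _ := GRing.isZmodMorphism.Build
  (series M k) (series M k') (smap f) smap_zmod.
HB.instance Definition _ := GRing.isMonoidMorphism.Build
  (series M k) (series M k') (smap f) smap_monoid.

(* Stated for [smap f] itself, while the generic lemmas on morphisms leave the
   canonical projection in place. *)
Lemma smapD (a b : series M k) : smap f (a + b) = smap f a + smap f b.
Proof. exact: rmorphD. Qed.
Lemma smapN (a : series M k) : smap f (- a) = - smap f a.
Proof. exact: rmorphN. Qed.
Lemma smapM (a b : series M k) : smap f (a * b) = smap f a * smap f b.
Proof. exact: rmorphM. Qed.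
Lemma smap_0 : smap f (0 : series M k) = 0. Proof. exact: rmorph0. Qed.
Lemma smap_1 : smap f (1 : series M k) = 1. Proof. exact: rmorph1. Qed.
Lemma smapXn (a : series M k) n : smap f (a ^+ n) = smap f a ^+ n.
Proof. exact: rmorphXn. Qed.
Lemma smap_sum I (r : seq I) (P : pred I) (F : I -> series M k) :
  smap f (\sum_(i <- r | P i) F i) = \sum_(i <- r | P i) smap f (F i).
Proof. exact: rmorph_sum. Qed.
Lemma smap_prod I (r : seq I) (P : pred I) (F : I -> series M k) :
  smap f (\prod_(i <- r | P i) F i) = \prod_(i <- r | P i) smap f (F i).
Proof. exact: rmorph_prod. Qed.

Lemma smap_mono m : smap f (mono m) = mono m :> series M k'.
Proof. by apply/seriesP => n /=; rewrite rmorph_nat. Qed.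

End ScalarExtension.

Section ScalarExtensionMaps.
Variables (M N : gradedMonoidType) (k k' : comPzRingType) (f : {rmorphism k -> k'}).

Lemma smap_tens (a : series M k) (b : series N k) :
  smap f (tens a b) = tens (smap f a) (smap f b).
Proof. by apply/seriesP => p /=; rewrite rmorphM. Qed.

Lemma smap_cont_ext (tau : M -> series N k) (a : series M k) :
  smap f (cont_ext tau a) = cont_ext (fun m => smap f (tau m)) (smap f a).
Proof.
apply/seriesP => n /=; rewrite rmorph_sum.
by apply: eq_bigr => m _; rewrite rmorphM.
Qed.

Lemma eq_cont_ext (tau tau' : M -> series N k) (a : series M k) :
  tau =1 tau' -> cont_ext tau a = cont_ext tau' a.
Proof. by move/funext->. Qed.
End ScalarExtensionMaps.

Lemma smap_alg_ext (X : finType) (N : gradedMonoidType) (k k' : comPzRingType)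
    (f : {rmorphism k -> k'}) (sigma : X -> series N k) (a : series (word X) k) :
  smap f (alg_ext sigma a) = alg_ext (fun x => smap f (sigma x)) (smap f a).
Proof.
rewrite /alg_ext smap_cont_ext; apply: eq_cont_ext => u.
by rewrite smap_prod.
Qed.

Lemma smap_tens_map (M N : gradedMonoidType) (k k' : comPzRingType)
    (f : {rmorphism k -> k'})
    (g : series M k -> series M k) (g' : series M k' -> series M k')
    (h : series N k -> series N k) (h' : series N k' -> series N k') a :
  (forall x, smap f (g x) = g' (smap f x)) ->
  (forall x, smap f (h x) = h' (smap f x)) ->
  smap f (tens_map g h a) = tens_map g' h' (smap f a).
Proof.
move=> gg' hh'; rewrite /tens_map smap_cont_ext; apply: eq_cont_ext => p.
by rewrite smap_tens gg' hh' !smap_mono.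
Qed.

(** * Inverses and unipotent maps *)

Section Inverses.
Variables (M : gradedMonoidType) (k : comPzRingType).
Implicit Types a b u : series M k.

Lemma sinv_eq a b : a * b = 1 -> b * a = 1 -> sinv a = b.
Proof.
move=> ab ba; rewrite /sinv; case: xgetP => [c _ [ac ca]|/(_ b)[]//].
by rewrite -[c]mulr1 -ab mulrA ca mul1r.
Qed.

Lemma sinvK a : sinvertible a -> a * sinv a = 1.
Proof. by case=> b [ab ba]; rewrite (sinv_eq ab ba). Qed.
Lemma sinvKl a : sinvertible a -> sinv a * a = 1.
Proof. by case=> b [ab ba]; rewrite (sinv_eq ab ba). Qed.
Lemma sinv_invertible a : sinvertible a -> sinvertible (sinv a).
Proof. by move=> ia; exists a; rewrite sinvK ?sinvKl. Qed.
Lemma sinv1 : sinv 1 = 1 :> series M k.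
Proof. by apply: sinv_eq; rewrite mulr1. Qed.

Lemma sinvM a b : sinvertible a -> sinvertible b ->
  sinvertible (a * b) /\ sinv (a * b) = sinv b * sinv a.
Proof.
move=> ia ib.
have e1 : a * b * (sinv b * sinv a) = 1.
  by rewrite mulrA -(mulrA a) sinvK // mulr1 sinvK.
have e2 : sinv b * sinv a * (a * b) = 1.
  by rewrite mulrA -(mulrA (sinv b)) sinvKl // mulr1 sinvKl.
by split; [exists (sinv b * sinv a)|apply: sinv_eq].
Qed.

Lemma sAdM u a b : sinvertible u -> sAd u (a * b) = sAd u a * sAd u b.
Proof.
by move=> iu; rewrite /sAd !mulrA -[_ * sinv u * u]mulrA sinvKl // mulr1.
Qed.

Lemma sAd_chom u : sinvertible u -> chom (sAd u).
Proof.
move=> iu; split=> [||a b]; last exact: sAdM.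
  by apply: clin_mulr; apply: clin_mull; apply: clin_id.
by rewrite /sAd mulr1 sinvK.
Qed.

Lemma sAd_comp u v a : sinvertible u -> sinvertible v ->
  sAd u (sAd v a) = sAd (u * v) a.
Proof. by move=> iu iv; rewrite /sAd (sinvM iu iv).2 !mulrA. Qed.

End Inverses.

Lemma chom_inv (M N : gradedMonoidType) (k : comPzRingType)
    (f : series M k -> series N k) a : chom f -> sinvertible a ->
  sinvertible (f a) /\ sinv (f a) = f (sinv a).
Proof.
case=> _ f1 fM ia.
have e1 : f a * f (sinv a) = 1 by rewrite -fM sinvK.
have e2 : f (sinv a) * f a = 1 by rewrite -fM sinvKl.
by split; [exists (f (sinv a))|apply: sinv_eq].
Qed.

Lemma smap_inv (M : gradedMonoidType) (k k' : comPzRingType)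
    (f : {rmorphism k -> k'}) (a : series M k) : sinvertible a ->
  sinvertible (smap f a) /\ sinv (smap f a) = smap f (sinv a).
Proof.
move=> ia.
have e1 : smap f a * smap f (sinv a) = 1 by rewrite -rmorphM sinvK ?rmorph1.
have e2 : smap f (sinv a) * smap f a = 1 by rewrite -rmorphM sinvKl ?rmorph1.
by split; [exists (smap f (sinv a))|apply: sinv_eq].
Qed.

Section Unipotent.
Variables (M : gradedMonoidType) (k : comPzRingType).
Variable f : series M k -> series M k.
Hypotheses (cf : clin f)
  (f_uni : forall m, has_order (gdeg m).+1 (f (mono m) - mono m)).

Let nil (a : series M k) : series M k := a - f a.

Let nil_clin : clin nil.
Proof. exact: clin_sub. Qed.

Lemma unipotent_order d a : has_order d a -> has_order d.+1 (a - f a).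
Proof.
move=> oa n lt; rewrite -/(nil a) (clin_cont_ext nil_clin) /= big1 // => m _.
have [ltm|lem] := ltnP (gdeg m) d; first by rewrite oa ?mul0r.
have /f_uni fm : (gdeg n < (gdeg m).+1)%N by apply: leq_trans lt _; rewrite ltnS.
rewrite -[X in _ * X]/(nil (mono m) n) /nil -opprB scoefN.
by rewrite [(f _ - _) n]fm oppr0 mulr0.
Qed.

Lemma unipotent_inj a b : f a = f b -> a = b.
Proof.
move=> ab; apply/eqP; rewrite -subr_eq0; apply/eqP.
have f0 : f (a - b) = 0 by rewrite clinB // ab subrr.
apply: has_order_eq0; elim=> // d /unipotent_order.
by rewrite f0 subr0.
Qed.

(** The preimage is the Neumann series with terms (id - f)^i b. The i-th term has order i, so each
    coefficient is read off a finite partial sum and no limit is taken. *)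
Lemma unipotent_surj b : exists a, f a = b.
Proof.
pose t i := iter i nil b.
have ot i : has_order i (t i).
  by elim: i => //= i /unipotent_order.
pose S d := \sum_(i < d) t i.
have fS d : f (S d) = b - t d.
  rewrite /S (clin_sum cf); elim: d => [|d IH].
    by rewrite big_ord0 subrr.
  by rewrite big_ord_recr IH /= -/(t d) /nil opprB (addrC (f _)) addrA.
exists (Series (fun n => S (gdeg n).+1 n)); set a := Series _.
apply/seriesP => n; have oa : has_order (gdeg n).+1 (a - S (gdeg n).+1).
  move=> m lt; rewrite scoefD scoefN /= /S !scoef_sum.
  (* The additional terms of the longer partial sum have order greater than the degree of [m]. *)
  rewrite -(subnKC (lt : gdeg m < _)%N) big_split_ord /=.
  rewrite [X in _ - (_ + X)]big1 ?addr0 ?subrr // => i _.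
  exact: (ot (gdeg m + i).+1 m (leq_addr _ _ : (gdeg m < (gdeg m + i).+1)%N)).
have := cf.2 _ _ oa n (ltnSn _); rewrite clinB // fS.
by move/eqP; rewrite scoefD scoefN scoefD scoefN (ot _ n) // subr0 subr_eq0 => /eqP.
Qed.

End Unipotent.

Section WordInverses.
Variables (X : finType) (k : comPzRingType).
Implicit Types a : series (word X) k.

Lemma word_order1 a : a [::] = 0 -> has_order 1 a.
Proof. by move=> a0 [|x u]. Qed.

Lemma word_unit_order a : a [::] = 1 -> has_order 1 (a - 1).
Proof.
by move=> a1; apply: word_order1; rewrite scoefD scoefN a1 coef_mono eqxx subrr.
Qed.

(** The multiplications by [a] on either side are unipotent, hence onto; the two one-sided inverses
    then agree. *)
Lemma word_invertible a : a [::] = 1 -> sinvertible a.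
Proof.
move=> /word_unit_order o1.
have [|m|b /= ab] := unipotent_surj (f := fun x => a * x) _ _ 1.
- by apply: clin_mull; apply: clin_id.
- rewrite -{2}[mono m]mul1r -mulrBl -add1n; apply: has_orderM => //.
  exact: has_order_mono.
have [|m|c /= ca] := unipotent_surj (f := fun x => x * a) _ _ 1.
- by apply: clin_mulr; apply: clin_id.
- rewrite -{2}[mono m]mulr1 -mulrBr -addn1; apply: has_orderM => //.
  exact: has_order_mono.
have cb : c = b by rewrite -[c]mulr1 -ab mulrA ca mul1r.
by exists b; rewrite -{2}cb.
Qed.

Lemma gfactors_nil : gfactors ([::] : word X) = [:: ([::], [::])].
Proof.
apply: perm_small_eq => //; apply: uniq_perm; rewrite ?gfactors_uniq //.
by move=> [[|x u] [|y v]]; rewrite mem_gfactors inE.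
Qed.

Lemma coef_nilM a b : (a * b) [::] = a [::] * b [::].
Proof. by rewrite scoefM gfactors_nil big_seq1. Qed.

End WordInverses.

Lemma unit_wordE (w : word unit) : w = nseq (size w) tt.
Proof. by elim: w => [|[] w {1}->]. Qed.

Lemma pseries_mulC (k : comPzRingType) (f g : pseries k) : f * g = g * f.
Proof.
move: f g; apply: bilin_ext => [b|a|b|a|m n]; [clin_tac..|].
rewrite !monoM; congr mono; rewrite [m]unit_wordE [n]unit_wordE.
by rewrite -[LHS]nseqD -[RHS]nseqD addnC.
Qed.

(** * The exponential of power series in one variable *)

Section Exponential.
Variable k : qalg.
Implicit Types f g : pseries k.

Let q n : k := qalg_in k n`!%:R^-1.

Lemma exp_coef_binomial n i : (i <= n)%N ->
  q n * 'C(n, i)%:R = q (n - i) * q i.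
Proof.
move=> le; rewrite -(rmorph_nat (qalg_in k)) -!rmorphM; congr (qalg_in k _).
rewrite -(bin_fact le) !natrM !invfM mulrAC mulVf ?mul1r 1?mulrC //.
by rewrite Num.Theory.pnatr_eq0 -lt0n bin_gt0.
Qed.

Lemma sum_triangle (V : zmodType) (T : nat -> nat -> V) D :
  \sum_(n < D) \sum_(i < n.+1) T (n - i)%N i =
  \sum_(i < D) \sum_(j < D - i) T j i.
Proof.
elim: D => [|D IH]; first by rewrite !big_ord0.
rewrite big_ord_recr IH /= [RHS]big_ord_recr /= subSnn.
rewrite [X in _ = _ + X]big_ord_recl big_ord0 addr0.
rewrite [X in _ + X = _]big_ord_recr /= subnn addrA -big_split /=.
congr (_ + _); apply: eq_bigr => i _; rewrite subSn; last by apply: ltnW.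
by rewrite big_ord_recr.
Qed.

Lemma has_orderX f n : has_order 1 f -> has_order n (f ^+ n).
Proof.
move=> of1; elim: n => [|n IH]; first exact: has_order0.
by rewrite exprS -add1n; apply: has_orderM.
Qed.

(** Any truncation beyond the degree of [w] will do, so that the factors of a product can share
    one. *)
Lemma ps_exp_coef f N w : has_order 1 f -> (gdeg w <= N)%N ->
  ps_exp f w = (\sum_(n < N.+1) q n *: f ^+ n) w.
Proof.
move=> of1 le; rewrite scoef_sum -(subnKC (le : (gdeg w).+1 <= N.+1)%N).
rewrite big_split_ord /= [X in _ + X]big1 ?addr0 // => i _.
rewrite -[_ * _]/((q _ *: f ^+ _) w) scoefZ (has_orderX of1) ?mulr0 //.
exact: leq_addr.
Qed.

(** The binomial theorem gives the terms f^j g^i with i + j at most d, the product of the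
    exponentials those with i and j at most d. The extra terms have order greater than d and do not
    reach [w]. *)
Lemma ps_expD f g : has_order 1 f -> has_order 1 g ->
  ps_exp (f + g) = ps_exp f * ps_exp g.
Proof.
move=> of1 og1; apply/seriesP => w; set d := gdeg w.
pose T j i := (q j * q i * (f ^+ j * g ^+ i) w).
rewrite (ps_exp_coef (has_orderD of1 og1) (leqnn d)) scoef_sum.
transitivity (\sum_(n < d.+1) \sum_(i < n.+1) T (n - i)%N i).
  apply: eq_bigr => n _; rewrite scoefZ exprDn_comm; last exact: pseries_mulC.
  rewrite scoef_sum mulr_sumr; apply: eq_bigr => i _.
  rewrite /T -exp_coef_binomial; last by rewrite -ltnS.
  by rewrite -mulrA; congr (_ * _); rewrite -scaler_nat scoefZ.
rewrite sum_triangle scoefM.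
transitivity (\sum_(i < d.+1) \sum_(j < d.+1) T j i).
  apply: eq_bigr => i _; have le : (d.+1 - i <= d.+1)%N by rewrite leq_subr.
  rewrite (big_ord_widen _ (fun j => T j i) le) big_mkcond /=.
  apply: eq_bigr => j _; case: ltnP => // lt.
  rewrite /T (_ : (f ^+ j * g ^+ i) w = 0) ?mulr0 //.
  have lt_d : (gdeg w < j + i)%N by rewrite -/d; lia.
  have o_fg : has_order (j + i) (f ^+ j * g ^+ i).
    by apply: has_orderM; apply: has_orderX.
  exact: o_fg.
transitivity (((\sum_(j < d.+1) q j *: f ^+ j) * (\sum_(i < d.+1) q i *: g ^+ i)) w).
  rewrite mulr_suml exchange_big /= scoef_sum; apply: eq_bigr => j _.
  rewrite mulr_sumr scoef_sum; apply: eq_bigr => i _.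
  by rewrite sscalerAl sscalerAr scalerA.
rewrite scoefM; apply: eq_big_seq => p; rewrite mem_gfactors => /eqP pw.
rewrite (ps_exp_coef (N := d) of1) ?(ps_exp_coef (N := d) og1) //.
  by rewrite /d -pw gdegM leq_addl.
by rewrite /d -pw gdegM leq_addr.
Qed.

Lemma ps_exp_nil f : ps_exp f [::] = 1.
Proof.
by rewrite /= big_ord_recl big_ord0 addr0 expr0 /qscale invr1 rmorph1 mul1r.
Qed.

Lemma ps_exp0 : ps_exp (0 : pseries k) = 1.
Proof.
apply/seriesP => w; rewrite (ps_exp_coef (N := gdeg w)) // big_ord_recl big1.
  by rewrite addr0 /q invr1 rmorph1 scale1r.
by move=> i _; rewrite exprS mul0r scaler0.
Qed.

End Exponential.

(** * The group law and the automorphisms of V *)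

Section GroupLaw.
Variables (gT : finGroupType) (k : comPzRingType).
Local Notation kX := (series (wordX gT) k).
Implicit Types (Psi Phi a : kX) (g h : gT).

Lemma xvar_order x : has_order 1 (xvar k x : kX).
Proof. exact: (@has_order_mono k (wordX gT) (letter x)). Qed.

Lemma tshift_chom g : chom (tshift g : kX -> kX).
Proof. by apply: alg_ext_chom => x; apply: xvar_order. Qed.

Lemma tshift_xvar g x :
  tshift g (xvar k x) = xvar k (omap (fun h => (g * h)%g) x).
Proof. by apply: alg_ext_letter => y; apply: xvar_order. Qed.

Lemma tshift_comp g h a : tshift g (tshift h a) = tshift (g * h)%g a.
Proof.
move: a; apply: chom_word_ext => [||x].
- by apply: chom_comp; apply: tshift_chom.
- exact: tshift_chom.
rewrite /= -!/(xvar k x) !tshift_xvar; case: x => [x|] //=; by rewrite mulgA.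
Qed.

Lemma tshift_nil g a : tshift g a [::] = a [::].
Proof. exact: (chom_nil a (tshift_chom g)). Qed.

Lemma autX_order Psi (x : option gT) :
  has_order 1 (if x is Some g then tshift g (sinv Psi) * xvar k x * tshift g Psi
               else xvar k x).
Proof.
case: x => [g|]; last exact: xvar_order.
rewrite -[1%N]/(0 + 1 + 0)%N; apply: has_orderM => //; apply: has_orderM => //.
exact: xvar_order.
Qed.

Lemma autX_chom Psi : chom (autX Psi).
Proof. exact: alg_ext_chom (autX_order Psi). Qed.

Lemma autX_x0 Psi : autX Psi (xvar k None) = xvar k None.
Proof. exact: (alg_ext_letter (autX_order Psi) None). Qed.

Lemma autX_xg Psi g : autX Psi (xvar k (Some g)) =
  tshift g (sinv Psi) * xvar k (Some g) * tshift g Psi.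
Proof. exact: (alg_ext_letter (autX_order Psi) (Some g)). Qed.

Lemma autX_nil Psi a : autX Psi a [::] = a [::].
Proof. exact: (chom_nil a (autX_chom Psi)). Qed.

Lemma autX_tshift Psi g a : autX Psi (tshift g a) = tshift g (autX Psi a).
Proof.
move: a; apply: chom_word_ext => [||x].
- by apply: chom_comp; [apply: autX_chom|apply: tshift_chom].
- by apply: chom_comp; [apply: tshift_chom|apply: autX_chom].
have [_ _ tM] := tshift_chom g.
rewrite /= -!/(xvar k x); case: x => [h|].
  by rewrite autX_xg tshift_xvar autX_xg !tM !tshift_comp tshift_xvar.
by rewrite autX_x0 !tshift_xvar autX_x0.
Qed.

Lemma sinv_nil Psi : Psi [::] = 1 -> sinv Psi [::] = 1.
Proof.
move=> p1; have : (Psi * sinv Psi) [::] = 1.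
  by rewrite sinvK ?coef_mono //; apply: word_invertible.
by rewrite coef_nilM p1 mul1r.
Qed.

Lemma circast_nil Psi Phi : circast Psi Phi [::] = Psi [::] * Phi [::].
Proof. by rewrite coef_nilM autX_nil. Qed.

Lemma sinv_circast Psi Phi : Psi [::] = 1 -> Phi [::] = 1 ->
  sinv (circast Psi Phi) = autX Psi (sinv Phi) * sinv Psi.
Proof.
move=> p1 f1; have ip := word_invertible p1; have jf := word_invertible f1.
have [ia sa] := chom_inv (autX_chom Psi) jf.
by rewrite (sinvM ip ia).2 sa.
Qed.

(** On x_g the two conjugations compose because [autX Psi] commutes with [tshift]. Multiplicativity
    of [autX Psi] then turns this identity into associativity of [circast]. *)
Lemma autX_circast Psi Phi a : Psi [::] = 1 -> Phi [::] = 1 ->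
  autX (circast Psi Phi) a = autX Psi (autX Phi a).
Proof.
move=> p1 f1; move: a; apply: chom_word_ext => [||x].
- exact: autX_chom.
- by apply: chom_comp; apply: autX_chom.
rewrite /= -!/(xvar k x); case: x => [h|]; last by rewrite !autX_x0.
have [_ _ aM] := autX_chom Psi; have [_ _ tM] := tshift_chom h.
rewrite !autX_xg !aM !autX_tshift autX_xg sinv_circast // !tM.
by rewrite !mulrA.
Qed.

Lemma autX1 a : autX 1 a = a.
Proof.
move: a; apply: chom_word_ext => [||x]; first exact: autX_chom.
  by split=> //; apply: clin_id.
rewrite -!/(xvar k x); case: x => [h|]; last by rewrite autX_x0.
by have [_ t1 _] := tshift_chom h; rewrite autX_xg sinv1 t1 mulr1 mul1r.
Qed.

Lemma circastA Psi Phi a : Psi [::] = 1 -> Phi [::] = 1 ->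
  circast Psi (circast Phi a) = circast (circast Psi Phi) a.
Proof.
move=> p1 f1; have [_ _ aM] := autX_chom Psi.
by rewrite /circast aM mulrA -/(circast Psi Phi) autX_circast.
Qed.

Lemma circast1l a : circast 1 a = a.
Proof. by rewrite /circast autX1 mul1r. Qed.

Lemma circast1r Psi : circast Psi 1 = Psi.
Proof. by have [_ a1 _] := autX_chom Psi; rewrite /circast a1 mulr1. Qed.

Lemma has_order_xg Psi g : Psi [::] = 1 ->
  has_order 2 (autX Psi (xvar k (Some g)) - xvar k (Some g)).
Proof.
move=> p1; rewrite autX_xg; set x := xvar k _; have ox : has_order 1 x.
  exact: xvar_order.
have o1 : has_order 1 (tshift g (sinv Psi) - 1).
  by apply: word_unit_order; rewrite tshift_nil sinv_nil.
have o2 : has_order 1 (tshift g Psi - 1).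
  by apply: word_unit_order; rewrite tshift_nil.
have -> : tshift g (sinv Psi) * x * tshift g Psi - x =
    (tshift g (sinv Psi) - 1) * x * tshift g Psi + x * (tshift g Psi - 1).
  by rewrite mulrBl mul1r mulrBl mulrBr mulr1 addrA subrK.
apply: has_orderD; last by rewrite -[2%N]/(1 + 1)%N; apply: has_orderM.
rewrite -[2%N]/(1 + 1 + 0)%N; apply: has_orderM => //; exact: has_orderM.
Qed.

(** As [Psi] has constant term 1, each letter changes only by terms of degree at least 2; for a word
    the difference telescopes letter by letter. *)
Lemma autX_unipotent Psi (u : wordX gT) : Psi [::] = 1 ->
  has_order (gdeg u).+1 (autX Psi (mono u) - mono u).
Proof.
move=> p1; have [_ a1 aM] := autX_chom Psi.
elim/word_ind: u => [|x u IH]; first by rewrite mono_nil a1 subrr.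
rewrite mono_cons aM; set y := mono (letter x).
have -> : autX Psi y * autX Psi (mono u) - y * mono u =
    (autX Psi y - y) * autX Psi (mono u) + y * (autX Psi (mono u) - mono u).
  by rewrite mulrBl mulrBr addrA subrK.
apply: has_orderD.
  rewrite -[_.+1]/(2 + gdeg (u : wordX gT))%N; apply: has_orderM.
    rewrite /y -/(xvar k x); case: x {y} => [g|]; first exact: has_order_xg.
    by rewrite autX_x0 subrr.
  have [[_ oa] _ _] := autX_chom Psi.
  by apply: oa; apply: has_order_mono.
rewrite -[_.+1]/(1 + (gdeg (u : wordX gT)).+1)%N; apply: has_orderM => //.
exact: xvar_order.
Qed.

Lemma coprod_chom : chom (@coprod gT k).
Proof.
apply: alg_ext_chom => x; apply: has_orderD.
  by rewrite -[1%N]/(1 + 0)%N; apply: has_order_tens => //; apply: xvar_order.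
by rewrite -[1%N]/(0 + 1)%N; apply: has_order_tens => //; apply: xvar_order.
Qed.

Lemma coprod_xvar (x : option gT) :
  coprod (xvar k x) = tens (xvar k x) 1 + tens 1 (xvar k x) :> series _ k.
Proof.
apply: (@alg_ext_letter (option gT) _ k
  (fun y : option gT => tens (xvar k y) 1 + tens 1 (xvar k y))).
move=> y; apply: has_orderD.
  by rewrite -[1%N]/(1 + 0)%N; apply: has_order_tens => //; apply: xvar_order.
by rewrite -[1%N]/(0 + 1)%N; apply: has_order_tens => //; apply: xvar_order.
Qed.

(** The constant term is idempotent, by comparing coefficients at the pair of empty words, and it is
    invertible; an idempotent unit is 1. *)
Lemma grouplike_nil Psi : grouplike Psi -> Psi [::] = 1.
Proof.
case=> -[b [pb _]] /(congr1 (fun a : series _ k => a 1%g)).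
rewrite (chom_nil _ coprod_chom) /= => pp.
have e : Psi [::] * b [::] = 1 by rewrite -coef_nilM pb coef_mono eqxx.
by rewrite -[LHS]mulr1 -{1}e mulrA -[X in X * _]pp e.
Qed.

Lemma grouplikeP Psi :
  grouplike Psi <-> Psi [::] = 1 /\ coprod Psi = tens Psi Psi.
Proof.
split=> [gp|[p1 cp]]; last by split=> //; apply: word_invertible.
by split; [apply: grouplike_nil|case: gp].
Qed.

Lemma coprod_tshift g a : coprod (tshift g a) =
  tens_map (tshift g) (tshift g) (coprod a).
Proof.
have tc := tshift_chom g; have ct := chom_clin tc; have [_ t1 _] := tc.
move: a; apply: chom_word_ext => [||x].
- by apply: chom_comp; [apply: coprod_chom|].
- by apply: chom_comp; [apply: tens_map_chom|apply: coprod_chom].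
rewrite /= -/(xvar k x) tshift_xvar !coprod_xvar (clinD (tens_map_clin ct ct)).
by rewrite !tens_map_tens // tshift_xvar t1.
Qed.

Lemma coprod_tshift_grouplike Psi g : grouplike Psi ->
  coprod (tshift g Psi) = tens (tshift g Psi) (tshift g Psi).
Proof.
case=> _ cp; rewrite coprod_tshift cp tens_map_tens //;
  exact: chom_clin (tshift_chom g).
Qed.

Lemma grouplike_sinv Psi : grouplike Psi -> grouplike (sinv Psi).
Proof.
move=> gp; have /grouplikeP[p1 cp] := gp; have ip := word_invertible p1.
split; first exact: sinv_invertible.
have [_ <-] := chom_inv coprod_chom ip; apply: sinv_eq.
  by rewrite cp tensM sinvK // tens11.
by rewrite cp tensM sinvKl // tens11.
Qed.

(** Conjugating a primitive letter by a grouplike series gives a primitive series, so the two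
    morphisms agree on letters. *)
Lemma coprod_autX Psi a : grouplike Psi ->
  coprod (autX Psi a) = tens_map (autX Psi) (autX Psi) (coprod a).
Proof.
move=> gp; have gs := grouplike_sinv gp.
have ac := autX_chom Psi; have ca := chom_clin ac; have [_ a1 _] := ac.
have ip : sinvertible Psi by case: gp.
move: a; apply: chom_word_ext => [||x].
- by apply: chom_comp; [apply: coprod_chom|].
- by apply: chom_comp; [apply: tens_map_chom|apply: coprod_chom].
rewrite /= -/(xvar k x) (coprod_xvar x) (clinD (tens_map_clin ca ca)).
rewrite !tens_map_tens // a1; case: x => [h|]; last by rewrite autX_x0 coprod_xvar.
have [_ _ cM] := coprod_chom; have [_ t1 tM] := tshift_chom h.
rewrite autX_xg !cM coprod_xvar !coprod_tshift_grouplike //.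
rewrite mulrDr mulrDl !tensM !mulr1.
by rewrite -!tM sinvKl // t1.
Qed.

Lemma grouplike_circast Psi Phi : grouplike Psi -> grouplike Phi ->
  grouplike (circast Psi Phi).
Proof.
move=> gp gf; have [p1 cp] := (grouplikeP _).1 gp.
have [f1 cf] := (grouplikeP _).1 gf; apply/grouplikeP; split.
  by rewrite circast_nil p1 f1 mulr1.
have [_ _ cM] := coprod_chom; have ca := chom_clin (autX_chom Psi).
by rewrite /circast cM coprod_autX // cp cf tens_map_tens // tensM.
Qed.

Lemma grouplike1 : grouplike (1 : kX).
Proof.
apply/grouplikeP; rewrite coef_mono eqxx; split=> //.
by have [_ -> _] := coprod_chom; rewrite tens11.
Qed.

(** The inverse is the solution [Phi] of [autX Psi Phi = sinv Psi], which unipotence provides. It is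
    grouplike because [coprod Phi] and [tens Phi Phi] have the same image under the tensor square of
    [autX Psi], which is unipotent too, hence injective. *)
Lemma circast_inverse Psi : grouplike Psi ->
  exists Phi, grouplike Phi /\ circast Psi Phi = 1.
Proof.
move=> gp; have [p1 cp] := (grouplikeP _).1 gp; have ip := word_invertible p1.
have ac := autX_chom Psi; have ca := chom_clin ac.
have uni u := @autX_unipotent Psi u p1.
have [Phi aPhi] := unipotent_surj ca uni (sinv Psi).
exists Phi; split; last by rewrite /circast aPhi sinvK.
apply/grouplikeP; split; first by rewrite -(autX_nil Psi) aPhi sinv_nil.
apply: (unipotent_inj (tens_map_clin ca ca)) => [[u v]|].
  rewrite tens_map_mono //= -tens_mono.
  have -> : tens (autX Psi (mono u)) (autX Psi (mono v)) - tens (mono u) (mono v)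
      = tens (autX Psi (mono u) - mono u) (autX Psi (mono v))
        + tens (mono u) (autX Psi (mono v) - mono v).
    by rewrite tensBl tensBr addrA subrK.
  apply: has_orderD.
    rewrite -[_.+1]/((gdeg u).+1 + gdeg v)%N; apply: has_order_tens.
      exact: uni.
    by apply: ca.2; apply: has_order_mono.
  rewrite -[_.+1]/(gdeg u + gdeg v).+1 -addnS; apply: has_order_tens.
    exact: has_order_mono.
  exact: uni.
rewrite -coprod_autX // aPhi tens_map_tens // aPhi.
by have [] := grouplike_sinv gp.
Qed.

(* The coefficients of the words x_0^n x_1 are those of a derivation over the
   projection x_0 |-> x, x_g |-> 0 to power series in x. *)
Definition px0 : kX -> pseries k :=
  alg_ext (fun x => if x is Some g then 0 else mono (letter tt)).

Definition aug : kX -> pseries k := alg_ext (fun=> 0).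

Fixpoint is_x0x1 (u : seq (option gT)) : bool :=
  match u with
  | [::] => false
  | None :: v => is_x0x1 v
  | Some g :: v => (g == 1%g) && (v == [::])
  end.

Lemma is_x0x1E u : is_x0x1 u =
  (u != [::]) && (u == nseq (size u).-1 None ++ [:: Some 1%g]).
Proof.
elim: u => [|[g|] v IH] //=.
  by case: v IH => [|y v] //= _; rewrite ?andbF ?andbT.
by rewrite IH; case: v IH.
Qed.

(** The generating series of the coefficients of the words x_0^n x_1, each word being sent to
    x^(n+1). *)
Definition qx0x1 : kX -> pseries k :=
  cont_ext (fun u : wordX gT =>
    if is_x0x1 u then mono (nseq (size u) tt : word unit) else 0).

Fact qx0x1_deg (u : wordX gT) n : (gdeg n < gdeg u)%N ->
  (if is_x0x1 u then mono (nseq (size u) tt : word unit) else 0 : pseries k) n = 0.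
Proof.
case: ifP => // _ lt; rewrite coef_mono; case: eqP => // nE; move: lt.
by rewrite nE /gdeg /= size_nseq ltnn.
Qed.

Lemma qx0x1_clin : clin qx0x1.
Proof. by apply: cont_ext_clin => u n; apply: qx0x1_deg. Qed.

Lemma qx0x1_mono (u : wordX gT) : qx0x1 (mono u) =
  if is_x0x1 u then mono (nseq (size u) tt : word unit) else 0.
Proof. by rewrite /qx0x1 cont_ext_mono // => v n; apply: qx0x1_deg. Qed.

Lemma qx0x1_coef a n : qx0x1 a (nseq n.+1 tt) = coef_x0x1 a n.
Proof.
pose u : wordX gT := nseq n None ++ [:: Some 1%g].
rewrite /qx0x1 /coef_x0x1 /= -/u.
have su : size u = n.+1 by rewrite size_cat size_nseq addn1.
have uW : is_x0x1 u by rewrite is_x0x1E su /= eqxx andbT -size_eq0 su.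
rewrite (bigD1_seq (u : wordX gT)) ?gelems_uniq ?mem_gelems //=; last first.
  by rewrite /gdeg /= su size_nseq.
rewrite uW coef_mono su eqxx mulr1 big1 ?addr0 // => v ne.
case: ifP => [vW|]; last by rewrite mulr0.
rewrite coef_mono; case: eqP => [/(congr1 size)|]; rewrite ?mulr0 //.
rewrite !size_nseq => sv; case/eqP: ne; move: vW; rewrite is_x0x1E -sv /=.
by rewrite size_nseq => /andP[_ /eqP].
Qed.

Lemma px0_chom : chom px0.
Proof.
by apply: alg_ext_chom => -[g|] //; exact: (@has_order_mono k (word unit) (letter tt)).
Qed.

Lemma px0_xvar x :
  px0 (xvar k x) = if x is Some g then 0 else mono (letter tt).
Proof.
apply: alg_ext_letter => -[g|] //; exact: (@has_order_mono k (word unit) (letter tt)).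
Qed.

Lemma aug_chom : chom aug.
Proof. by apply: alg_ext_chom. Qed.

Lemma aug_xvar x : aug (xvar k x) = 0.
Proof. exact: (@alg_ext_letter _ _ _ (fun=> 0)). Qed.

Lemma augE a : aug a = a [::] *: (1 : pseries k).
Proof.
move: a; apply: clin_ext => [||u]; first exact: chom_clin aug_chom.
  split=> [c a b|d a oa]; first by rewrite scoefD scoefZ scalerDl scalerA.
  case: d oa => // d oa; rewrite (oa [::]) // scale0r; exact: has_order_zero.
case: u => [|x u].
  by rewrite mono_nil coef_mono eqxx scale1r; have [_ ->] := aug_chom.
rewrite coef_mono /= scale0r mono_cons; have [_ _ ->] := aug_chom.
by rewrite -/(xvar k x) aug_xvar mul0r.
Qed.

Lemma qx0x1_xvar x :
  qx0x1 (xvar k x) = if x == Some 1%g then mono (letter tt) else 0.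
Proof. by rewrite qx0x1_mono; case: x => [g|] //=; rewrite andbT. Qed.

(** A concatenation u v has the form x_0^n x_1 exactly when u has it and v is empty, or u is a power
    of x_0 and v has it. *)
Lemma qx0x1M a b : qx0x1 (a * b) = qx0x1 a * aug b + px0 a * qx0x1 b.
Proof.
have [ca a1 aM] := aug_chom; have [cp p1 pM] := px0_chom; have cq := qx0x1_clin.
have q1 : qx0x1 1 = 0 by rewrite -mono1 qx0x1_mono.
move: a b; apply: bilin_ext => [b|a|b|a|u v].
- by apply: (clin_comp cq); clin_tac.
- by apply: (clin_comp cq); clin_tac.
- by clin_tac.
- by clin_tac.
have letterP x w : qx0x1 (mono (letter x) * mono w) =
    qx0x1 (xvar k x) * aug (mono w) + px0 (xvar k x) * qx0x1 (mono w).
  rewrite monoM !qx0x1_mono px0_xvar augE; case: x => [g|] /=; last first.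
    rewrite mul0r add0r; case: ifP => _; last by rewrite mulr0.
    by rewrite monoM.
  rewrite mul0r addr0 andbT [[::] == _]eq_sym.
  have [->|_] := eqVneq w [::];
    rewrite ?andbT ?andbF ?scale1r ?scale0r ?mulr0 //.
  by rewrite mulr1.
elim/word_ind: u => [|x u IH].
  by rewrite mono_nil q1 p1 !mul1r mul0r add0r.
rewrite mono_cons (letterP x u) -mulrA (monoM k u v) letterP -(monoM k u v) aM IH.
rewrite pM -/(xvar k x) mulrDr mulrDl !mulrA.
by rewrite -!addrA.
Qed.

Lemma px0_tshift g a : px0 (tshift g a) = px0 a.
Proof.
move: a; apply: chom_word_ext => [||x].
- by apply: chom_comp; [apply: px0_chom|apply: tshift_chom].
- exact: px0_chom.
by rewrite /= -/(xvar k x) tshift_xvar !px0_xvar; case: x.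
Qed.

Lemma px0_autX Psi a : px0 (autX Psi a) = px0 a.
Proof.
move: a; apply: chom_word_ext => [||x].
- by apply: chom_comp; [apply: px0_chom|apply: autX_chom].
- exact: px0_chom.
rewrite /= -/(xvar k x); case: x => [g|]; last by rewrite autX_x0.
have [_ _ pM] := px0_chom.
by rewrite autX_xg !pM px0_xvar mulr0 mul0r.
Qed.

(** In t_g(Psi^-1) x_g t_g(Psi) only the words count whose part before x_g is a power of x_0 and
    whose part after it is empty; whence the factor [px0 (sinv Psi)]. In [circast] it cancels
    against the [px0 Psi] produced by left multiplication by [Psi], which leaves an additive law. *)
Lemma qx0x1_autX Psi a : Psi [::] = 1 ->
  qx0x1 (autX Psi a) = px0 (sinv Psi) * qx0x1 a.
Proof.
move=> p1; have [ca a1 aM] := autX_chom Psi.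
have [cg g1 gM] := aug_chom; have [_ pp1 _] := px0_chom.
have augX b : aug (autX Psi b) = aug b by rewrite !augE autX_nil.
move: a; apply: (derivation_word_ext (phi := aug) (psi := px0)) => //.
- by apply: clin_comp; first exact: qx0x1_clin.
- by apply: clin_mull; exact: qx0x1_clin.
- by move=> a b /=; rewrite aM qx0x1M augX px0_autX.
- move=> a b; rewrite qx0x1M mulrDr !mulrA; congr (_ + _ * _).
  exact: pseries_mulC.
move=> x /=; rewrite -/(xvar k x) qx0x1_xvar; case: x => [g|]; last first.
  by rewrite autX_x0 qx0x1_xvar mulr0.
rewrite autX_xg -mulrA qx0x1M px0_tshift gM aug_xvar mul0r mulr0 add0r.
rewrite qx0x1M px0_xvar mul0r addr0 augE tshift_nil p1 scale1r mulr1.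
by rewrite qx0x1_xvar.
Qed.

Lemma qx0x1_circast Psi Phi : Psi [::] = 1 -> Phi [::] = 1 ->
  qx0x1 (circast Psi Phi) = qx0x1 Psi + qx0x1 Phi.
Proof.
move=> p1 f1; have [_ pp1 pM] := px0_chom.
rewrite qx0x1M augE autX_nil f1 scale1r mulr1 qx0x1_autX // mulrA -pM.
by rewrite sinvK ?pp1 ?mul1r //; apply: word_invertible.
Qed.

Lemma coef_x0x1_circast Psi Phi n : Psi [::] = 1 -> Phi [::] = 1 ->
  coef_x0x1 (circast Psi Phi) n = coef_x0x1 Psi n + coef_x0x1 Phi n.
Proof. by move=> p1 f1; rewrite -!qx0x1_coef qx0x1_circast. Qed.

End GroupLaw.

(** * Morphisms and automorphisms of the algebra V *)

Section VMorphisms.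
Variables (gT : finGroupType) (k : comPzRingType).
Local Notation V := (series (vmon gT) k).
Local Notation kX := (series (wordX gT) k).
Implicit Types (g h : gT) (Psi Phi : kX).

Lemma egrpM g h : egrp k g * egrp k h = egrp k (g * h)%g.
Proof.
have [gM _ _] := vmon_relations gT.
by rewrite /egrp monoM gM.
Qed.

Lemma egrp1 : egrp k (1%g : gT) = 1.
Proof. by []. Qed.

Lemma egrp_e0 g : egrp k g * e0 gT k = e0 gT k * egrp k g.
Proof.
have [_ _ ge0] := vmon_relations gT.
by rewrite /egrp /e0 !monoM ge0.
Qed.

Lemma vmon_cons x (u : wordX gT) g :
  mono (VMon (x :: u) g) = vletter (e0 gT k) (e1 gT k) x * mono (VMon u g) :> V.
Proof.
case: x => [h|] /=; rewrite /egrp /e0 /e1 !monoM; congr mono; congr VMon;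
  by rewrite /= /vcarry /= ?mulg1 ?vpush1 ?if_same ?mul1g.
Qed.

Lemma vmon_ind (P : vmon gT -> Prop) : (forall g, P (VMon [::] g)) ->
  (forall x (u : wordX gT) g, P (VMon u g) -> P (VMon (x :: u) g)) ->
  forall m, P m.
Proof. by move=> P0 PS [u g]; elim/word_ind: u => [|x u IH]; auto. Qed.

Lemma e0_order : has_order 1 (e0 gT k).
Proof. exact: (@has_order_mono k (vmon gT) (ve0 gT)). Qed.
Lemma e1_order : has_order 1 (e1 gT k).
Proof. exact: (@has_order_mono k (vmon gT) (ve1 gT)). Qed.

Lemma vletter_order (E0 E1 : V) x : has_order 1 E0 -> has_order 1 E1 ->
  has_order 1 (vletter E0 E1 x).
Proof.
move=> o0 o1; case: x => [h|] //=.
by rewrite -[1%N]/(0 + 1)%N; apply: has_orderM.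
Qed.

Section Extension.
Variables E0 E1 : V.
Hypotheses (o0 : has_order 1 E0) (o1 : has_order 1 E1)
  (gE0 : forall g, egrp k g * E0 = E0 * egrp k g).

Let tau (m : vmon gT) : V :=
  (\prod_(x <- vword m) vletter E0 E1 x) * egrp k (vgrp m).

Let tau_deg m : has_order (gdeg m) (tau m).
Proof.
rewrite -[gdeg m]addn0; apply: has_orderM => //.
have := has_order_prod (r := vword m) (d := fun=> 1%N)
  (fun x => vletter_order x o0 o1).
by rewrite sum1_size.
Qed.

(** A group element moves to the right past E0 and is absorbed by the first h E1, exactly as [vpush]
    and [vcarry] prescribe for normal forms. *)
Let tau_push g (u : wordX gT) :
  egrp k g * (\prod_(x <- u) vletter E0 E1 x) =
  (\prod_(x <- vpush g u) vletter E0 E1 x) * egrp k (vcarry g u).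
Proof.
elim: u => [|[h|] u IH]; first by rewrite !big_nil mul1r mulr1.
  by rewrite !big_cons /= /vcarry /= egrp1 mulr1 !mulrA egrpM.
by rewrite !big_cons /= mulrA gE0 -!mulrA IH.
Qed.

Lemma V_ext_chom : chom (V_ext E0 E1).
Proof.
have td m n : (gdeg n < gdeg m)%N -> tau m n = 0 by apply: tau_deg.
apply: chomP => [||[u g] [v h]]; first exact: cont_ext_clin.
  by rewrite /V_ext -mono1 cont_ext_mono // /tau big_nil mul1r.
rewrite /V_ext !(cont_ext_mono td) /tau /= big_cat /= -egrpM.
by rewrite !mulrA; congr (_ * _); rewrite -!mulrA tau_push.
Qed.

Lemma V_ext_mono m : V_ext E0 E1 (mono m) = tau m.
Proof. by apply: cont_ext_mono => {m} m n; apply: tau_deg. Qed.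

Lemma V_ext_e0 : V_ext E0 E1 (e0 gT k) = E0.
Proof. by rewrite V_ext_mono /tau big_seq1 mulr1. Qed.

Lemma V_ext_e1 : V_ext E0 E1 (e1 gT k) = E1.
Proof. by rewrite V_ext_mono /tau big_seq1 /= egrp1 mul1r mulr1. Qed.

Lemma V_ext_egrp g : V_ext E0 E1 (egrp k g) = egrp k g.
Proof. by rewrite V_ext_mono /tau big_nil mul1r. Qed.

End Extension.

Lemma chom_V_ext (N : gradedMonoidType) (f f' : V -> series N k) :
  chom f -> chom f' ->
  f (e0 gT k) = f' (e0 gT k) -> f (e1 gT k) = f' (e1 gT k) ->
  (forall g, f (egrp k g) = f' (egrp k g)) -> f =1 f'.
Proof.
move=> [cf f1 fM] [cf' f1' fM'] eq0 eq1 eqg; apply: clin_ext => //.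
apply: vmon_ind => [g|x u g IH]; first exact: eqg.
rewrite vmon_cons fM fM' IH; congr (_ * _).
by case: x => [h|] //=; rewrite fM fM' eqg eq1.
Qed.

Lemma derivation_V_ext (N : gradedMonoidType) (phi D D' : V -> series N k) :
  clin D -> clin D' ->
  (forall a b, D (a * b) = D a * phi b + phi a * D b) ->
  (forall a b, D' (a * b) = D' a * phi b + phi a * D' b) ->
  D (e0 gT k) = D' (e0 gT k) -> D (e1 gT k) = D' (e1 gT k) ->
  (forall g, D (egrp k g) = D' (egrp k g)) -> D =1 D'.
Proof.
move=> cD cD' DM DM' eq0 eq1 eqg; apply: clin_ext => //.
apply: vmon_ind => [g|x u g IH]; first exact: eqg.
rewrite vmon_cons DM DM' IH; congr (_ * _ + _).
by case: x => [h|] //=; rewrite DM DM' eqg eq1.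
Qed.

Lemma beta1_order (x : option gT) : has_order 1
  (if x is Some g then - (egrp k g * e1 gT k * egrp k g^-1%g) else e0 gT k).
Proof.
case: x => [g|]; last exact: e0_order.
apply: has_orderN; rewrite -[1%N]/(0 + 1 + 0)%N; apply: has_orderM => //.
by apply: has_orderM => //; apply: e1_order.
Qed.

Lemma beta1_chom : chom (@beta1 gT k).
Proof. exact: alg_ext_chom beta1_order. Qed.

Lemma beta1_x0 : beta1 (xvar k None) = e0 gT k.
Proof. exact: (alg_ext_letter beta1_order None). Qed.

Lemma beta1_xg g :
  beta1 (xvar k (Some g)) = - (egrp k g * e1 gT k * egrp k g^-1%g).
Proof. exact: (alg_ext_letter beta1_order (Some g)). Qed.

Lemma egrp_inv g : sinvertible (egrp k g) /\ sinv (egrp k g) = egrp k g^-1%g.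
Proof.
have e1 : egrp k g * egrp k g^-1%g = 1 by rewrite egrpM mulgV.
have e2 : egrp k g^-1%g * egrp k g = 1 by rewrite egrpM mulVg.
by split; [exists (egrp k g^-1%g)|apply: sinv_eq].
Qed.

Lemma beta1_tshift g (a : kX) :
  beta1 (tshift g a) = egrp k g * beta1 a * egrp k g^-1%g.
Proof.
have [ig sg] := egrp_inv g.
rewrite -sg -/(sAd _ _); move: a; apply: chom_word_ext => [||x].
- by apply: chom_comp; [apply: beta1_chom|apply: tshift_chom].
- by apply: chom_comp; [apply: sAd_chom|apply: beta1_chom].
rewrite /= -/(xvar k x) tshift_xvar /sAd sg; case: x => [h|] /=.
  by rewrite !beta1_xg mulrN mulNr -!egrpM invMg -egrpM !mulrA.
by rewrite beta1_x0 egrp_e0 -mulrA egrpM mulgV mulr1.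
Qed.

Section AutV.
Variable Psi : kX.
Hypothesis Psi1 : Psi [::] = 1.

Let iPsi : sinvertible Psi. Proof. exact: word_invertible. Qed.
Let ibeta : sinvertible (beta1 Psi).
Proof. exact: (chom_inv beta1_chom iPsi).1. Qed.
Let sbeta : sinv (beta1 Psi) = beta1 (sinv Psi).
Proof. exact: (chom_inv beta1_chom iPsi).2. Qed.

Let E1_order : has_order 1 (beta1 (sinv Psi) * e1 gT k * beta1 Psi).
Proof.
rewrite -[1%N]/(0 + 1 + 0)%N; apply: has_orderM => //.
by apply: has_orderM => //; apply: e1_order.
Qed.

Lemma autV0_chom : chom (autV0 Psi).
Proof. exact: (V_ext_chom e0_order E1_order egrp_e0). Qed.

Lemma autV0_e0 : autV0 Psi (e0 gT k) = e0 gT k.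
Proof. exact: (V_ext_e0 e0_order E1_order). Qed.

Lemma autV0_e1 :
  autV0 Psi (e1 gT k) = beta1 (sinv Psi) * e1 gT k * beta1 Psi.
Proof. exact: (V_ext_e1 e0_order E1_order). Qed.

Lemma autV0_egrp g : autV0 Psi (egrp k g) = egrp k g.
Proof. exact: (V_ext_egrp e0_order E1_order). Qed.

(** On x_g the factors g and g^-1 around e_1 match the shift t_g, which [beta1] turns into
    conjugation by g. *)
Lemma autV0_beta1 (a : kX) : autV0 Psi (beta1 a) = beta1 (autX Psi a).
Proof.
have [_ _ aM] := autV0_chom; have [_ _ bM] := beta1_chom.
move: a; apply: chom_word_ext => [||x].
- by apply: chom_comp; [apply: autV0_chom|apply: beta1_chom].
- by apply: chom_comp; [apply: beta1_chom|apply: autX_chom].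
rewrite /= -/(xvar k x); case: x => [g|]; last first.
  by rewrite autX_x0 beta1_x0 autV0_e0.
rewrite autX_xg !bM !beta1_tshift beta1_xg (clinN (chom_clin autV0_chom)).
rewrite !aM !autV0_egrp autV0_e1 mulrN mulNr; congr (- _).
rewrite !mulrA -[_ * egrp k g^-1%g * egrp k g]mulrA egrpM mulVg egrp1 mulr1.
by rewrite -[_ * egrp k g^-1%g * egrp k g]mulrA egrpM mulVg egrp1 mulr1.
Qed.

Lemma autV1_chom : chom (autV1 Psi).
Proof. exact: (chom_comp (sAd_chom ibeta) autV0_chom). Qed.

(** The outer conjugation undoes the one in [autV0]. Hence series in e_1 are fixed, and left
    multiples of e_1 go to left multiples of e_1, which keeps W stable. *)
Lemma autV1_e1 : autV1 Psi (e1 gT k) = e1 gT k.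
Proof.
rewrite /autV1 /sAd autV0_e1 sbeta !mulrA -sbeta sinvK // mul1r.
by rewrite -mulrA sinvK ?mulr1.
Qed.

Lemma autV1_ps_eval (f : pseries k) :
  autV1 Psi (ps_eval f (- e1 gT k)) = ps_eval f (- e1 gT k).
Proof.
have o1 : has_order 1 (- e1 gT k) by apply: has_orderN; apply: e1_order.
have c := alg_ext_chom (fun _ : unit => o1); have cV := autV1_chom.
move: f; apply: chom_word_ext => [||x] //.
- by apply: chom_comp; [apply: cV|apply: c].
rewrite /= /ps_eval alg_ext_letter // (clinN (chom_clin cV)).
by rewrite autV1_e1.
Qed.

End AutV.

Lemma autV0_circast Psi Phi (a : V) : Psi [::] = 1 -> Phi [::] = 1 ->
  autV0 (circast Psi Phi) a = autV0 Psi (autV0 Phi a).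
Proof.
move=> p1 f1; have cp := autV0_chom Psi; have cf := autV0_chom Phi.
have [_ _ aM] := cp; have [_ _ bM] := beta1_chom.
have pf1 : circast Psi Phi [::] = 1 by rewrite circast_nil p1 f1 mulr1.
move: a; apply: chom_V_ext => [||||g] /=.
- exact: autV0_chom.
- exact: chom_comp.
- by rewrite !autV0_e0.
- rewrite !autV0_e1 // !aM !autV0_beta1 // autV0_e1 // sinv_circast // !bM.
  by rewrite !mulrA.
by rewrite !autV0_egrp.
Qed.

Lemma autV1_circast Psi Phi (a : V) : Psi [::] = 1 -> Phi [::] = 1 ->
  autV1 (circast Psi Phi) a = autV1 Psi (autV1 Phi a).
Proof.
move=> p1 f1; have cp := autV0_chom Psi; have [_ _ aM] := cp.
have [_ _ bM] := beta1_chom.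
have ip := word_invertible p1; have jf := word_invertible f1.
have [ibp _] := chom_inv beta1_chom ip; have [ibf _] := chom_inv beta1_chom jf.
have [iaf saf] := chom_inv cp ibf.
rewrite /autV1 {3}/sAd !aM -saf -/(sAd _ _) sAd_comp // -autV0_circast //.
by rewrite autV0_beta1 // -bM.
Qed.

End VMorphisms.

Lemma chom_sAd (M N : gradedMonoidType) (k : comPzRingType)
    (f : series M k -> series N k) u a : chom f -> sinvertible u ->
  f (sAd u a) = sAd (f u) (f a).
Proof.
by move=> cf iu; have [_ _ fM] := cf; rewrite /sAd !fM (chom_inv cf iu).2.
Qed.

(** * The stabilizer of the harmonic coproduct *)

Section HarmonicCoproduct.
Variables (gT : finGroupType) (k : comPzRingType).
Local Notation V := (series (vmon gT) k).
Implicit Types (a : V) (f : pseries k).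

Lemma ps_eval_e1_chom : chom (fun f => ps_eval f (- e1 gT k)).
Proof. by apply: alg_ext_chom => _; apply: has_orderN; apply: e1_order. Qed.

Lemma ps_eval_e1M f g : ps_eval (f * g) (- e1 gT k) =
  ps_eval f (- e1 gT k) * ps_eval g (- e1 gT k).
Proof. by case: ps_eval_e1_chom => _ _; apply. Qed.

Lemma ps_eval_e1_letter :
  ps_eval (mono (letter tt)) (- e1 gT k) = - e1 gT k.
Proof. by apply: alg_ext_letter => _; apply: has_orderN; apply: e1_order. Qed.

Lemma ps_eval_e1_comm f :
  ps_eval f (- e1 gT k) * e1 gT k = e1 gT k * ps_eval f (- e1 gT k).
Proof.
have := ps_eval_e1M f (mono (letter tt)).
have := ps_eval_e1M (mono (letter tt)) f; rewrite ps_eval_e1_letter => e1 e2.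
by apply: oppr_inj; rewrite -mulrN -mulNr -e1 -e2 pseries_mulC.
Qed.

Lemma DeltaW_clin : clin (@DeltaW gT k).
Proof. by apply: cont_ext_clin => m n; apply: DeltaW_mon_deg. Qed.

Lemma W_mono (m : vmon gT) : in_Wmon m -> W (mono m : V).
Proof.
case: m => u g; rewrite /in_Wmon /= => /andP[/eqP-> {g}].
case/lastP: u => [|u [g|]]; rewrite ?last_rcons //= => _.
  by exists 1, 0; rewrite scale1r mul0r addr0.
exists 0, (mono (VMon u g)); rewrite scale0r add0r monoM; congr mono.
by congr VMon; rewrite /= ?mulg1 ?cats1 // /vcarry /= mulg1.
Qed.

Lemma W_e1 : W (e1 gT k : V).
Proof. by exists 0, 1; rewrite scale0r add0r mul1r. Qed.

Lemma W_ext (N : gradedMonoidType) (f g : V -> series N k) : clin f -> clin g ->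
  (forall m, in_Wmon m -> f (mono m) = g (mono m)) ->
  forall a, W a -> f a = g a.
Proof.
move=> cf cg fg a Wa; apply: (clin_ext_on (P := @in_Wmon gT)) => // m.
exact: W_mon.
Qed.

Lemma chom_W (f : V -> V) : chom f -> f (e1 gT k) = e1 gT k ->
  forall a, W a -> W (f a).
Proof.
case=> cf f1 fM fe1 a [c [v ->]]; exists c, (f v).
by rewrite (clinD cf) (clinZ cf) f1 fM fe1.
Qed.

Definition Delta_compat (f : V -> V) : Prop :=
  forall a, W a -> tens_map f f (DeltaW a) = DeltaW (f a).

(** Elements of W over a larger algebra need not come from W over the smaller one, but the monomials
    are defined over every algebra. This form of the condition is the one that passes through base
    change and through the dual numbers. *)
Lemma Delta_compatP (f : V -> V) : clin f -> Delta_compat f <->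
  forall m, in_Wmon m -> tens_map f f (DeltaW (mono m)) = DeltaW (f (mono m)).
Proof.
move=> cf; split=> [st m mW|st]; first by apply: st; apply: W_mono.
apply: W_ext => //; first by apply: (clin_comp (tens_map_clin cf cf)); apply: DeltaW_clin.
exact: clin_comp DeltaW_clin cf.
Qed.

Lemma Delta_compat_comp (f g : V -> V) : clin f -> clin g ->
  (forall a, W a -> W (g a)) -> Delta_compat f -> Delta_compat g ->
  Delta_compat (f \o g).
Proof.
move=> cf cg Wg sf sg a Wa.
rewrite (tens_map_comp cf cg cf cg) /= sg // sf //; exact: Wg.
Qed.

Lemma Delta_compat_id : Delta_compat id.
Proof. by move=> a _; rewrite tens_map_id. Qed.

Lemma Delta_compat_inv (f g : V -> V) : clin f -> clin g ->
  (forall a, W a -> W (g a)) -> cancel f g -> cancel g f ->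
  Delta_compat f -> Delta_compat g.
Proof.
move=> cf cg Wg fK gK sf a Wa.
have fg : g \o f = id by apply/funext.
rewrite -[in LHS](gK a) -sf; last exact: Wg.
by have /= <- := tens_map_comp cg cf cg cf (DeltaW (g a)); rewrite fg tens_map_id.
Qed.

End HarmonicCoproduct.

(** * The points of the stabilizer form a group *)

Section StabGroup.
Variables (gT : finGroupType) (k : qalg).
Local Notation V := (series (vmon gT) k).
Local Notation kX := (series (wordX gT) k).
Implicit Types (Psi Phi : kX) (a : V).

Definition Gam_log Psi : pseries k := mkps (fun n => if (2 <= n)%N
  then qscale ((-1) ^+ n.-1 / n%:R) (coef_x0x1 Psi n.-1) else 0).

Lemma Gam_log_order Psi : has_order 1 (Gam_log Psi).
Proof. exact: word_order1. Qed.

Lemma Gam_log_circast Psi Phi : Psi [::] = 1 -> Phi [::] = 1 ->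
  Gam_log (circast Psi Phi) = Gam_log Psi + Gam_log Phi.
Proof.
move=> p1 f1; apply/seriesP => w; rewrite scoefD /=.
case: ifP => _; last by rewrite addr0.
by rewrite [X in qscale _ X](coef_x0x1_circast _ p1 f1) /qscale mulrDr.
Qed.

Lemma Gam_circast Psi Phi : Psi [::] = 1 -> Phi [::] = 1 ->
  Gam (circast Psi Phi) = Gam Psi * Gam Phi.
Proof.
move=> p1 f1; rewrite /Gam -/(Gam_log _) Gam_log_circast //.
by apply: ps_expD; apply: Gam_log_order.
Qed.

Lemma Gam1 : Gam (1 : kX) = 1.
Proof.
rewrite /Gam -/(Gam_log _) -[RHS]ps_exp0; congr ps_exp; apply/seriesP => w /=.
case: ifP => // _; rewrite /qscale.
by case: (size w).-1 => [|n] /=; rewrite mulr0.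
Qed.

Lemma Gam_invertible Psi : sinvertible (Gam Psi).
Proof. by apply: word_invertible; apply: ps_exp_nil. Qed.

Definition Gam_unit Psi : V := ps_eval (sinv (Gam Psi)) (- e1 gT k).

Lemma Gam_autWE Psi a : Gam_autW Psi a = sAd (Gam_unit Psi) (autV1 Psi a).
Proof. by []. Qed.

Lemma Gam_unit_invertible Psi : sinvertible (Gam_unit Psi).
Proof.
apply: (chom_inv (ps_eval_e1_chom gT k) _).1.
exact/sinv_invertible/Gam_invertible.
Qed.

Lemma Gam_autW_chom Psi : Psi [::] = 1 -> chom (Gam_autW Psi).
Proof.
move=> p1; apply: (chom_comp (sAd_chom (Gam_unit_invertible Psi))).
exact: autV1_chom.
Qed.

(** [Gam_unit Phi] is a series in e_1, hence fixed by [autV1 Psi], so the two twists multiply. The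
    inverses of [Gam Psi] and [Gam Phi] come out in reverse order, which is harmless in one
    variable. *)
Lemma Gam_autW_circast Psi Phi a : Psi [::] = 1 -> Phi [::] = 1 ->
  Gam_autW (circast Psi Phi) a = Gam_autW Psi (Gam_autW Phi a).
Proof.
move=> p1 f1; have ip := Gam_unit_invertible Psi.
have jf := Gam_unit_invertible Phi.
rewrite Gam_autWE (Gam_autWE Phi a) (Gam_autWE Psi).
rewrite (chom_sAd (autV1 Phi a) (autV1_chom p1) jf).
have -> : autV1 Psi (Gam_unit Phi) = Gam_unit Phi by apply: autV1_ps_eval.
rewrite (sAd_comp _ ip jf) (autV1_circast _ p1 f1); congr (sAd _ _).
rewrite /Gam_unit (Gam_circast p1 f1).
rewrite (sinvM (Gam_invertible Psi) (Gam_invertible Phi)).2.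
by rewrite pseries_mulC ps_eval_e1M.
Qed.

Lemma Gam_autW1 a : Gam_autW 1 a = a.
Proof.
have [_ e1' _] := ps_eval_e1_chom gT k.
have s1 (b : V) : sAd 1 b = b by rewrite /sAd sinv1 mulr1 mul1r.
have [_ b1 _] := beta1_chom gT k.
rewrite /Gam_autW Gam1 sinv1 e1' s1 /autV1 b1 s1.
move: a; apply: chom_V_ext => [||||g].
- exact: autV0_chom.
- by split=> //; apply: clin_id.
- exact: autV0_e0.
- by rewrite autV0_e1 sinv1 b1 mulr1 mul1r.
exact: autV0_egrp.
Qed.

Lemma Gam_autW_e1 Psi : Psi [::] = 1 -> Gam_autW Psi (e1 gT k) = e1 gT k.
Proof.
move=> p1; rewrite /Gam_autW autV1_e1 // /sAd -/(Gam_unit Psi).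
by rewrite ps_eval_e1_comm -mulrA sinvK ?mulr1 //; apply: Gam_unit_invertible.
Qed.

Lemma Gam_autW_W Psi a : Psi [::] = 1 -> W a -> W (Gam_autW Psi a).
Proof. by move=> p1; apply: chom_W; [apply: Gam_autW_chom|apply: Gam_autW_e1]. Qed.

Lemma StabP Psi : Stab Psi <-> grouplike Psi /\ Delta_compat (Gam_autW Psi).
Proof. by []. Qed.

Lemma Stab1 : Stab (1 : kX).
Proof.
apply/StabP; split; first exact: grouplike1.
by rewrite (_ : Gam_autW 1 = id); [apply: Delta_compat_id|apply/funext/Gam_autW1].
Qed.

Lemma Stab_circast Psi Phi : Stab Psi -> Stab Phi -> Stab (circast Psi Phi).
Proof.
move=> /StabP[gp sp] /StabP[gf sf].
have p1 := grouplike_nil gp; have f1 := grouplike_nil gf.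
apply/StabP; split; first exact: grouplike_circast.
have -> : Gam_autW (circast Psi Phi) = Gam_autW Psi \o Gam_autW Phi.
  by apply/funext => b; apply: Gam_autW_circast.
apply: Delta_compat_comp sp sf.
- exact: chom_clin (Gam_autW_chom p1).
- exact: chom_clin (Gam_autW_chom f1).
- by move=> a; apply: Gam_autW_W.
Qed.

Lemma Stab_inverse Psi Phi : Stab Psi -> grouplike Phi ->
  circast Psi Phi = 1 -> circast Phi Psi = 1 -> Stab Phi.
Proof.
move=> /StabP[gp sp] gf pf fp; have p1 := grouplike_nil gp.
have f1 := grouplike_nil gf; apply/StabP; split; first exact: gf.
apply: Delta_compat_inv sp.
- exact: chom_clin (Gam_autW_chom p1).
- exact: chom_clin (Gam_autW_chom f1).
- by move=> a; apply: Gam_autW_W.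
- by move=> a; rewrite -(Gam_autW_circast a f1 p1) fp Gam_autW1.
by move=> a; rewrite -(Gam_autW_circast a p1 f1) pf Gam_autW1.
Qed.

Lemma Stab_group : is_group_on (@Stab gT k) (@circast gT k) 1.
Proof.
have S1 (x : kX) : Stab x -> x [::] = 1 by case=> /grouplike_nil.
split.
- exact: Stab1.
- exact: Stab_circast.
- by move=> x y z /S1 x1 /S1 y1 _; apply: circastA.
- by move=> x _; rewrite circast1l circast1r.
move=> x Sx; have [gx _] := Sx; have x1 := S1 x Sx.
(* Only right inverses are available so far; the right inverse [z] of [y] equals [x] by
   associativity. *)
have [y [gy xy]] := circast_inverse gx; have y1 := grouplike_nil gy.
have [z [gz yz]] := circast_inverse gy.
have xz : x = z by rewrite -[x]circast1r -yz circastA // xy circast1l.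
have yx : circast y x = 1 by rewrite xz.
by exists y; split; [exact: (Stab_inverse Sx gy xy yx)|exact: xy|exact: yx].
Qed.

End StabGroup.

(** * Base change of the defining equations *)

Section Naturality.
Variables (gT : finGroupType) (k k' : qalg) (f : qalg_hom k k').
Local Notation V := (series (vmon gT) k).
Local Notation kX := (series (wordX gT) k).
Implicit Types (Psi Phi : kX) (a : V).

Lemma smap_xvar x : smap f (xvar k x) = xvar k' x :> series (wordX gT) k'.
Proof. exact: smap_mono. Qed.

Lemma smap_tshift g Psi : smap f (tshift g Psi) = tshift g (smap f Psi).
Proof. by rewrite smap_alg_ext; congr alg_ext; apply/funext => x; rewrite smap_xvar. Qed.

Lemma smap_coprod Psi : smap f (coprod Psi) = coprod (smap f Psi).
Proof.
rewrite smap_alg_ext; congr alg_ext; apply/funext => x.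
by rewrite smapD !smap_tens smap_xvar !smap_1.
Qed.

(** [sinv] is a choice with default 0, and a morphism may send a series without inverse to one that
    has an inverse. Constant term 1 ensures invertibility beforehand, which is why this hypothesis
    recurs in the lemmas on base change. *)
Lemma smap_sinv Psi : Psi [::] = 1 -> smap f (sinv Psi) = sinv (smap f Psi).
Proof. by move/word_invertible/(smap_inv f) => [_ ->]. Qed.

Lemma smap_autX Psi Phi : Psi [::] = 1 ->
  smap f (autX Psi Phi) = autX (smap f Psi) (smap f Phi).
Proof.
move=> p1; rewrite smap_alg_ext; congr alg_ext; apply/funext => -[g|];
  by rewrite ?smapM ?smap_tshift smap_xvar // smap_sinv.
Qed.

Lemma smap_circast Psi Phi : Psi [::] = 1 ->
  smap f (circast Psi Phi) = circast (smap f Psi) (smap f Phi).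
Proof. by move=> p1; rewrite smapM smap_autX. Qed.

Lemma smap_egrp g : smap f (egrp k g) = egrp k' (g : gT).
Proof. exact: smap_mono. Qed.
Lemma smap_e0 : smap f (e0 gT k) = e0 gT k'.
Proof. exact: smap_mono. Qed.
Lemma smap_e1 : smap f (e1 gT k) = e1 gT k'.
Proof. exact: smap_mono. Qed.

Lemma smap_beta1 Psi : smap f (beta1 Psi) = beta1 (smap f Psi).
Proof.
rewrite smap_alg_ext; congr alg_ext; apply/funext => -[g|]; last exact: smap_e0.
by rewrite smapN !smapM !smap_egrp smap_e1.
Qed.

Lemma smap_V_ext (E0 E1 a : V) :
  smap f (V_ext E0 E1 a) = V_ext (smap f E0) (smap f E1) (smap f a).
Proof.
rewrite smap_cont_ext; congr cont_ext; apply/funext => m.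
rewrite smapM smap_prod smap_egrp; congr (_ * _).
by apply: eq_bigr => -[h|] _ //=; rewrite smapM smap_egrp.
Qed.

Lemma smap_autV0 Psi a : Psi [::] = 1 ->
  smap f (autV0 Psi a) = autV0 (smap f Psi) (smap f a).
Proof.
move=> p1; rewrite smap_V_ext !smapM smap_e0 smap_e1 !smap_beta1.
by rewrite smap_sinv.
Qed.

Lemma smap_sAd (u a : V) : sinvertible u ->
  smap f (sAd u a) = sAd (smap f u) (smap f a).
Proof. by move=> iu; rewrite /sAd !smapM (smap_inv f iu).2. Qed.

Lemma smap_autV1 Psi a : Psi [::] = 1 ->
  smap f (autV1 Psi a) = autV1 (smap f Psi) (smap f a).
Proof.
move=> p1; rewrite /autV1 smap_sAd ?smap_autV0 ?smap_beta1 //.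
exact: (chom_inv (beta1_chom gT k) (word_invertible p1)).1.
Qed.

Lemma smap_qscale c (x : k) : f (qscale c x) = qscale c (f x).
Proof. by rewrite /qscale rmorphM (qalg_homE f). Qed.

Lemma smap_ps_exp (h : pseries k) : smap f (ps_exp h) = ps_exp (smap f h).
Proof.
apply/seriesP => w /=; rewrite rmorph_sum; apply: eq_bigr => n _.
by rewrite smap_qscale -smapXn.
Qed.

Lemma smap_Gam Psi : smap f (Gam Psi) = Gam (smap f Psi).
Proof.
rewrite smap_ps_exp; congr ps_exp; apply/seriesP => w /=.
by case: ifP => _; rewrite ?rmorph0 // smap_qscale.
Qed.

Lemma smap_ps_eval (h : pseries k) :
  smap f (ps_eval h (- e1 gT k)) = ps_eval (smap f h) (- e1 gT k').
Proof.
rewrite smap_alg_ext; congr alg_ext; apply/funext => _.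
by rewrite smapN smap_e1.
Qed.

Lemma smap_Gam_autW Psi a : Psi [::] = 1 ->
  smap f (Gam_autW Psi a) = Gam_autW (smap f Psi) (smap f a).
Proof.
move=> p1; rewrite /Gam_autW smap_sAd; last exact: Gam_unit_invertible.
rewrite smap_autV1 // smap_ps_eval -smap_Gam.
by rewrite (smap_inv f (Gam_invertible Psi)).2.
Qed.

Lemma smap_zgen n (g : gT) : smap f (zgen k n g) = zgen k' n g.
Proof. by rewrite smapN !smapM smapXn smap_e0 smap_e1 smap_egrp. Qed.

Lemma smap_DeltaW a : smap f (DeltaW a) = DeltaW (smap f a).
Proof.
rewrite smap_cont_ext; congr cont_ext; apply/funext => m.
rewrite /DeltaW_mon; case: ifP => _; last by rewrite smap_0.
rewrite smap_prod; apply: eq_bigr => p _; rewrite smapN !smapD.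
rewrite !smap_tens !smap_zgen !smap_1 smap_sum; congr (- (_ + _)).
apply: eq_bigr => i _; rewrite smap_sum; apply: eq_bigr => h _.
by rewrite smap_tens !smap_zgen.
Qed.

Lemma smap_Stab_eqn Psi (m : vmon gT) : Psi [::] = 1 ->
  smap f (tens_map (Gam_autW Psi) (Gam_autW Psi) (DeltaW (mono m))) =
    tens_map (Gam_autW (smap f Psi)) (Gam_autW (smap f Psi)) (DeltaW (mono m))
  /\ smap f (DeltaW (Gam_autW Psi (mono m))) =
       DeltaW (Gam_autW (smap f Psi) (mono m)).
Proof.
move=> p1; split; last by rewrite smap_DeltaW smap_Gam_autW // smap_mono.
have fG x := @smap_Gam_autW Psi x p1.
by rewrite (smap_tens_map _ fG fG) smap_DeltaW smap_mono.
Qed.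

Lemma Stab_smap Psi : Stab Psi -> Stab (smap f Psi).
Proof.
move=> /StabP[gp]; have [p1 cp] := (grouplikeP _).1 gp.
have f1 : smap f Psi [::] = 1 by rewrite /= p1 rmorph1.
move/(Delta_compatP (chom_clin (Gam_autW_chom p1))) => st.
apply/StabP; split.
  by apply/grouplikeP; rewrite f1 -smap_coprod cp smap_tens.
apply/(Delta_compatP (chom_clin (Gam_autW_chom f1))) => m mW.
have [e e'] := smap_Stab_eqn m p1.
exact: etrans (esym e) (etrans (congr1 (smap f) (st m mW)) e').
Qed.

End Naturality.

Lemma series_sep (M : gradedMonoidType) (k : qalg)
    (P : forall k' : qalg, qalg_hom k k' -> Prop) (a b : series M k) :
    (forall x y : k, (forall k' (f : qalg_hom k k'), P k' f -> f x = f y) ->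
       x = y) ->
    (forall k' (f : qalg_hom k k'), P k' f -> smap f a = smap f b) -> a = b.
Proof.
move=> sep ab; apply/seriesP => m; apply: sep => k' f Pf.
exact: (congr1 (fun c : series M k' => c m) (ab k' f Pf)).
Qed.

(** Each defining equation is natural and holds after every morphism of the separating family. The
    constant term comes first, since base change of the stabilizer equation presupposes that it is
    1. *)
Lemma Stab_closed (gT : finGroupType) (k : qalg) (x : series (wordX gT) k) :
  (forall a b : k, (forall (k' : qalg) (f : qalg_hom k k'),
     Stab (smap f x) -> f a = f b) -> a = b) -> Stab x.
Proof.
move=> sep; have sepS M := @series_sep M k (fun k' f => Stab (smap f x)).
have x1 : x [::] = 1.
  apply: sep => k' f [/grouplike_nil fx _].
  by rewrite rmorph1 -fx.
apply/StabP; split.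
  apply/grouplikeP; split=> //; apply: sepS => // k' f [[_ cx] _].
  by rewrite smap_coprod smap_tens cx.
apply/(Delta_compatP (chom_clin (Gam_autW_chom x1))) => m mW.
apply: sepS => // k' f /StabP[_ st]; have [e e'] := smap_Stab_eqn f m x1.
exact: etrans e (etrans (st _ (W_mono k' mW)) (esym e')).
Qed.

Lemma Stab_group_functor (gT : finGroupType) :
  is_group_functor (fun (k k' : qalg) (f : qalg_hom k k') => @smap (wordX gT) k k' f)
    (fun k : qalg => @Stab gT k) (fun k : qalg => @circast gT k) (fun k : qalg => 1).
Proof.
split.
- by move=> k; apply: Stab_group.
- by move=> k k' f x; apply: Stab_smap.
- by move=> k k' f x y [/grouplike_nil x1 _] _; apply: smap_circast.
- by move=> k f x fid _; apply/seriesP => m /=; rewrite fid.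
by move=> k1 k2 k3 f g h x hE _; rewrite smap_comp; apply: eq_smap.
Qed.

(** * Dual numbers and the Lie algebra *)

Section Adjoint.
Variables (M : gradedMonoidType) (k : comPzRingType).
Implicit Types u v a b : series M k.

Lemma sadDl u v a : sad (u + v) a = sad u a + sad v a.
Proof. by rewrite /sad mulrDl mulrDr opprD addrACA. Qed.

Lemma sadZl (c : k) u a : sad (c *: u) a = c *: sad u a.
Proof. by rewrite /sad sscalerAl sscalerAr scalerBr. Qed.

Lemma sadM u a b : sad u (a * b) = sad u a * b + a * sad u b.
Proof. by rewrite /sad mulrBl mulrBr !mulrA addrA subrK. Qed.

Lemma sad_clin u : clin (sad u).
Proof. by apply: clin_sub; clin_tac. Qed.

Definition is_derivation (D : series M k -> series M k) : Prop :=
  forall a b, D (a * b) = D a * b + a * D b.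

Lemma derivation_sad D u a : clin D -> is_derivation D ->
  D (sad u a) = sad (D u) a + sad u (D a).
Proof.
move=> cD DM; rewrite /sad (clinB cD) !DM.
by apply/seriesP => m; rewrite !(scoefD, scoefN); ring.
Qed.

Lemma derivation_comm D D' : clin D -> clin D' ->
  is_derivation D -> is_derivation D' ->
  is_derivation (fun a => D (D' a) - D' (D a)).
Proof.
move=> cD cD' DM DM' a b; rewrite DM DM' (clinD cD) (clinD cD') !DM !DM'.
rewrite !(mulrDl, mulrDr, mulrN, mulNr).
by apply/seriesP => m; rewrite !(scoefD, scoefN); ring.
Qed.

(* For derivations D1, D2 with D_i x = sad p_i x, y12 = D1 p2 and y21 = D2 p1,
   the left-hand side is [D1, D2] x. *)
Lemma sad_bracket (p1 p2 q x y12 y21 : series M k) : y12 - y21 = q + sad p1 p2 ->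
  (sad y12 x + sad p2 (sad p1 x)) - (sad y21 x + sad p1 (sad p2 x)) = sad q x.
Proof.
move=> /(canRL (subrK _)) ->; rewrite /sad.
rewrite !(mulrDl, mulrDr, mulrN, mulNr, mulrA, opprD, opprK).
by apply/seriesP => m; rewrite !(scoefD, scoefN); ring.
Qed.

End Adjoint.

Definition dnum (a b : ratQ) : dualQ := qalg_in dualQ a + qscale b epsQ.

Lemma polyn_dnum (a b : ratQ) :
  (dnum a b : {poly %/ ('X^2 : {poly rat})})
    = (a : rat)%:P + (b : rat)%:P * 'X :> {poly rat}.
Proof.
rewrite /dnum /qscale /=; congr (_ + _).
(* The modulus X^2 is already monic and nonconstant, so [mk_monic] leaves it alone and X is a
   reduced representative. *)
have sX : (size ('X : {poly rat}) < size (mk_monic ('X^2 : {poly rat})))%N.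
  by rewrite mk_monic_Xn size_polyXn size_polyX.
rewrite !Pdiv.CommonRing.rmodp_small // mul_polyC.
exact: leq_ltn_trans (size_scale_leq _ _) sX.
Qed.

Lemma dnum_inj (a b a' b' : ratQ) : dnum a b = dnum a' b' -> a = a' /\ b = b'.
Proof.
move=> /(congr1 (fun p : {poly %/ ('X^2 : {poly rat})} => p : {poly rat})).
rewrite !polyn_dnum => e.
have c0 := congr1 (fun p : {poly rat} => p`_0) e.
have c1 := congr1 (fun p : {poly rat} => p`_1) e.
by move: c0 c1; rewrite /= !coefD !coefC !coefMX !coefC /= !addr0 !add0r.
Qed.

Lemma dual_aug_dnum a b : dual_aug (dnum a b) = a.
Proof.
by rewrite /dual_aug polyn_dnum coefD coefC coefMX /= addr0.
Qed.

Lemma dnum_exists (p : dualQ) : exists b, p = dnum (dual_aug p) b.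
Proof.
exists ((p : {poly %/ ('X^2 : {poly rat})})`_1); apply: val_inj.
rewrite [RHS]polyn_dnum; apply/polyP => -[|[|i]];
  rewrite coefD coefC coefMX coefC /= ?addr0 ?add0r // nth_default //.
have sm : size (mk_monic ('X^2 : {poly rat})) = 3.
  by rewrite mk_monic_Xn size_polyXn.
have := size_mk_monic (p : {poly %/ ('X^2 : {poly rat})}).
by rewrite [X in (_ < X)%N]sm ltnS => /leq_trans; apply.
Qed.

Lemma epsQM : epsQ * epsQ = 0.
Proof.
transitivity (in_qpoly ('X^2 : {poly rat}) ('X * 'X)).
  exact: esym (in_qpolyM _ _ _).
apply: val_inj; rewrite /= -expr2 mk_monic_Xn.
exact: Pdiv.RingMonic.rmodpp (monicXn _ _).
Qed.

Lemma dnumD a b c d : dnum a b + dnum c d = dnum (a + c) (b + d).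
Proof. by rewrite /dnum /qscale !rmorphD mulrDl addrACA. Qed.

Lemma dnumM a b c d : dnum a b * dnum c d = dnum (a * c) (a * d + b * c).
Proof.
rewrite /dnum /qscale !rmorphD !rmorphM mulrDl !mulrDr !mulrDl.
set A := qalg_in dualQ a; set B := qalg_in dualQ b.
set C := qalg_in dualQ c; set D := qalg_in dualQ d.
rewrite (_ : B * epsQ * (D * epsQ) = 0); last first.
  by rewrite mulrACA epsQM mulr0.
by rewrite addr0 -addrA mulrA (mulrAC B).
Qed.

Lemma dnum1 : dnum 1 0 = 1.
Proof. by rewrite /dnum /qscale !rmorph1 rmorph0 mul0r addr0. Qed.
Lemma dnum0 : dnum 0 0 = 0.
Proof. by rewrite /dnum /qscale !rmorph0 mul0r addr0. Qed.
Lemma dnum_nat n : dnum n%:R 0 = n%:R.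
Proof. by rewrite /dnum /qscale rmorph_nat rmorph0 mul0r addr0. Qed.

Lemma dnum_sum I (r : seq I) (F G : I -> ratQ) :
  \sum_(i <- r) dnum (F i) (G i) = dnum (\sum_(i <- r) F i) (\sum_(i <- r) G i).
Proof.
elim: r => [|i r IH]; first by rewrite !big_nil dnum0.
by rewrite !big_cons IH dnumD.
Qed.

Definition QtoD : qalg_hom ratQ dualQ :=
  @QAlgHom ratQ dualQ (qalg_in dualQ) (fun c => erefl).

Section DualSeries.
Variables M N : gradedMonoidType.
Local Notation QM := (series M ratQ).
Local Notation DM := (series M dualQ).
Implicit Types a b : QM.

(* the series a + eps b *)
Definition dl a b : DM := Series (fun m => dnum (a m) (b m)).

Lemma dl_inj a b a' b' : dl a b = dl a' b' -> a = a' /\ b = b'.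
Proof.
move=> e; have em m := dnum_inj (congr1 (fun c : DM => c m) e).
by split; apply/seriesP => m; case: (em m).
Qed.

Lemma dl_exists (p : DM) : exists b, p = dl (smap dual_aug p) b.
Proof.
have [b bE] := choice (fun m => dnum_exists (p m)).
by exists (Series b); apply/seriesP => m; apply: bE.
Qed.

Lemma smap_dual_aug a b : smap dual_aug (dl a b) = a.
Proof. by apply/seriesP => m; apply: dual_aug_dnum. Qed.

Lemma dlD a b a' b' : dl a b + dl a' b' = dl (a + a') (b + b').
Proof. by apply/seriesP => m; apply: dnumD. Qed.

Lemma dlM a b a' b' : dl a b * dl a' b' = dl (a * a') (a * b' + b * a').
Proof.
apply/seriesP => m; rewrite scoefM /= -big_split /= -dnum_sum.
by apply: eq_bigr => p _; rewrite dnumM.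
Qed.

Lemma dlZ (c : ratQ) a b : qalg_in dualQ c *: dl a b = dl (c *: a) (c *: b).
Proof.
apply/seriesP => m; rewrite scoefZ /=.
have -> : qalg_in dualQ c = dnum c 0.
  by rewrite /dnum /qscale rmorph0 mul0r addr0.
by rewrite dnumM mul0r addr0.
Qed.

Lemma dl_mono m : dl (mono m) 0 = mono m.
Proof. by apply/seriesP => n; apply: dnum_nat. Qed.

Lemma dl1 : dl 1 0 = 1. Proof. exact: dl_mono. Qed.
Lemma dl0 : dl 0 0 = 0. Proof. by apply/seriesP => m; apply: dnum0. Qed.

Lemma dlE a b : dl a b = smap QtoD a + epsQ *: smap QtoD b.
Proof.
by apply/seriesP => m; rewrite scoefD scoefZ /= /dnum /qscale mulrC.
Qed.

Lemma dl_order d a b : has_order d (dl a b) <-> has_order d a /\ has_order d b.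
Proof.
split=> [o|[oa ob] m lt]; last by rewrite /= oa // ob // dnum0.
by split=> m lt; have := o m lt; rewrite -dnum0 => /dnum_inj[].
Qed.

Lemma dl_sinv b : sinvertible (dl 1 b) /\ sinv (dl 1 b) = dl 1 (- b).
Proof.
have e1 : dl 1 b * dl 1 (- b) = 1.
  by rewrite dlM !mul1r !mulr1 addNr dl1.
have e2 : dl 1 (- b) * dl 1 b = 1.
  by rewrite dlM !mul1r !mulr1 addrN dl1.
by split; [exists (dl 1 (- b))|apply: sinv_eq].
Qed.

End DualSeries.

Section DualMaps.
Variables M N : gradedMonoidType.
Implicit Types a b : series M ratQ.

(** By [dlE], a + eps b is a combination of two series defined over Q; linearity over Q[eps] then
    lets a map defined over Q act on each component. *)
Lemma dl_natural (F : series M dualQ -> series N dualQ)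
    (T : series M ratQ -> series N ratQ) a b :
  clin F -> (forall x, smap QtoD (T x) = F (smap QtoD x)) ->
  F (dl a b) = dl (T a) (T b).
Proof. by move=> cF FT; rewrite dlE (clinD cF) (clinZ cF) -!FT -dlE. Qed.

Lemma dl_cont_ext (tau delta : M -> series N ratQ) a b :
  cont_ext (fun m => dl (tau m) (delta m)) (dl a b) =
  dl (cont_ext tau a) (cont_ext delta a + cont_ext tau b).
Proof.
apply/seriesP => n /=; rewrite -big_split /= -dnum_sum.
by apply: eq_bigr => m _; rewrite dnumM.
Qed.

Lemma cont_ext0 (tau : M -> series N ratQ) : cont_ext tau 0 = 0.
Proof. by apply/seriesP => n; rewrite /= big1 // => m _; rewrite mul0r. Qed.

End DualMaps.

Lemma one_epsE (gT : finGroupType) (psi : series (wordX gT) ratQ) :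
  one_eps psi = dl 1 psi.
Proof.
by apply/seriesP => w; rewrite /one_eps scoefD /= /dnum rmorph_nat.
Qed.

Lemma dl_tens (M N : gradedMonoidType) (a b : series M ratQ) (c d : series N ratQ) :
  tens (dl a b) (dl c d) = dl (tens a c) (tens a d + tens b c).
Proof. by apply/seriesP => p; rewrite /= dnumM. Qed.

(** This is the Leibniz rule, from eps^2 = 0. It is why [derX] and [derV0], built from [word_der],
    appear as eps-parts of automorphisms. *)
Lemma dl_word_prod (X : finType) (M : gradedMonoidType)
    (s d : X -> series M ratQ) (u : word X) :
  \prod_(x <- u) dl (s x) (d x) = dl (\prod_(x <- u) s x) (word_der s d u).
Proof.
elim/word_ind: u => [|x u IH]; first by rewrite !big_nil dl1.
by rewrite !big_cons IH dlM addrC.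
Qed.

(* A morphism over the dual numbers that lifts phi is phi + eps D with D a
   phi-derivation. *)
Section DualMorphism.
Variables M N : gradedMonoidType.
Variable F : series M dualQ -> series N dualQ.
Variables phi D : series M ratQ -> series N ratQ.
Hypothesis FD : forall a, F (dl a 0) = dl (phi a) (D a).

Lemma dual_clin : clin F -> clin phi /\ clin D.
Proof.
move=> cF.
have lin c a b : dl (phi (c *: a + b)) (D (c *: a + b)) =
    dl (c *: phi a + phi b) (c *: D a + D b).
  rewrite -FD -dlD -dlZ -!FD -(clinZ cF) -(clinD cF) dlZ dlD scaler0 addr0.
  by [].
have ord d a : has_order d a -> has_order d (phi a) /\ has_order d (D a).
  move=> oa; apply/dl_order; rewrite -FD; apply: cF.2.
  by apply/dl_order; split=> //; apply: has_order_zero.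
by split; split=> [c a b|d a /ord[]//]; case/dl_inj: (lin c a b).
Qed.

Lemma dual_derivation : chom F ->
  forall a b, D (a * b) = D a * phi b + phi a * D b.
Proof.
case=> _ _ FM a b; have := FM (dl a 0) (dl b 0).
rewrite dlM mulr0 mul0r addr0 !FD dlM => /dl_inj[_ ->].
by rewrite addrC.
Qed.

End DualMorphism.

Lemma cont_ext_mono_id (M : gradedMonoidType) (k : comPzRingType) (x : series M k) :
  cont_ext (fun m => mono m) x = x.
Proof. exact: esym (clin_cont_ext (@clin_id M k) x). Qed.

Lemma cont_extD (M N : gradedMonoidType) (k : comPzRingType)
    (s t : M -> series N k) (x : series M k) :
  cont_ext (fun m => s m + t m) x = cont_ext s x + cont_ext t x.
Proof.
apply/seriesP => n; rewrite scoefD /= -big_split /=.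
by apply: eq_bigr => m _; rewrite mulrDr.
Qed.

(** The term f (x) g carries eps^2 and vanishes; for f = g there remains the operator f (x) id + id
    (x) f by which [stab] is defined. *)
Lemma tens_map_dl (M N : gradedMonoidType)
    (F : series M dualQ -> series M dualQ) (G : series N dualQ -> series N dualQ)
    (f : series M ratQ -> series M ratQ) (g : series N ratQ -> series N ratQ) x :
  (forall m, F (mono m) = dl (mono m) (f (mono m))) ->
  (forall n, G (mono n) = dl (mono n) (g (mono n))) ->
  tens_map F G (dl x 0) = dl x (tens_map f id x + tens_map id g x).
Proof.
move=> Ff Gg; rewrite /tens_map.
have -> : (fun p : M * N => tens (F (mono p.1)) (G (mono p.2))) = (fun p =>
    dl (mono p) (tens (f (mono p.1)) (mono p.2) + tens (mono p.1) (g (mono p.2)))).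
  apply/funext => -[m n] /=.
  by rewrite Ff Gg dl_tens tens_mono addrC.
by rewrite dl_cont_ext cont_ext_mono_id cont_ext0 addr0 cont_extD.
Qed.

(** * First-order expansion of the group law and of the automorphisms *)

Section LieGroupLaw.
Variable gT : finGroupType.
Local Notation QX := (series (wordX gT) ratQ).
Local Notation V := (series (vmon gT) ratQ).
Implicit Types (psi a b : QX) (g : gT).

Lemma tshift_dl g a b : tshift g (dl a b) = dl (tshift g a) (tshift g b).
Proof.
apply: dl_natural; first exact: chom_clin (tshift_chom _ _).
by move=> x; apply: smap_tshift.
Qed.

Lemma coprod_dl a b : coprod (dl a b) = dl (coprod a) (coprod b).
Proof.
apply: dl_natural; first exact: chom_clin (coprod_chom _ _).
by move=> x; apply: smap_coprod.
Qed.

Lemma beta1_dl a b : beta1 (dl a b) = dl (beta1 a) (beta1 b).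
Proof.
apply: dl_natural; first exact: chom_clin (beta1_chom _ _).
by move=> x; apply: smap_beta1.
Qed.

Lemma DeltaW_dl (a b : V) : DeltaW (dl a b) = dl (DeltaW a) (DeltaW b).
Proof.
apply: dl_natural; first exact: DeltaW_clin.
by move=> x; apply: smap_DeltaW.
Qed.

Lemma alg_ext_xvar a : alg_ext (xvar ratQ) a = a.
Proof.
move: a; apply: chom_word_ext => [||x].
- by apply: alg_ext_chom => x; apply: xvar_order.
- by split=> //; apply: clin_id.
by rewrite alg_ext_letter // => y; apply: xvar_order.
Qed.

(** On x_g, conjugation by 1 + eps t_g(psi) adds eps times the commutator of x_g with t_g(psi),
    which is the value of [derX psi] there. *)
Lemma autX_dl psi a b : autX (dl 1 psi) (dl a b) = dl a (derX psi a + b).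
Proof.
pose d (x : option gT) : QX :=
  if x is Some g then sad (xvar ratQ x) (tshift g psi) else 0.
rewrite /autX /alg_ext.
have -> : (fun u : wordX gT => \prod_(x <- u)
    (if x is Some g then tshift g (sinv (dl 1 psi)) * xvar dualQ x
       * tshift g (dl 1 psi) else xvar dualQ x)) =
    (fun u => dl (\prod_(x <- u) xvar ratQ x) (word_der (xvar ratQ) d u)).
  apply/funext => u; rewrite -dl_word_prod; apply: eq_bigr => x _.
  rewrite /d (dl_sinv psi).2; case: x => [g|]; last by rewrite dl_mono.
  have [_ t1 _] := tshift_chom ratQ g.
  rewrite !tshift_dl t1 -[xvar dualQ _]dl_mono !dlM !mul1r !mulr1 add0r.
  by rewrite (clinN (chom_clin (tshift_chom ratQ g))) mulNr.
by rewrite [LHS]dl_cont_ext -[cont_ext _ _]/(alg_ext (xvar ratQ) _)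
  -[X in _ + X]/(alg_ext (xvar ratQ) _) !alg_ext_xvar.
Qed.

Lemma autX_dl0 psi a : autX (dl 1 psi) (dl a 0) = dl a (derX psi a).
Proof. by rewrite autX_dl addr0. Qed.

Lemma derX_clin psi : clin (derX psi).
Proof. by case: (dual_clin (autX_dl0 psi) (chom_clin (autX_chom _))). Qed.

Lemma grouplike_dl psi : grouplike (dl 1 psi) <-> primitive psi.
Proof.
rewrite /grouplike /primitive /= coprod_dl dl_tens.
have [_ -> _] := coprod_chom gT ratQ; rewrite tens11.
split=> [[_ /dl_inj[_ ->]]|->]; first by rewrite addrC.
by split; [apply: (dl_sinv psi).1|rewrite addrC].
Qed.

Lemma primitive_nil psi : primitive psi -> psi [::] = 0.
Proof.
move=> /grouplike_dl/grouplike_nil; rewrite /= -dnum1 => /dnum_inj[_].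
by [].
Qed.

Lemma autX_mono_dl psi (u : wordX gT) :
  autX (dl 1 psi) (mono u) = dl (mono u) (derX psi (mono u)).
Proof. by rewrite -dl_mono autX_dl0. Qed.

Lemma coprod_derX psi a : primitive psi -> coprod (derX psi a) =
  tens_map (derX psi) id (coprod a) + tens_map id (derX psi) (coprod a).
Proof.
move/grouplike_dl => gp; have := coprod_autX (dl a 0) gp.
rewrite autX_dl0 !coprod_dl (clin0 (chom_clin (coprod_chom gT ratQ))).
rewrite (tens_map_dl _ (autX_mono_dl psi) (autX_mono_dl psi)).
by case/dl_inj.
Qed.

Lemma qx0x1_dl a b : qx0x1 (dl a b) = dl (qx0x1 a) (qx0x1 b).
Proof.
apply: dl_natural; first exact: qx0x1_clin.
move=> x; rewrite smap_cont_ext; congr cont_ext; apply/funext => u.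
by case: ifP => _; rewrite ?smap_mono ?smap_0.
Qed.

Lemma px0_dl a b : px0 (dl a b) = dl (px0 a) (px0 b).
Proof.
apply: dl_natural; first exact: chom_clin (px0_chom _ _).
move=> x; rewrite smap_alg_ext; congr alg_ext; apply/funext => -[g|].
  exact: smap_0.
exact: smap_mono.
Qed.

Lemma qx0x1_derX psi a : primitive psi ->
  qx0x1 (derX psi a) = - (px0 psi * qx0x1 a).
Proof.
move=> pp; have p1 : dl 1 psi [::] = 1.
  by apply: grouplike_nil; apply/grouplike_dl.
have := qx0x1_autX (dl a 0) p1.
have cp := px0_chom gT ratQ; have [_ pp1 _] := cp.
rewrite autX_dl0 (dl_sinv psi).2 px0_dl !qx0x1_dl (clin0 (qx0x1_clin _ _)).
rewrite dlM pp1 mul1r mul1r (clinN (chom_clin cp)) => /dl_inj[_ ->].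
by rewrite add0r mulNr.
Qed.

(* The two terms of s_op cancel on the words x_0^n x_1. *)
Lemma coef_x0x1_s_op psi1 psi2 n : primitive psi1 -> primitive psi2 ->
  coef_x0x1 (s_op psi1 psi2) n = 0.
Proof.
move=> p1 p2; rewrite -qx0x1_coef (clinD (qx0x1_clin gT ratQ)) qx0x1_derX //.
by rewrite qx0x1M augE primitive_nil // scale0r mulr0 add0r addrN.
Qed.

(** The defect of primitivity comes from the product [psi1 * psi2]; it is symmetric in [psi1] and
    [psi2] and so cancels in the bracket. *)
Lemma primitive_s_op psi1 psi2 : primitive psi1 -> primitive psi2 ->
  coprod (s_op psi1 psi2) = tens (s_op psi1 psi2) 1 + tens 1 (s_op psi1 psi2)
    + (tens psi1 psi2 + tens psi2 psi1).
Proof.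
move=> p1 p2; have cp := coprod_chom gT ratQ; have [_ _ cM] := cp.
have cd := derX_clin psi1.
have d1 : derX psi1 1 = 0.
  have [_ a1 _] := autX_chom (dl 1 psi1 : series (wordX gT) dualQ).
  by have := autX_dl0 psi1 1; rewrite dl1 a1 -dl1 => /dl_inj[_ <-].
rewrite /s_op (clinD (chom_clin cp)) cM coprod_derX // p1 p2.
have ci := @clin_id (wordX gT) ratQ.
rewrite (clinD (tens_map_clin cd ci)) (clinD (tens_map_clin ci cd)).
rewrite !(tens_map_tens cd ci) !(tens_map_tens ci cd) d1 tens0l tens0r.
rewrite mulrDl !mulrDr !tensM !mulr1 !mul1r tensDl tensDr addr0 add0r.
rewrite (addrC (tens psi2 psi1)) (addrACA _ (tens psi1 psi2)) [LHS]addrAC.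
by rewrite (addrACA (tens (psi1 * psi2) 1)).
Qed.

Lemma primitive_lie_bracket psi1 psi2 : primitive psi1 -> primitive psi2 ->
  primitive (lie_bracket psi1 psi2).
Proof.
move=> p1 p2; rewrite /primitive /= /lie_bracket.
rewrite (clinB (chom_clin (coprod_chom gT ratQ))) !primitive_s_op //.
rewrite tensBl tensBr (addrC (tens psi2 psi1)) opprD addrACA subrr addr0.
by rewrite opprD addrACA.
Qed.

Lemma autV0_dl psi (a b : V) : autV0 (dl 1 psi) (dl a b) = dl a (derV0 psi a + b).
Proof.
pose d := vletter 0 (sad (e1 gT ratQ) (beta1 psi)).
have [_ b1 _] := beta1_chom gT ratQ.
have cb := chom_clin (beta1_chom gT ratQ).
rewrite /autV0 /V_ext (dl_sinv psi).2 !beta1_dl b1.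
have -> : (fun m : vmon gT => (\prod_(x <- vword m)
    vletter (e0 gT dualQ) (dl 1 (beta1 (- psi)) * e1 gT dualQ * dl 1 (beta1 psi)) x)
    * egrp dualQ (vgrp m)) =
  (fun m => dl ((\prod_(x <- vword m) vletter (e0 gT ratQ) (e1 gT ratQ) x)
                 * egrp ratQ (vgrp m))
       (word_der (vletter (e0 gT ratQ) (e1 gT ratQ)) d (vword m)
         * egrp ratQ (vgrp m))).
  (* The vanishing summand inserted in the eps-part is the contribution of the zero eps-part of the
     group element; with it [dlM] can be read backwards. *)
  apply/funext => m; rewrite /egrp -dl_mono -[in RHS](add0r (word_der _ _ _ * _)).
  rewrite -[X in dl _ (X + _)](mulr0 (\prod_(x <- vword m) vletter (e0 gT ratQ) (e1 gT ratQ) x)).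
  rewrite -dlM; congr (_ * _); rewrite -dl_word_prod; apply: eq_bigr => x _.
  case: x => [g|] /=; last by rewrite /e0 dl_mono.
  rewrite /egrp -dl_mono /e1 -dl_mono !dlM !mul1r !mulr1 add0r mul0r addr0.
  by rewrite (clinN cb) mulNr.
have idE x : V_ext (e0 gT ratQ) (e1 gT ratQ) x = x.
  move: x; apply: chom_V_ext => [||||g].
  - by apply: V_ext_chom; [apply: e0_order|apply: e1_order|apply: egrp_e0].
  - by split=> //; apply: clin_id.
  - by apply: V_ext_e0; [apply: e0_order|apply: e1_order].
  - by apply: V_ext_e1; [apply: e0_order|apply: e1_order].
  by apply: V_ext_egrp; [apply: e0_order|apply: e1_order].
by rewrite [LHS]dl_cont_ext -[cont_ext _ a]/(V_ext (e0 gT ratQ) (e1 gT ratQ) a)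
  -[X in _ + X]/(V_ext (e0 gT ratQ) (e1 gT ratQ) b) !idE.
Qed.

Lemma dl_mono_primitive psi : primitive psi -> (dl 1 psi : series _ dualQ) [::] = 1.
Proof. by move=> /grouplike_dl/grouplike_nil. Qed.

Lemma derV0_e0 psi : derV0 psi (e0 gT ratQ) = 0.
Proof.
have := autV0_dl psi (e0 gT ratQ) 0; rewrite addr0 dl_mono autV0_e0.
by rewrite -[e0 gT dualQ]dl_mono => /dl_inj[_ <-].
Qed.

Lemma derV0_egrp psi g : derV0 psi (egrp ratQ g) = 0.
Proof.
have := autV0_dl psi (egrp ratQ g) 0; rewrite addr0 dl_mono autV0_egrp.
by rewrite -[egrp dualQ g]dl_mono => /dl_inj[_ <-].
Qed.

Lemma derV0_beta1 psi a : derV0 psi (beta1 a) = beta1 (derX psi a).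
Proof.
have := autV0_beta1 (dl 1 psi) (dl a 0).
rewrite !beta1_dl autV0_dl autX_dl0 beta1_dl.
by rewrite (clin0 (chom_clin (beta1_chom gT ratQ))) addr0 => /dl_inj[].
Qed.

Lemma sAd_dl (p a b : V) : sAd (dl 1 p) (dl a b) = dl a (sad p a + b).
Proof.
rewrite /sAd (dl_sinv p).2 !dlM !mul1r !mulr1 /sad mulrN; congr dl.
by rewrite addrC -addrA addrC.
Qed.

Lemma autV1_dl psi (a : V) : autV1 (dl 1 psi) (dl a 0) = dl a (derV1 psi a).
Proof.
have [_ b1 _] := beta1_chom gT ratQ.
by rewrite /autV1 beta1_dl b1 autV0_dl addr0 sAd_dl.
Qed.

Lemma qscale_dnum c (x y : ratQ) : qscale c (dnum x y) = dnum (qscale c x) (qscale c y).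
Proof.
have -> : qscale c (dnum x y) = dnum c 0 * dnum x y.
  by rewrite /qscale {2}/dnum /qscale rmorph0 mul0r addr0.
by rewrite dnumM mul0r addr0.
Qed.

Lemma Gam_log_dl psi : Gam_log (dl 1 psi) = dl 0 (Gam_log psi).
Proof.
apply/seriesP => w /=; case: ifP => _; last by rewrite dnum0.
rewrite [X in qscale _ X](_ : _ = dnum 0 (coef_x0x1 psi (size w).-1)).
  by rewrite qscale_dnum /qscale mulr0.
by rewrite /coef_x0x1 /=; case: (size w).-1.
Qed.

Lemma ps_exp_dl (h : pseries ratQ) : has_order 1 h -> ps_exp (dl 0 h) = dl 1 h.
Proof.
move=> oh; have o1 : has_order 1 (dl 0 h).
  by apply/dl_order; split=> //; apply: has_order_zero.
have sq0 : dl 0 h * dl 0 h = 0 by rewrite dlM !mul0r mulr0 addr0 dl0.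
(* One more than the degree of [w], so that the terms of exponent 0 and 1 are both present even for
   the empty word; the others vanish as the square is 0. *)
apply/seriesP => w; rewrite (ps_exp_coef (N := (gdeg w).+1)) //.
rewrite 2!big_ord_recl big1 => [|i _]; last first.
  by rewrite !exprS mulrA sq0 mul0r scaler0.
rewrite addr0 expr0 expr1 !invr1 rmorph1 !scale1r.
by rewrite -[1]dl1 dlD addr0 add0r.
Qed.

Definition gam_unit psi : V := ps_eval (Gam_log psi) (- e1 gT ratQ).

Lemma Gam_unit_dl psi : Gam_unit (dl 1 psi) = dl 1 (- gam_unit psi).
Proof.
have GE : Gam (dl 1 psi) = dl 1 (Gam_log psi).
  rewrite -ps_exp_dl; last exact: Gam_log_order.
  by rewrite -Gam_log_dl.
have c := ps_eval_e1_chom gT ratQ; have [_ c1 _] := c.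
rewrite /Gam_unit GE (dl_sinv _).2.
rewrite (dl_natural (T := fun h => ps_eval h (- e1 gT ratQ)) _ _
  (chom_clin (ps_eval_e1_chom gT dualQ))); last by move=> h; apply: smap_ps_eval.
by rewrite c1 (clinN (chom_clin c)).
Qed.

(* the derivative of [Gam_autW] at 1 in the direction psi (see [Gam_autW_dl]) *)
Definition Gam_autW_der psi (a : V) : V := sad (- gam_unit psi) a + derV1 psi a.

Lemma Gam_autW_dl psi (a : V) :
  Gam_autW (dl 1 psi) (dl a 0) = dl a (Gam_autW_der psi a).
Proof. by rewrite Gam_autWE Gam_unit_dl autV1_dl sAd_dl. Qed.

(** The signs (-1)^(n+1) and (-1)^(n-1) agree, so the two series differ only in the term n = 1. *)
Lemma gam_split psi : gam psi = Gam_log psi + coef_x0x1 psi 0 *: mono (letter tt).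
Proof.
apply/seriesP => w; rewrite scoefD scoefZ /= [w]unit_wordE size_nseq.
case: (size w) => [|[|n]] /=.
- by rewrite mulr0 addr0.
- by rewrite add0r mulr1 /qscale sqrrN expr1n divr1 rmorph1 mul1r.
by rewrite mulr0 addr0 !exprS mulrA mulrNN !mul1r.
Qed.

(* [gam] has a term of degree 1 that the logarithm of [Gam] lacks. The resulting
   multiple of ad e_1 does not change the stabilizer, e_1 being primitive for
   [DeltaW]. *)
Lemma gam_derWE psi (a : V) : gam_derW psi a =
  coef_x0x1 psi 0 *: sad (e1 gT ratQ) a + Gam_autW_der psi a.
Proof.
have c := chom_clin (ps_eval_e1_chom gT ratQ).
rewrite /gam_derW gam_split (clinD c) (clinZ c) ps_eval_e1_letter.
rewrite -/(gam_unit psi) scalerN opprD opprK [X in sad X]addrC sadDl sadZl.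
exact: esym (addrA _ _ _).
Qed.

End LieGroupLaw.

(** * Derivations compatible with the harmonic coproduct *)

Section DeltaDerivations.
Variable gT : finGroupType.
Local Notation V := (series (vmon gT) ratQ).
Implicit Types (D : V -> V) (a : V).

Definition Delta_der D : Prop := forall a, W a ->
  tens_map D id (DeltaW a) + tens_map id D (DeltaW a) = DeltaW (D a).

Lemma Delta_derP D : clin D -> Delta_der D <->
  forall m : vmon gT, in_Wmon m ->
    tens_map D id (DeltaW (mono m)) + tens_map id D (DeltaW (mono m)) =
    DeltaW (D (mono m)).
Proof.
move=> cD; have ci := @clin_id (vmon gT) ratQ; have cW := @DeltaW_clin gT ratQ.
split=> [st m mW|st]; first by apply: st; apply: W_mono.
apply: W_ext => //; last exact: clin_comp cW cD.
apply: clin_add; first exact: (clin_comp (tens_map_clin cD ci) cW).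
exact: (clin_comp (tens_map_clin ci cD) cW).
Qed.

Lemma tens_map_linl (c : ratQ) D D' (x : series (vmon gT * vmon gT)%type ratQ) :
  tens_map (fun a => c *: D a + D' a) id x = c *: tens_map D id x + tens_map D' id x.
Proof.
apply/seriesP => p; rewrite scoefD scoefZ /= mulr_sumr -big_split /=.
by apply: eq_bigr => q _; ring.
Qed.

Lemma tens_map_linr (c : ratQ) D D' (x : series (vmon gT * vmon gT)%type ratQ) :
  tens_map id (fun a => c *: D a + D' a) x = c *: tens_map id D x + tens_map id D' x.
Proof.
apply/seriesP => p; rewrite scoefD scoefZ /= mulr_sumr -big_split /=.
by apply: eq_bigr => q _; ring.
Qed.

Lemma Delta_der_lin (c : ratQ) D D' : Delta_der D -> Delta_der D' ->
  Delta_der (fun a => c *: D a + D' a).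
Proof.
move=> sD sD' a Wa; have cW := @DeltaW_clin gT ratQ.
rewrite tens_map_linl tens_map_linr (clinD cW) (clinZ cW) -sD // -sD' //.
by rewrite addrACA scalerDr.
Qed.

Lemma Delta_der_zero : Delta_der (fun=> 0).
Proof.
move=> a _; rewrite (clin0 (@DeltaW_clin gT ratQ)).
have z x : tens_map (fun _ : V => 0) id x = 0 :> series (vmon gT * vmon gT)%type ratQ.
  by apply/seriesP => p; rewrite /= big1 // => q _; rewrite mul0r mulr0.
have z' x : tens_map id (fun _ : V => 0) x = 0 :> series (vmon gT * vmon gT)%type ratQ.
  by apply/seriesP => p; rewrite /= big1 // => q _; rewrite !mulr0.
by rewrite z z' addr0.
Qed.

(** Applying the condition twice gives, besides the composites acting in one slot, the mixed terms D
    (x) D' + D' (x) D. These are symmetric in the two maps and drop out of the commutator. *)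
Lemma Delta_der_bracket D D' : clin D -> clin D' ->
  (forall a, W a -> W (D a)) -> (forall a, W a -> W (D' a)) ->
  Delta_der D -> Delta_der D' -> Delta_der (fun a => D (D' a) - D' (D a)).
Proof.
move=> cD cD' WD WD' sD sD'.
have ci := @clin_id (vmon gT) ratQ; have cW := @DeltaW_clin gT ratQ.
have lin (f g : V -> V) : (fun a => f a - g a) = (fun a => -1 *: g a + f a).
  by apply/funext => a; rewrite scaleN1r addrC.
have key f g : clin f -> clin g -> (forall a, W a -> W (g a)) ->
    Delta_der f -> Delta_der g -> forall a, W a ->
    DeltaW (f (g a)) = tens_map (f \o g) id (DeltaW a) + tens_map id (f \o g) (DeltaW a)
      + (tens_map f g (DeltaW a) + tens_map g f (DeltaW a)).
  move=> cf cg Wg sf sg a Wa; rewrite -sf; last exact: Wg.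
  rewrite -sg // (clinD (tens_map_clin cf ci)) (clinD (tens_map_clin ci cf)).
  have /= <- := tens_map_comp cf cg ci ci (DeltaW a).
  have /= <- := tens_map_comp cf ci ci cg (DeltaW a).
  have /= <- := tens_map_comp ci cg cf ci (DeltaW a).
  have /= <- := tens_map_comp ci ci cf cg (DeltaW a).
  by rewrite [X in _ + X]addrC addrACA.
move=> a Wa; rewrite lin tens_map_linl tens_map_linr !scaleN1r.
rewrite (clinD cW) (clinN cW) (key D D') // (key D' D) //.
set A := tens_map (D \o D') _ _; set B := tens_map _ (D \o D') _.
set A' := tens_map (D' \o D) _ _; set B' := tens_map _ (D' \o D) _.
set C := tens_map D D' _; set C' := tens_map D' D _.
rewrite -/A -/B -/A' -/B'.
by apply/seriesP => m; rewrite !(scoefD, scoefN); ring.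
Qed.

Lemma DeltaW_e1 : DeltaW (e1 gT ratQ) = tens (e1 gT ratQ) 1 + tens 1 (e1 gT ratQ).
Proof.
have zE : zgen ratQ 1 (1%g : gT) = - e1 gT ratQ by rewrite /zgen expr0 mul1r mul1r.
apply: oppr_inj; rewrite -(clinN (@DeltaW_clin gT ratQ)) -zE DeltaW_zgen //.
by rewrite /Delta_zgen big_geq // addr0 zE tensNl tensNr opprD.
Qed.

(** Multiplicativity of [DeltaW] on W turns ad e_1 into the commutator with e_1 (x) 1 + 1 (x) e_1,
    which is the sum of ad e_1 in either slot. *)
Lemma Delta_der_e1 : Delta_der (sad (e1 gT ratQ)).
Proof.
move=> a Wa; have cW := @DeltaW_clin gT ratQ.
have cs := @sad_clin _ ratQ (e1 gT ratQ).
have ci := @clin_id (vmon gT) ratQ.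
rewrite {3}/sad (clinB cW) !DeltaWM //; [|exact: W_e1..].
rewrite DeltaW_e1; move: (DeltaW a); apply: clin_ext => [||[m n]].
- by apply: clin_add; apply: tens_map_clin.
- by apply: clin_sub; clin_tac.
rewrite !tens_map_mono //= -tens_mono /sad tensBl tensBr mulrDl mulrDr !tensM.
by rewrite !mul1r !mulr1 opprD addrACA.
Qed.

(** On a monomial of W the two sides over Q[eps] have the same rational part, and the equality of
    their eps-parts is the derivation condition. *)
Lemma Gam_autW_der_stab psi : primitive psi ->
  Delta_compat (Gam_autW (dl 1 psi : series (wordX gT) dualQ)) <->
  Delta_der (Gam_autW_der psi).
Proof.
move=> pp; have p1 := dl_mono_primitive pp.
have cG := chom_clin (Gam_autW_chom p1).
have [_ cD] := dual_clin (Gam_autW_dl psi) cG.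
have G m : Gam_autW (dl 1 psi) (mono m) = dl (mono m) (Gam_autW_der psi (mono m)).
  by rewrite -[mono m]dl_mono Gam_autW_dl.
have eqn m : tens_map (Gam_autW (dl 1 psi)) (Gam_autW (dl 1 psi)) (DeltaW (mono m))
    = dl (DeltaW (mono m)) (tens_map (Gam_autW_der psi) id (DeltaW (mono m))
                            + tens_map id (Gam_autW_der psi) (DeltaW (mono m))).
  rewrite -[mono m in LHS]dl_mono DeltaW_dl (clin0 (@DeltaW_clin gT ratQ)).
  exact: (tens_map_dl _ G G).
have eqn' m : DeltaW (Gam_autW (dl 1 psi) (mono m)) =
    dl (DeltaW (mono m)) (DeltaW (Gam_autW_der psi (mono m))).
  by rewrite G DeltaW_dl.
split=> [/(Delta_compatP cG) st|/(Delta_derP cD) st].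
  apply/(Delta_derP cD) => m mW; have := st m mW.
  by rewrite eqn eqn' => /dl_inj[].
apply/(Delta_compatP cG) => m mW.
by rewrite eqn eqn' st.
Qed.

Lemma gam_derW_stab psi : Delta_der (gam_derW psi) <-> Delta_der (Gam_autW_der psi).
Proof.
set c := coef_x0x1 psi 0.
have E : gam_derW psi = (fun a => c *: sad (e1 gT ratQ) a + Gam_autW_der psi a).
  by apply/funext => a; apply: gam_derWE.
have E' : Gam_autW_der psi = (fun a => - c *: sad (e1 gT ratQ) a + gam_derW psi a).
  by apply/funext => a; rewrite gam_derWE scaleNr addKr.
split=> st; first by rewrite E'; apply: Delta_der_lin => //; apply: Delta_der_e1.
by rewrite E; apply: Delta_der_lin => //; apply: Delta_der_e1.
Qed.

Lemma Stab_dl psi : Stab (dl 1 psi : series (wordX gT) dualQ) <-> stab psi.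
Proof.
split=> [/StabP[/grouplike_dl pp st]|[pp st]].
  by split; [exact: pp|exact: (gam_derW_stab psi).2 ((Gam_autW_der_stab pp).1 st)].
apply/StabP; split; first exact/grouplike_dl.
exact: (Gam_autW_der_stab pp).2 ((gam_derW_stab psi).1 st).
Qed.

End DeltaDerivations.

Lemma Lie_ker_Stab (gT : finGroupType) :
  Lie_ker (fun k : qalg => @Stab gT k) = [set one_eps psi | psi in @stab gT ratQ].
Proof.
apply/seteqP; split=> [Psi [SP aP]|_ [psi sp <-]]; last first.
  by split; rewrite one_epsE; [apply/Stab_dl|apply: smap_dual_aug].
have [psi PE] := dl_exists Psi; rewrite aP in PE.
by exists psi; rewrite ?one_epsE -?PE //; apply/Stab_dl; rewrite -PE.
Qed.

(** * The Lie bracket and the commutator of derivations *)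

Section LieBracket.
Variable gT : finGroupType.
Local Notation V := (series (vmon gT) ratQ).
Local Notation QX := (series (wordX gT) ratQ).
Implicit Types (psi : QX) (a b : V).

(** The element p for which [gam_derW psi] is ad p + [derV0 psi], hence ad p on e_0 and on G, which
    [derV0 psi] kills. *)
Definition gam_ad psi : V := beta1 psi - ps_eval (gam psi) (- e1 gT ratQ).

Lemma gam_derW_ad psi a : gam_derW psi a = sad (gam_ad psi) a + derV0 psi a.
Proof.
by rewrite /gam_derW /derV1 [LHS]addrA -sadDl /gam_ad (addrC (beta1 psi)).
Qed.

Lemma gam_derW_e0 psi : gam_derW psi (e0 gT ratQ) = sad (gam_ad psi) (e0 gT ratQ).
Proof. by rewrite gam_derW_ad derV0_e0 addr0. Qed.

Lemma gam_derW_egrp psi g :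
  gam_derW psi (egrp ratQ g) = sad (gam_ad psi) (egrp ratQ g).
Proof. by rewrite gam_derW_ad derV0_egrp addr0. Qed.

Lemma gam_derW_clin psi : primitive psi -> clin (gam_derW psi).
Proof.
move=> pp; have cG := chom_clin (Gam_autW_chom (dl_mono_primitive pp)).
have [_ cD] := dual_clin (Gam_autW_dl psi) cG.
apply: (clin_eq (fun a => esym (gam_derWE psi a))).
by apply: clin_add => //; apply: clin_scale; apply: sad_clin.
Qed.

Lemma gam_derWM psi a b : primitive psi ->
  gam_derW psi (a * b) = gam_derW psi a * b + a * gam_derW psi b.
Proof.
move=> pp; rewrite !gam_derWE sadM.
rewrite (dual_derivation (Gam_autW_dl psi) (Gam_autW_chom (dl_mono_primitive pp))).
move: (sad _ a) (sad _ b) (Gam_autW_der psi a) (Gam_autW_der psi b) => s t u v.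
by rewrite mulrDl mulrDr sscalerAl sscalerAr scalerDr addrACA.
Qed.

Lemma gam_derW_e1 psi : primitive psi -> gam_derW psi (e1 gT ratQ) = 0.
Proof.
move=> pp; rewrite gam_derWE /sad subrr scaler0 add0r.
have := Gam_autW_dl psi (e1 gT ratQ); rewrite dl_mono Gam_autW_e1.
  by rewrite -[e1 gT dualQ]dl_mono => /dl_inj[_ <-].
exact: dl_mono_primitive.
Qed.

Lemma derivation_one D : (forall a b, D (a * b) = D a * b + a * D b) -> D (1 : V) = 0 :> V.
Proof.
by move=> DM; apply: (addrI (D 1)); rewrite addr0 -{3}[1]mulr1 DM mulr1 mul1r.
Qed.

Lemma gam_derW_W psi a : primitive psi -> W a -> W (gam_derW psi a).
Proof.
move=> pp [c [v ->]]; have cD := gam_derW_clin pp.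
have d1 := derivation_one (fun a b => gam_derWM a b pp).
exists 0, (gam_derW psi v); rewrite (clinD cD) (clinZ cD) d1 scaler0.
by rewrite gam_derWM // gam_derW_e1 // mulr0 addr0 scale0r.
Qed.

Lemma gam_derW_ps_eval psi (f : pseries ratQ) : primitive psi ->
  gam_derW psi (ps_eval f (- e1 gT ratQ)) = 0.
Proof.
move=> pp; have cD := gam_derW_clin pp; have [ce c1 cM] := ps_eval_e1_chom gT ratQ.
move: f; apply: (derivation_word_ext
  (phi := fun f => ps_eval f (- e1 gT ratQ))
  (psi := fun f => ps_eval f (- e1 gT ratQ))) => //.
- exact: clin_comp cD ce.
- exact: clin_zero.
- by move=> f g /=; rewrite cM gam_derWM.
- by move=> f g; rewrite mul0r mulr0 addr0.
by case; rewrite /= ps_eval_e1_letter (clinN cD) gam_derW_e1 // oppr0.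
Qed.

(** A continuous derivation is determined by its values on the generators of V. This reduces
    identities between the derivations [gam_derW psi] to identities between the elements
    [gam_ad psi]. *)
Lemma gam_derW_unique psi (D : V -> V) : primitive psi -> clin D ->
  (forall a b, D (a * b) = D a * b + a * D b) -> D (e1 gT ratQ) = 0 ->
  D (e0 gT ratQ) = sad (gam_ad psi) (e0 gT ratQ) ->
  (forall g, D (egrp ratQ g) = sad (gam_ad psi) (egrp ratQ g)) ->
  gam_derW psi =1 D.
Proof.
move=> pp cD DM D1 D0 Dg; apply: (derivation_V_ext (phi := id)) => //.
- exact: gam_derW_clin.
- by move=> a b; apply: gam_derWM.
- by rewrite gam_derW_e0.
- by rewrite gam_derW_e1.
by move=> g; rewrite gam_derW_egrp.
Qed.

Lemma gam_lin (c : ratQ) psi psi' : gam (c *: psi + psi') = c *: gam psi + gam psi'.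
Proof.
apply/seriesP => w; rewrite scoefD scoefZ /=; case: ifP => _; last first.
  by rewrite mulr0 addr0.
by rewrite /qscale mulrDr mulrCA.
Qed.

Lemma gam_ad_lin (c : ratQ) psi psi' :
  gam_ad (c *: psi + psi') = c *: gam_ad psi + gam_ad psi'.
Proof.
rewrite /gam_ad gam_lin (chom_clin (ps_eval_e1_chom gT ratQ)).1.
rewrite (chom_clin (beta1_chom gT ratQ)).1.
by rewrite opprD addrACA scalerBr.
Qed.

Lemma gam_derW_lin (c : ratQ) psi psi' : primitive psi -> primitive psi' ->
  primitive (c *: psi + psi') ->
  gam_derW (c *: psi + psi') =1 (fun a => c *: gam_derW psi a + gam_derW psi' a).
Proof.
move=> pp pp' pc; apply: gam_derW_unique => //.
- apply: clin_add; last exact: gam_derW_clin.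
  by apply: clin_scale; apply: gam_derW_clin.
- move=> a b; rewrite !gam_derWM //.
  move: (gam_derW _ a) (gam_derW _ b) (gam_derW _ a) (gam_derW _ b) => s t u v.
  by rewrite scalerDr mulrDl mulrDr sscalerAl sscalerAr addrACA.
- by rewrite !gam_derW_e1 // scaler0 addr0.
- by rewrite !gam_derW_e0 gam_ad_lin (sadDl (c *: _)) sadZl.
by move=> g; rewrite !gam_derW_egrp gam_ad_lin (sadDl (c *: _)) sadZl.
Qed.

(** By [coef_x0x1_s_op], [gam] of the bracket is 0. Moreover [gam_derW psi1] kills series in e_1, so
    it acts on [gam_ad psi2] through [beta1 psi2] alone, where [derV0] becomes [derX]. An identity
    between commutators remains. *)
Lemma gam_ad_bracket psi1 psi2 : primitive psi1 -> primitive psi2 ->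
  gam_derW psi1 (gam_ad psi2) - gam_derW psi2 (gam_ad psi1) =
  gam_ad (lie_bracket psi1 psi2) + sad (gam_ad psi1) (gam_ad psi2).
Proof.
move=> p1 p2; have cb := chom_clin (beta1_chom gT ratQ).
have [_ _ bM] := beta1_chom gT ratQ.
have gam0 : gam (lie_bracket psi1 psi2) = 0.
  apply/seriesP => w /=; case: ifP => // _.
  rewrite [X in qscale _ X](_ : _ = coef_x0x1 (s_op psi1 psi2) (size w).-1
    - coef_x0x1 (s_op psi2 psi1) (size w).-1) //.
  by rewrite !coef_x0x1_s_op // subr0 /qscale mulr0.
have [ce ce1 _] := ps_eval_e1_chom gT ratQ.
rewrite {1 3}/gam_ad gam0 (clin0 ce) subr0.
rewrite (clinB (gam_derW_clin p1)) (clinB (gam_derW_clin p2)).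
rewrite (gam_derW_ps_eval _ p1) (gam_derW_ps_eval _ p2) !subr0 !gam_derW_ad !derV0_beta1.
rewrite /lie_bracket /s_op (clinB cb) !(clinD cb) !bM /gam_ad.
set B1 := beta1 psi1; set B2 := beta1 psi2.
(* The two sides now differ by the commutator of the series [C1] and [C2] in e_1, which vanishes
   since power series in one variable commute. *)
have := ps_eval_e1M gT (gam psi1) (gam psi2).
rewrite pseries_mulC ps_eval_e1M.
set C1 := ps_eval (gam psi1) _; set C2 := ps_eval (gam psi2) _ => CC.
rewrite /sad !(mulrDl, mulrDr, mulrN, mulNr, mulrA, opprD, opprK) CC.
by apply/seriesP => m; rewrite !(scoefD, scoefN); ring.
Qed.

(** Write D_i for the two derivations and p_i for their [gam_ad]. On e_0 and G the commutator of D_1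
    and D_2 is ad of D_1 p_2 - D_2 p_1 - [p_1, p_2], which [gam_ad_bracket] identifies. *)
Lemma gam_derW_bracket psi1 psi2 : primitive psi1 -> primitive psi2 ->
  gam_derW (lie_bracket psi1 psi2) =1
  (fun a => gam_derW psi1 (gam_derW psi2 a) - gam_derW psi2 (gam_derW psi1 a)).
Proof.
move=> p1 p2; have c1 := gam_derW_clin p1; have c2 := gam_derW_clin p2.
have d1 : is_derivation (gam_derW psi1) by move=> a b; apply: gam_derWM.
have d2 : is_derivation (gam_derW psi2) by move=> a b; apply: gam_derWM.
have br := gam_ad_bracket p1 p2.
apply: gam_derW_unique.
- exact: primitive_lie_bracket.
- exact: clin_sub (clin_comp c1 c2) (clin_comp c2 c1).
- exact: (derivation_comm c1 c2 d1 d2).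
- by rewrite (gam_derW_e1 p1) (gam_derW_e1 p2) (clin0 c1) (clin0 c2) subr0.
- rewrite (gam_derW_e0 psi1) (gam_derW_e0 psi2) (derivation_sad _ _ c1 d1).
  rewrite (derivation_sad _ _ c2 d2) (gam_derW_e0 psi1) (gam_derW_e0 psi2).
  exact: sad_bracket br.
move=> g; rewrite (gam_derW_egrp psi1) (gam_derW_egrp psi2).
rewrite (derivation_sad _ _ c1 d1) (derivation_sad _ _ c2 d2).
rewrite (gam_derW_egrp psi1) (gam_derW_egrp psi2).
exact: sad_bracket br.
Qed.

End LieBracket.

Lemma stab_lie_subalgebra (gT : finGroupType) : lie_subalgebra (@stab gT ratQ).
Proof.
have cc := chom_clin (coprod_chom gT ratQ).
have p0 : primitive (0 : series (wordX gT) ratQ).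
  by rewrite /primitive /= (clin0 cc) tens0l tens0r addr0.
have pL (c : rat) (x y : series (wordX gT) ratQ) :
    primitive x -> primitive y -> primitive ((c : ratQ) *: x + y).
  move=> px py; rewrite /primitive /= cc.1 px py.
  rewrite (clin_tensl 1 (@clin_id _ _)).1 (clin_tensr 1 (@clin_id _ _)).1.
  by rewrite scalerDr addrACA.
have sP psi : stab psi <-> primitive psi /\ Delta_der (@gam_derW gT ratQ psi) by [].
have s0 : stab (0 : series (wordX gT) ratQ).
  apply/sP; split; first exact: p0.
  rewrite (_ : gam_derW 0 = fun=> 0); first exact: Delta_der_zero.
  (* The combination -1 times 0 plus 0 is 0 again, so linearity writes the value at 0 as a
     difference of equal terms. *)
  apply/funext => a; have := gam_derW_lin (c := -1) p0 p0 (pL _ _ _ p0 p0) a.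
  by rewrite scaler0 addr0 scaleN1r addNr.
split; [by move=> psi /sP[]|exact: s0| |].
  move=> c x y /sP[px sx] /sP[py sy]; have pc := pL c x y px py.
  apply/sP; split; first exact: pc.
  rewrite (funext (gam_derW_lin px py pc)); exact: (Delta_der_lin _ sx sy).
move=> x y /sP[px sx] /sP[py sy]; apply/sP; split; first exact: primitive_lie_bracket.
rewrite (funext (gam_derW_bracket px py)); apply: Delta_der_bracket sx sy.
- exact: gam_derW_clin.
- exact: gam_derW_clin.
- by move=> a; apply: gam_derW_W.
by move=> a; apply: gam_derW_W.
Qed.

Theorem proposition4p3p3 (gT : finGroupType) (abelG : abelian [set: gT]%SET) :
  affine_group_scheme
    (fun (k k' : qalg) (f : qalg_hom k k') => @smap (wordX gT) k k' f)
    (fun k : qalg => @Stab gT k)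
    (fun k : qalg => @circast gT k)
    (fun k : qalg => 1)
  /\ Lie_ker (fun k : qalg => @Stab gT k) = [set one_eps psi | psi in @stab gT ratQ]
  /\ lie_subalgebra (@stab gT ratQ).
Proof.
split; first exact: affine_of_closed (Stab_group_functor gT) (@Stab_closed gT).
by split; [apply: Lie_ker_Stab|apply: stab_lie_subalgebra].
Qed.
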